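(* (Non-smooth Picone inequality.) Let $\Omega\subseteq\mathbb{R}^N$ be open and let $H:\mathbb{R}^N\to[0,\infty[$ be convex and positively $p$-homogeneous for some $p\ge1$. Let $u,v\in W^{1,1}_{\rm loc}(\Omega)\cap L^\infty_{\rm loc}(\Omega)$ be such that $\inf_\Omega u>0$ and $\inf_\Omega v\ge0$, and let $\xi:\Omega\to\mathbb{R}^N$ be a Lebesgue measurable function such that $\xi(x)\in\partial H(Du(x))$ for a.e. $x\in\Omega$. Then $$\frac1p\left(\xi,\,D\frac{v^p}{u^{p-1}}\right)\le H(Dv)\qquad\text{a.e. in }\Omega.$$ Suppose additionally that $H$ is strictly convex, $\Omega$ is connected and equality holds a.e. in $\Omega$ in the previous inequality, i.e. $\frac1p\left(\xi,\,D\frac{v^p}{u^{p-1}}\right)= H(Dv)$ a.e. in $\Omega$. Then $v=k\,u$ for some $k>0$.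
   Context: $H$ is positively $p$-homogeneous if $H(\lambda z)=\lambda^pH(z)$ for all $\lambda>0$, $z\in\mathbb{R}^N$; it is not assumed even or differentiable. $\partial H(w)=\{\xi\in\mathbb{R}^N: H(w+z)-H(w)\ge(\xi,z)\ \forall z\in\mathbb{R}^N\}$ is the convex subdifferential of $H$ at $w$, where $(\cdot,\cdot)$ is the Euclidean scalar product. $\inf_\Omega$ is the essential infimum and $D$ the weak gradient.
   Formalization: In the equality case it is additionally assumed that v is not a.e. zero in Ω: for v = 0 equality holds trivially, but v = ku with u > 0 would force k = 0, so the claim k > 0 fails as printed. *)

(* Defs.v *)
From HB Require Import structures.
From mathcomp Require Import all_boot all_order all_algebra.
From mathcomp Require Import all_classical all_reals all_analysis.
From mathcomp Require Import ess_sup_inf.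

Set Implicit Arguments.
Unset Strict Implicit.
Unset Printing Implicit Defensive.

Import Order.TTheory GRing.Theory Num.Theory.
Import numFieldNormedType.Exports.

Local Open Scope classical_set_scope.
Local Open Scope ring_scope.

Section lebesgue.
Context {R : realType}.

(* The sigma-algebra generated by the coordinate functions, i.e. the Borel
   sigma-algebra of R^n. *)
Definition cylinder n : set (set 'rV[R]_n) :=
  [set A | exists i : 'I_n, exists2 B : set R,
     measurable B & A = (fun x : 'rV[R]_n => x 0 i) @^-1` B].

Definition borelRV n := g_sigma_algebraType (@cylinder n).

Definition cons_rv n (p : borelRV n * measurableTypeR R) : borelRV n.+1 :=
  row_mx (p.2%:M : 'rV[R]_1) (p.1 : 'rV[R]_n).

Lemma measurable_cons_rv n : measurable_fun setT (@cons_rv n).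
Proof.
apply: (@measurability _ _ _ _ setT (@cons_rv n) (@cylinder n.+1)) => //.
move=> _ [_ [i [B mB ->]] <-]; rewrite setTI -comp_preimage.
rewrite -[X in measurable X]setTI.
suff : measurable_fun setT ((fun x : 'rV[R]_n.+1 => x 0 i) \o @cons_rv n).
  by apply.
case: (split_ordP (i : 'I_(1 + n))) => j ij.
  rewrite (_ : _ \o _ = snd); first exact: measurable_snd.
  apply/funext => p /=; rewrite /cons_rv ij (@row_mxEl R 1 1 n).
  by rewrite (ord1 j) mxE eqxx mulr1n.
rewrite (_ : _ \o _ = (fun x : borelRV n => (x : 'rV[R]_n) 0 j) \o fst); last first.
  by apply/funext => p /=; rewrite /cons_rv ij (@row_mxEr R 1 1 n).
apply: measurableT_comp => // _ Y mY; rewrite setTI.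
by apply: sub_sigma_algebra; exists j; exists Y.
Qed.

Definition lebesgue_cons n (mu : {measure set (borelRV n) -> \bar R}) :
    {measure set (borelRV n.+1) -> \bar R} :=
  measure_function_pushforward__canonical__measure_function_Measure
    (mu \x lebesgue_measure)%E (@measurable_cons_rv n).

Fixpoint lebesgue_borel n : {measure set (borelRV n) -> \bar R} :=
  match n return {measure set (borelRV n) -> \bar R} with
  | 0 => dirac ((0 : 'rV[R]_0) : borelRV 0)
  | n.+1 => lebesgue_cons (lebesgue_borel n)
  end.

(* R^n with the completed sigma-algebra, i.e. that of the Lebesgue measurable
   sets; this type is convertible to 'rV[R]_n. *)
Definition lebesgueRV n : measurableType _ :=
  caratheodory_type (lebesgue_borel n)^*%mu.

Definition lebesgue n : {measure set (lebesgueRV n) -> \bar R} :=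
  @completed_measure_extension _ _ _ (lebesgue_borel n).

End lebesgue.

Arguments lebesgue {R} n.

Section sobolev.
Context {R : realType} {n : nat}.
Local Notation E := 'rV[R]_n.
Local Notation mu := (@lebesgue R n).
Implicit Types (Omega : set E) (u f phi : E -> R) (G : E -> E).

Definition ae_in Omega (P : E -> Prop) : Prop :=
  {ae mu, forall x : E, Omega x -> P x}.

Definition lebesgue_measurable Omega f : Prop :=
  measurable_fun (Omega : set (lebesgueRV n)) (f : lebesgueRV n -> R).

Definition L1loc Omega f : Prop :=
  lebesgue_measurable Omega f /\
  forall K : set E, compact K -> K `<=` Omega ->
    (\int[mu]_(x in K) `|f x|%:E < +oo)%E.

Definition Linftyloc Omega f : Prop :=
  lebesgue_measurable Omega f /\
  forall K : set E, compact K -> K `<=` Omega ->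
    exists M : R, ae_in K (fun x => `|f x| <= M).

(* Points outside Omega are sent to +oo, so that they do not contribute. *)
Definition ess_inf_in Omega f : \bar R :=
  ess_inf mu (patch (cst +oo%E) Omega (EFin \o f)).

Definition partial (i : 'I_n) f : E -> R := fun x => 'D_(delta_mx 0 i) f x.

Definition smooth f : Prop := forall s : seq 'I_n,
  let g := foldr partial f s in
  continuous g /\ forall (i : 'I_n) (x : E), derivable g x (delta_mx 0 i).

Definition supp f : set E := closure [set x | f x != 0].

Definition test_function Omega phi : Prop :=
  [/\ smooth phi, compact (supp phi) & supp phi `<=` Omega].

Definition weak_gradient Omega u G : Prop :=
  forall i : 'I_n, L1loc Omega (fun x => G x 0 i) /\
    forall phi, test_function Omega phi ->
      \int[mu]_(x in Omega) (u x * partial i phi x) =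
      - \int[mu]_(x in Omega) (G x 0 i * phi x).

Definition W11loc Omega u : Prop :=
  L1loc Omega u /\ exists G, weak_gradient Omega u G.

(* The weak gradient is determined up to a null set; [wgrad Omega u] is a
   chosen representative, meaningful when [u] is in [W11loc Omega]. *)
Definition wgrad Omega u : E -> E :=
  xget (fun=> 0) [set G | weak_gradient Omega u G].

End sobolev.

Section convexity.
Context {R : realType} {n : nat}.
Local Notation E := 'rV[R]_n.
Implicit Types (H : E -> R).

Definition dotv (z w : E) : R := \sum_(i < n) z 0 i * w 0 i.

Definition positively_homogeneous (p : R) H : Prop :=
  forall (lambda : R) (z : E), 0 < lambda -> H (lambda *: z) = lambda `^ p * H z.

Definition strictly_convex H : Prop :=
  forall (x y : E) (t : R), x != y -> 0 < t -> t < 1 ->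
    H (t *: x + (1 - t) *: y) < t * H x + (1 - t) * H y.

Definition subdifferential H (w : E) : set E :=
  [set xi | forall z : E, dotv xi z <= H (w + z) - H w].

End convexity.

(* Main.v *)
Require Import Defs.
From HB Require Import structures.
From mathcomp Require Import all_boot all_order all_algebra.
From mathcomp Require Import all_classical all_reals all_analysis.
From mathcomp Require Import measurable_realfun ess_sup_inf ring lra.

Set Implicit Arguments.
Unset Strict Implicit.
Unset Printing Implicit Defensive.

Import Order.TTheory GRing.Theory Num.Theory.
Import numFieldNormedType.Exports.

Local Open Scope classical_set_scope.
Local Open Scope ring_scope.

(** Let [r = v / u].  By the chain and Leibniz rules the weak gradient of
    [v^p u^(1-p)] is [p r^(p-1) Dv + (1-p) r^p Du], and Euler's identity
    [(xi, Du) = p H(Du)] holds for every subgradient of a [p]-homogeneous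
    function.  The left-hand side of the inequality is therefore
    [r^(p-1) (xi, Dv) + (1-p) r^p H(Du)], and that this is at most [H(Dv)] is
    the subgradient inequality at [Du] for the increment [r^-1 Dv - Du],
    multiplied by [r^p] ([picone_ratio]; the value [r = 0] is treated apart).
    If equality holds and [H] is strictly convex then [r^-1 Dv = Du]
    ([picone_ratio_eq]), that is, [v / u] has zero weak gradient; on a connected
    open set it is then constant.

    Two facts about weak derivatives carry this argument.

    The chain rule for a function of a locally bounded [v]
    ([weak_partial_chain]), applied to powers, and to the square for the Leibniz
    rule.  It has to allow for a function that is differentiable only relatively
    to a closed half-line, since [v] may vanish.  It is obtained from difference
    quotients: testing against smooth functions and a mean value theorem show
    that the distance in [L^1] from the difference quotient to the weak
    derivative is at most that from the derivative to its translates
    ([weak_difference]), which tends to zero by continuity of translations in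
    [L^1]; along a sequence of steps the quotients then converge almost
    everywhere with an integrable majorant, and dominated convergence passes to
    the limit in a discrete integration by parts.  That integrals against smooth
    functions control [L^1] norms ([bump_duality]), which also gives the
    uniqueness of weak derivatives, is proved with an explicit algebra of smooth
    functions instead of mollifiers.

    The constancy of a function with zero weak gradient ([ae_constant]).  By
    [weak_difference] such a function is invariant almost everywhere under
    each small translation, hence so are its sublevel sets; Tonelli's theorem
    makes a set with this property locally null or conull
    ([invariant_set_trivial]), and connectedness makes it globally so. *)

(** * Lebesgue measure: translations, balls and properties almost everywhere *)

Section borel.
Context {R : realType}.

Lemma measurable_coord n (i : 'I_n) :
  measurable_fun setT ((fun x : 'rV[R]_n => x 0 i) : borelRV n -> R).
Proof.
by move=> _ Y mY; rewrite setTI; apply: sub_sigma_algebra; exists i; exists Y.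
Qed.

Lemma measurable_to_borelRV d (T : measurableType d) n (f : T -> 'rV[R]_n) :
  (forall i, measurable_fun setT (fun t => f t 0 i)) ->
  measurable_fun setT (f : T -> borelRV n).
Proof.
move=> mf; apply: (@measurability _ _ T (@borelRV R n) setT f (@cylinder R n)) => //.
move=> _ [_ [i [B mB ->]] <-]; rewrite setTI -comp_preimage.
by rewrite -[X in measurable X]setTI; exact: (mf i).
Qed.

Lemma measurable_borel_shift n (h : 'rV[R]_n) :
  measurable_fun setT ((fun x => x + h) : borelRV n -> borelRV n).
Proof.
apply: measurable_to_borelRV => i.
under eq_fun do rewrite mxE.
by apply: measurable_funD => //; exact: measurable_coord.
Qed.

Lemma lebesgue_measure_shift (c : R) (A : set R) : measurable A ->
  lebesgue_measure ((fun x : R => x + c) @^-1` A) = lebesgue_measure A.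
Proof.
move=> mA.
have mc : measurable_fun setT ((fun x : R => x + c) : _ -> measurableTypeR R).
  exact: measurable_funD.
pose nu := pushforward (lebesgue_measure : set (measurableTypeR R) -> \bar R)
   ((fun x : R => x + c) : measurableTypeR R -> measurableTypeR R).
pose nu' := measure_function_pushforward__canonical__measure_function_Measure
   (lebesgue_measure : {measure set (measurableTypeR R) -> \bar R}) mc.
apply/esym; rewrite -[RHS]/(nu' A); apply: lebesgue_measure_unique => //.
move=> _ [[a b]] _ <-; rewrite /= /pushforward.
rewrite (_ : _ @^-1` _ = `]a - c, b - c]%classic); last first.
  by apply/seteqP; split => x /=; rewrite !in_itv/= ltrBlDr lerBrDr.
rewrite !lebesgue_measure_itv/= !lte_fin ltrD2r.
by case: ifP => // _; rewrite -!EFinD; congr (_%:E); ring.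
Qed.

Lemma row_mx_shift n (x : 'rV[R]_n) (t : R) (h : 'rV[R]_n.+1) :
  row_mx (t%:M : 'rV[R]_1) x + h =
  row_mx ((t + h 0 ord0)%:M : 'rV[R]_1) (x + @rsubmx R 1 1 n h).
Proof.
apply/rowP => i; rewrite mxE; case: (split_ordP (i : 'I_(1 + n))) => j ->.
  rewrite !row_mxEl (ord1 j) !mxE eqxx !mulr1n; congr (_ + h 0 _).
  exact: val_inj.
by rewrite !row_mxEr !mxE.
Qed.

(** Induction on the dimension: Tonelli's formula for the product with the line,
    whose Lebesgue measure is invariant under translations. *)
Lemma lebesgue_borel_shift n (h : 'rV[R]_n) (A : set (borelRV n)) :
  measurable A ->
  @lebesgue_borel R n ((fun x : 'rV[R]_n => x + h) @^-1` A) = lebesgue_borel n A.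
Proof.
elim: n h A => [|n IHn] h A mA.
  congr (dirac _ _); apply/seteqP; split=> x /=; by rewrite (thinmx0 (x + h)) (thinmx0 x).
rewrite /= /pushforward /product_measure1/=.
pose h' := @rsubmx R 1 1 n h; pose s := h 0 ord0.
pose B := @cons_rv R n @^-1` A.
have mB : measurable B by rewrite -[B]setTI; exact: measurable_cons_rv.
transitivity (\int[lebesgue_borel n]_x (fun y => lebesgue_measure (xsection B y)) ((x : 'rV[R]_n) + h')%R)%E.
  apply: eq_integral => x _ /=.
  rewrite -[RHS](@lebesgue_measure_shift s); last exact: measurable_xsection.
  congr (lebesgue_measure _); apply/seteqP; split => t;
    by rewrite /xsection /= !inE /B /= /cons_rv/= row_mx_shift.
rewrite -[LHS](@ge0_integral_pushforward _ _ _ _ R _ (@measurable_borel_shift n h')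
   (lebesgue_borel n) setT (fun y => lebesgue_measure (xsection B y))) //.
- apply: (@eq_measure_integral _ _ _ _ (lebesgue_borel n) (measure_function_pushforward__canonical__measure_function_Measure
    (lebesgue_borel n) (@measurable_borel_shift n h'))) => Y mY _.
  exact: IHn.
- exact: (measurable_fun_xsection _ mB).
Qed.

Definition cube n (c : 'rV[R]_n) (r : R) : set 'rV[R]_n :=
  [set x | forall i, `|c 0 i - x 0 i| < r].

Lemma ball_cube n (c : 'rV[R]_n) (r : R) : 0 < r -> ball c r = cube c r.
Proof.
move=> r0; apply/seteqP; split => x /=.
  by case=> _ h i; exact: h.
by move=> h; split => // i j; rewrite (ord1 i); exact: h.
Qed.

Lemma ball_le0 n (c : 'rV[R]_n) (r : R) : r <= 0 -> ball c r = set0.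
Proof. by move=> r0; apply/seteqP; split => x //= [+ _]; rewrite ltNge r0. Qed.

Lemma measurable_cube n (c : 'rV[R]_n) (r : R) :
  measurable (cube c r : set (borelRV n)).
Proof.
rewrite (_ : cube c r = \bigcap_(i in [set: 'I_n])
    ((fun x : borelRV n => (x : 'rV[R]_n) 0 i) @^-1` ball (c 0 i) r)); last first.
  by apply/seteqP; split => x /= h i; [move=> _|]; apply: h.
apply: fin_bigcap_measurable => [|i _]; first exact: finite_finset.
rewrite -[X in measurable X]setTI.
by apply: measurable_coord => //; exact: measurable_ball.
Qed.

Lemma lebesgue_borel_cube n (c : 'rV[R]_n) (r : R) : 0 < r ->
  lebesgue_borel n (cube c r) = ((r *+ 2) ^+ n)%:E.
Proof.
move=> r0; elim: n c => [|n IHn] c.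
  by rewrite expr0 /= diracE mem_set//= => -[].
rewrite /= /pushforward.
rewrite (_ : _ @^-1` _ = cube (@rsubmx R 1 1 n c) r `*` ball (c 0 ord0) r); last first.
  apply/seteqP; split => -[x t] /=.
    move=> h; split.
      move=> i /=; have := h (rshift 1 i : 'I_(1 + n)).
      by rewrite /cons_rv /= (@row_mxEr R 1 1 n) !mxE.
    have := h (lshift n ord0 : 'I_(1 + n)).
    rewrite /cons_rv /= (@row_mxEl R 1 1 n) mxE eqxx mulr1n /ball/=.
    by congr (`|c _ _ - _| < _); exact: val_inj.
  case=> hx ht i; case: (split_ordP (i : 'I_(1 + n))) => j ->.
    rewrite /cons_rv /= (@row_mxEl R 1 1 n) (ord1 j) mxE eqxx mulr1n.
    move: ht; rewrite /ball/=.
    by congr (`|c _ _ - _| < _); exact: val_inj.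
  by have := hx j; rewrite /cons_rv /= (@row_mxEr R 1 1 n) !mxE.
rewrite product_measure1E; [|exact: measurable_cube|exact: measurable_ball].
rewrite IHn [X in (_ * X)%E](_ : _ = (r *+ 2)%:E) -?EFinM -?exprSr//.
exact: lebesgue_measure_ball (ltW r0).
Qed.

Lemma lebesgue_borel_ball_gt0 n (c : 'rV[R]_n) r : 0 < r ->
  (0 < lebesgue_borel n (ball c r))%E.
Proof.
by move=> r0; rewrite ball_cube// lebesgue_borel_cube// lte_fin exprn_gt0// mulrn_wgt0.
Qed.

Lemma lebesgue_borel_ball_lty n (c : 'rV[R]_n) r :
  (lebesgue_borel n (ball c r) < +oo)%E.
Proof.
have [r0|r0] := ltP 0 r; last by rewrite ball_le0// measure0.
by rewrite ball_cube// lebesgue_borel_cube// ltry.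
Qed.

Lemma measurable_ballRV n (c : 'rV[R]_n) r : measurable (ball c r : set (borelRV n)).
Proof.
have [r0|r0] := ltP 0 r; last by rewrite ball_le0.
by rewrite ball_cube//; exact: measurable_cube.
Qed.

(** A countable base of the topology; the index type is countable, so that
    unions over it become unions over [nat] through [unpickle]. *)
Definition rat_ball n (qm : 'rV[rat]_n * nat) : set 'rV[R]_n :=
  ball (map_mx ratr qm.1 : 'rV[R]_n) (qm.2.+1%:R^-1 : R).

Lemma exists_rat_ball n (x : 'rV[R]_n) r : 0 < r ->
  exists2 qm : 'rV[rat]_n * nat, rat_ball qm x & rat_ball qm `<=` ball x r.
Proof.
move=> r0; have [m mr] : exists m, m.+1%:R^-1 < r / 2.
  have [m _ /(_ m (leqnn m)) mr] := near_infty_natSinv_lt (PosNum (divr_gt0 r0 (ltr0Sn R 1))).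
  by exists m.
have m0 : 0 < m.+1%:R^-1 :> R by rewrite invr_gt0.
have qx (i : 'I_n) : exists q : rat, `|x 0 i - ratr q| < m.+1%:R^-1.
  have [|q] := @rat_in_itvoo R (x 0 i - m.+1%:R^-1) (x 0 i + m.+1%:R^-1).
    by rewrite ltrD2l gtrN.
  rewrite in_itv/= => /andP[q1 q2]; exists q.
  by rewrite distrC ltr_distl q1 q2.
have [q hq] := choice qx.
have bx : ball (map_mx ratr (\row_i q i) : 'rV[R]_n) m.+1%:R^-1 x.
  by rewrite ball_cube// => i; rewrite !mxE distrC; exact: hq.
exists (\row_i q i, m) => // y by_.
rewrite (splitr r); apply: (@ball_triangle _ _ (map_mx ratr (\row_i q i) : 'rV[R]_n)).
  by apply: ball_sym; apply: le_ball bx; exact: ltW.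
by apply: le_ball by_; exact: ltW.
Qed.

Lemma open_measurableRV n (U : set 'rV[R]_n) : open U ->
  measurable (U : set (borelRV n)).
Proof.
move=> oU.
rewrite (_ : U = \bigcup_k (if unpickle k is Some qm then
   if `[< @rat_ball n qm `<=` U >] then rat_ball qm else set0 else set0)); last first.
  apply/seteqP; split => x.
    move=> Ux; have /nbhs_ballP[r /= r0 rU] := open_nbhs_nbhs (conj oU Ux).
    have [qm qx qr] := exists_rat_ball x r0.
    exists (pickle qm) => //=; rewrite pickleK.
    by case: asboolP => // h; exfalso; apply: h; exact: subset_trans qr rU.
  by case=> k _; case: unpickle => [qm|]//; case: asboolP => // h /h.
apply: bigcupT_measurable => k; case: unpickle => [qm|//]; case: asboolP => // _.
exact: measurable_ballRV.
Qed.

End borel.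

Section lebesgue_measure_RV.
Context {R : realType} {n : nat}.
Local Notation E := 'rV[R]_n.
Local Notation mu := (@lebesgue R n).

Lemma borel_lebesgue_measurable (A : set (@borelRV R n)) : measurable A ->
  measurable (A : set (@lebesgueRV R n)).
Proof. exact: caratheodory_measurable_mu_ext. Qed.

Lemma lebesgue_borelE (A : set (@borelRV R n)) : measurable A ->
  mu A = lebesgue_borel n A.
Proof. exact: measurable_mu_extE. Qed.

(** [mu X] is an infimum over countable Borel covers of [X], which can be
    translated; so [X] is an arbitrary set here. *)
Lemma lebesgue_outer_shift (h : E) (X : set E) :
  mu ((fun x => x + h) @^-1` X) = mu X.
Proof.
have le (Y : set E) (k : E) : (mu ((fun x : E => (x + k)%R) @^-1` Y) <= mu Y)%E.
  apply: le_ereal_inf_tmp => _ [F [mF YF] <-].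
  apply: ereal_inf_lbound; exists (fun i => (fun x : E => x + k) @^-1` F i).
    split => [i|x /= /YF[i _ Fi]]; last by exists i.
    by rewrite -[X in measurable X]setTI; exact: measurable_borel_shift.
  by apply: eq_eseriesr => i _; exact: lebesgue_borel_shift.
apply/eqP; rewrite eq_le le/=.
rewrite [leLHS](_ : _ = mu ((fun x : E => x + - h) @^-1` ((fun x : E => x + h) @^-1` X)))//.
by congr (mu _); apply/seteqP; split => x /=; rewrite subrK.
Qed.

(** Caratheodory's criterion is transported by the invariance of the outer
    measure. *)
Lemma measurable_shift (h : E) :
  measurable_fun setT ((fun x => x + h) : @lebesgueRV R n -> @lebesgueRV R n).
Proof.
move=> _ A mA; rewrite setTI.
have cA : ((lebesgue_borel n)^*%mu).-caratheodory A := mA.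
suff : ((lebesgue_borel n)^*%mu).-caratheodory ((fun x : E => x + h) @^-1` A) by [].
move=> X.
pose X' : set E := (fun x : E => x - h) @^-1` X.
have XE : X = (fun x : E => x + h) @^-1` X'.
  by apply/seteqP; split => x; rewrite /X' /= addrK.
rewrite XE -[in RHS](preimage_setI _ X' A) -[in RHS](preimage_setI _ X' (~` A)).
pose sh := lebesgue_outer_shift h.
transitivity (mu X'); first exact: sh.
by rewrite [LHS](cA X'); congr (_ + _)%E; apply/esym; exact: sh.
Qed.

Lemma lebesgue_ball_gt0 (c : E) r : 0 < r -> (0 < mu (ball c r))%E.
Proof.
by move=> r0; rewrite lebesgue_borelE ?lebesgue_borel_ball_gt0//; exact: measurable_ballRV.
Qed.

Lemma lebesgue_ball_lty (c : E) r : (mu (ball c r) < +oo)%E.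
Proof.
by rewrite lebesgue_borelE ?lebesgue_borel_ball_lty//; exact: measurable_ballRV.
Qed.

Lemma open_lebesgue_measurable (U : set E) : open U ->
  measurable (U : set (@lebesgueRV R n)).
Proof. by move=> oU; apply: borel_lebesgue_measurable; exact: open_measurableRV. Qed.

Lemma compact_lebesgue_measurable (K : set E) : compact K ->
  measurable (K : set (@lebesgueRV R n)).
Proof.
move=> cK; rewrite -(setCK K); apply: measurableC; apply: open_lebesgue_measurable.
by rewrite openC; apply: compact_closed => //; exact: norm_hausdorff.
Qed.

Lemma negligible_shift (h : E) (A : set E) : mu.-negligible A ->
  mu.-negligible ((fun x => x + h) @^-1` A).
Proof.
case=> B [mB B0 AB]; exists ((fun x : E => x + h) @^-1` B); split.
- by rewrite -[X in measurable X]setTI; exact: measurable_shift.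
- by rewrite -[RHS]B0; exact: lebesgue_outer_shift.
- by move=> x /= /AB.
Qed.

Lemma ae_lebesgue_filter : Filter (almost_everywhere mu : set_system E).
Proof. exact: (@ae_filter_ringOfSetsType _ (@lebesgueRV R n) R mu). Qed.

Lemma ae_in_sub (U V : set E) (P Q : E -> Prop) : V `<=` U ->
  (forall x, V x -> P x -> Q x) -> ae_in U P -> ae_in V Q.
Proof.
move=> VU PQ; apply: (@filterS _ _ ae_lebesgue_filter) => x Px Vx.
by apply: PQ => //; apply: Px; exact: VU.
Qed.

Lemma ae_in_all (U : set E) (P : nat -> E -> Prop) :
  (forall k, ae_in U (P k)) -> ae_in U (fun x => forall k, P k x).
Proof.
move=> /(@ae_foralln _ (@lebesgueRV R n) R mu (fun k x => U x -> P k x)).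
by apply: (@filterS _ _ ae_lebesgue_filter) => x Px Ux k; exact: Px.
Qed.

Lemma ae_in_and (U : set E) (P Q : E -> Prop) :
  ae_in U P -> ae_in U Q -> ae_in U (fun x => P x /\ Q x).
Proof.
by apply: (@filterS2 _ _ ae_lebesgue_filter) => x Px Qx Ux; split; [exact: Px|exact: Qx].
Qed.

Lemma ae_inW (U : set E) (P : E -> Prop) : (forall x, U x -> P x) -> ae_in U P.
Proof. by move=> PU; apply: (@aeW _ (@lebesgueRV R n)). Qed.

(** The rational balls on which [P] holds almost everywhere cover [U], and there
    are countably many of them. *)
Lemma ae_in_local (U : set E) (P : E -> Prop) :
  (forall x, U x -> exists2 r, 0 < r & ae_in (ball x r) P) -> ae_in U P.
Proof.
move=> h.
have : ae_in setT (fun x : E => forall k, if unpickle k is Some qm then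
    ae_in (@rat_ball R n qm) P -> rat_ball qm x -> P x else True).
  apply: ae_in_all => k; case: unpickle => [qm|]; last exact: ae_inW.
  have [Pq|Pq] := pselect (ae_in (@rat_ball R n qm) P); last exact: ae_inW.
  by move: (Pq); apply: (@filterS _ _ ae_lebesgue_filter) => x + _ _.
apply: ae_in_sub => // x Ux Px.
have [r r0 rP] := h x Ux.
have [qm qx qr] := exists_rat_ball x r0.
have := Px (pickle qm); rewrite pickleK; apply => //.
by apply: ae_in_sub rP.
Qed.

(** [B] is the intersection of countable Borel covers of [A] whose total
    measures tend to the outer measure of [A]. *)
Lemma lebesgue_measurable_borel (A : set (@lebesgueRV R n)) :
  measurable A -> (mu A < +oo)%E ->
  exists B : set (@borelRV R n), [/\ measurable B, A `<=` B & mu (B `\` A) = 0%E].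
Proof.
move=> mA Afin.
have Af : mu A \is a fin_num by rewrite ge0_fin_numE.
have cov k : exists F : (set E)^nat, measurable_cover (A : set (@borelRV R n)) F /\
   (\sum_(i <oo) lebesgue_borel n (F i) <= mu A + (k.+1%:R^-1)%:E)%E.
  have k0 : 0 < k.+1%:R^-1 :> R by rewrite invr_gt0.
  have [_ [F cF <-] /ltW Fk] := lb_ereal_inf_adherent k0 Af.
  by exists F.
have [F hF] := choice cov.
pose B := \bigcap_k \bigcup_i (F k i : set (@borelRV R n)).
have mU k : measurable (\bigcup_i (F k i : set (@borelRV R n))).
  by apply: bigcupT_measurable => i; exact: (hF k).1.1.
have mB : measurable B by exact: bigcapT_measurable.
have AB : A `<=` B by move=> x Ax k _; exact: (hF k).1.2.
exists B; split => //.
have mB' := borel_lebesgue_measurable mB.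
have BA : (mu B <= mu A)%E.
  apply/lee_addgt0Pr => e e0.
  have [m _ /(_ m (leqnn m)) /= me] := near_infty_natSinv_lt (PosNum e0).
  apply: (@le_trans _ _ (mu A + (m.+1%:R^-1)%:E)%E); last first.
    by rewrite leeD2l// lee_fin ltW.
  apply: le_trans (hF m).2; rewrite lebesgue_borelE//.
  apply: (@le_trans _ _ (lebesgue_borel n (\bigcup_i F m i))).
    by apply: le_measure; rewrite ?inE// => x; apply.
  by apply: measure_sigma_subadditive => // i; exact: (hF m).1.1.
have := measureD mB' mA; rewrite setIidr// => ->; last exact: le_lt_trans Afin.
apply/eqP; rewrite eq_le; apply/andP; split; first by rewrite sube_le0.
by rewrite sube_ge0 ?Af ?orbT// le_measure ?inE.
Qed.

End lebesgue_measure_RV.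

(** * An algebra of smooth functions *)

Section flat.
Context {R : realType}.

(** All the powers [k] are considered together because a derivative raises
    them: the linear span of these functions is stable under differentiation. *)
Definition flat (k : nat) (t : R) : R :=
  if 0 < t then t^-1 ^+ k * expR (- t^-1) else 0.

Lemma flat_ge0 k t : 0 <= flat k t.
Proof.
rewrite /flat; case: ifP => // t0.
by rewrite mulr_ge0 ?expR_ge0// exprn_ge0// invr_ge0 ltW.
Qed.

Lemma flat0_gt0 t : 0 < t -> 0 < flat 0 t.
Proof. by move=> t0; rewrite /flat t0 mul1r expR_gt0. Qed.

Lemma flat0_eq0 t : t <= 0 -> flat 0 t = 0.
Proof. by move=> t0; rewrite /flat ltNge t0. Qed.

Lemma flat0_le1 t : flat 0 t <= 1.
Proof.
rewrite /flat; case: ifP => // t0.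
by rewrite mul1r -expR0 ler_expR oppr_le0 invr_ge0 ltW.
Qed.

(** The bound that makes [flat] differentiable, with derivative zero, at the
    origin: a term of the exponential series dominates a power. *)
Lemma flat_le_linear k t : flat k t <= (k.+1`!%:R) * `|t|.
Proof.
rewrite /flat; case: ifP => t0; last by rewrite mulr_ge0.
rewrite (gtr0_norm t0) expRN ler_pdivrMr ?expR_gt0//.
have ti0 : 0 <= t^-1 by rewrite invr_ge0 ltW.
have C0 : 0 < k.+1`!%:R :> R by rewrite ltr0n fact_gt0.
have key : t^-1 ^+ k.+1 <= k.+1`!%:R * expR t^-1.
  rewrite -ler_pdivrMl// mulrC.
  by apply: le_trans (expR_ge1Dxn k ti0); rewrite lerDr.
have -> : t^-1 ^+ k = t * t^-1 ^+ k.+1.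
  by rewrite exprS mulrA divff ?mul1r// gt_eqF.
by rewrite [leRHS]mulrAC [leRHS]mulrC ler_wpM2l// ltW.
Qed.

Lemma flat_is_derive k (t : R) :
  is_derive t (1 : R) (flat k) (flat k.+2 t - k%:R * flat k.+1 t).
Proof.
have [t0|t0|->] := ltgtP t 0.
- have -> : flat k.+2 t - k%:R * flat k.+1 t = 0.
    by rewrite /flat ltNge (ltW t0)/= mulr0 subr0.
  apply: (@near_eq_is_derive _ _ _ (cst 0)).
    near=> s; rewrite /flat ltNge ltW//.
    by near: s; exact: lt_nbhsl.
- have -> : flat k.+2 t - k%:R * flat k.+1 t =
      t^-1 ^+ k.+2 * expR (- t^-1) - k%:R * (t^-1 ^+ k.+1 * expR (- t^-1)).
    by rewrite /flat t0.
  have tn : t != 0 by rewrite gt_eqF.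
  have dV : is_derive t 1 (fun s : R => s^-1) (- t ^- 2).
    have := @is_deriveV R id t 1 1 tn (is_derive_id t 1).
    by move=> /is_derive_eq; apply; rewrite scaler1.
  have dX : is_derive t 1 (fun s : R => s^-1 ^+ k) (- (k%:R * t^-1 ^+ k.+1)).
    have -> : (fun s : R => s^-1 ^+ k) = (fun s : R => s^-1) ^+ k.
      by apply/funext => s; rewrite exprfctE.
    have := @is_deriveX _ _ (fun s : R => s^-1) k t 1 _ dV.
    move=> /is_derive_eq; apply.
    case: k => [|k] /=; first by rewrite ?mul0r ?mulr0n ?scale0r ?oppr0 ?mul0r ?oppr0.
    by rewrite /GRing.scale/= -mulr_natl -(exprVn t 2) !exprS expr0; ring.
  have dE : is_derive t 1 (fun s : R => expR (- s^-1)) (t^-1 ^+ 2 * expR (- t^-1)).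
    have := @is_derive1_comp R expR (fun s => - s^-1) t _ _ (is_derive_expR _) (is_deriveN dV).
    by move=> /is_derive_eq; apply; rewrite opprK /GRing.scale/= mulrC exprVn.
  have dM : is_derive t 1 (fun s => s^-1 ^+ k * expR (- s^-1))
      (t^-1 ^+ k.+2 * expR (- t^-1) - k%:R * (t^-1 ^+ k.+1 * expR (- t^-1))).
    have := is_deriveM dX dE.
    move=> /is_derive_eq; apply.
    by rewrite /GRing.scale/= !exprS; ring.
  apply: (@near_eq_is_derive _ _ _ _ _ _ _ _ _ dM).
  near=> s; rewrite /flat ifT//.
  by near: s; exact: lt_nbhsr.
- have -> : flat k.+2 0 - k%:R * flat k.+1 0 = 0.
    by rewrite /flat ltxx/= mulr0 subr0.
  have cv : (fun h => h^-1 *: ((flat k \o shift 0) (h *: 1) - flat k 0)) @ 0^' --> (0 : R).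
    apply/cvgr0Pnorm_le => e e0; near=> h.
    rewrite /= addr0 scaler1.
    have -> : flat k 0 = 0 by rewrite /flat ltxx.
    rewrite subr0 /GRing.scale/=.
    have [h0|h0] := ltP 0 h; last by rewrite /flat ltNge h0/= mulr0 normr0 ltW.
    have -> : h^-1 * flat k h = flat k.+1 h by rewrite /flat h0 mulrA -exprS.
    rewrite ger0_norm ?flat_ge0//; apply: le_trans (flat_le_linear _ _) _.
    have C0 : 0 < k.+2`!%:R :> R by rewrite ltr0n fact_gt0.
    rewrite -ler_pdivlMl// ltW//.
    near: h; apply: dnbhs0_lt; by rewrite mulr_gt0 ?invr_gt0.
  by apply: DeriveDef; [exact: cvgP cv|exact: cvg_lim cv].
Unshelve. all: by end_near. Qed.

End flat.

Section bump_algebra.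
Context {R : realType} {n : nat}.
Local Notation E := 'rV[R]_n.

Lemma is_derive_coord (g : R -> R) (x : E) (i j : 'I_n) (dg : R) :
  is_derive (x 0 i) (1 : R) g dg ->
  is_derive x (delta_mx 0 j : E) (fun y : E => g (y 0 i)) ((i == j)%:R * dg).
Proof.
move=> [cg <-].
have [ij|ij] := eqVneq i j.
  rewrite mul1r.
  have e : (fun h : R => h^-1 *: (((fun y : E => g (y 0 i)) \o shift x) (h *: (delta_mx 0 j : E)) - g (x 0 i))) =
    (fun h : R => h^-1 *: ((g \o shift (x 0 i)) (h *: (1 : R)) - g (x 0 i))).
    by apply/funext => h; rewrite /= !mxE ij !eqxx.
  by apply: DeriveDef; rewrite /derivable /derive e.
rewrite mul0r.
have e : (fun h : R => h^-1 *: (((fun y : E => g (y 0 i)) \o shift x) (h *: (delta_mx 0 j : E)) - g (x 0 i))) =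
    (fun h : R => 0).
  by apply/funext => h; rewrite /= !mxE (negbTE ij) mulr0 add0r subrr scaler0.
by apply: DeriveDef; rewrite /derivable /derive e; [exact: is_cvg_cst|rewrite lim_cst].
Qed.

(** This class is stable under partial derivatives, whence the smoothness of its
    elements by iteration, and the products of functions [flat 0] of affine
    functions of the coordinates provide functions supported in balls.  It plays
    the role of the test functions in all density and duality arguments. *)
Inductive bump_alg : (E -> R) -> Prop :=
| bump_cst c : bump_alg (fun=> c)
| bump_flat k (i : 'I_n) (c b : R) : bump_alg (fun x => flat k (c * x 0 i + b))
| bump_add f g : bump_alg f -> bump_alg g -> bump_alg (fun x => f x + g x)
| bump_mul f g : bump_alg f -> bump_alg g -> bump_alg (fun x => f x * g x).

Lemma flat_affine_is_derive k (c b t : R) :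
  is_derive t (1 : R) (fun s => flat k (c * s + b))
    ((flat k.+2 (c * t + b) - k%:R * flat k.+1 (c * t + b)) * c).
Proof.
have da : is_derive t (1 : R) (fun s : R => c * s + b) c.
  have := is_deriveD (is_deriveZ c (is_derive_id t (1 : R))) (is_derive_cst b t (1 : R)).
  by move=> /is_derive_eq; apply; rewrite addr0 /GRing.scale/= mulr1.
exact: (@is_derive1_comp R (flat k) (fun s => c * s + b) t _ _ (flat_is_derive k _) da).
Qed.

Lemma bump_alg_is_derive (f : E -> R) : bump_alg f -> forall j : 'I_n,
  exists2 g, bump_alg g & forall x : E, is_derive x (delta_mx 0 j : E) f (g x).
Proof.
elim=> [c|k i c b|{}f g bf IHf bg IHg|{}f g bf IHf bg IHg] j.
- by exists (fun=> 0) => [|x]; [exact: bump_cst|exact: is_derive_cst].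
- exists (fun x => (i == j)%:R * ((flat k.+2 (c * x 0 i + b)
      + - k%:R * flat k.+1 (c * x 0 i + b)) * c)).
    apply: bump_mul; first exact: bump_cst.
    apply: bump_mul; last exact: bump_cst.
    apply: bump_add; first exact: bump_flat.
    by apply: bump_mul; [exact: bump_cst|exact: bump_flat].
  move=> x; rewrite mulNr.
  exact: (is_derive_coord j (flat_affine_is_derive k c b (x 0 i))).
- have [f' bf' df] := IHf j; have [g' bg' dg] := IHg j.
  exists (fun x => f' x + g' x); first exact: bump_add.
  by move=> x; exact: is_deriveD (df x) (dg x).
- have [f' bf' df] := IHf j; have [g' bg' dg] := IHg j.
  exists (fun x => f x * g' x + g x * f' x).
    by apply: bump_add; exact: bump_mul.
  by move=> x; exact: is_deriveM (df x) (dg x).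
Qed.

Lemma bump_alg_continuous (f : E -> R) : bump_alg f -> continuous f.
Proof.
elim=> [c|k i c b|{}f g bf IHf bg IHg|{}f g bf IHf bg IHg] x.
- exact: cst_continuous.
- apply: (@continuous_comp _ _ _ (fun y : E => y 0 i) (fun s => flat k (c * s + b))).
    exact: coord_continuous.
  apply/differentiable_continuous/derivable1_diffP.
  by have [] := flat_affine_is_derive k c b (x 0 i).
- exact: (continuousD (IHf x) (IHg x)).
- exact: (continuousM (IHf x) (IHg x)).
Qed.

Lemma bump_alg_partial (f : E -> R) (j : 'I_n) : bump_alg f -> bump_alg (partial j f).
Proof.
move=> /bump_alg_is_derive/(_ j)[g bg dg].
rewrite (_ : partial j f = g)//; apply/funext => x; rewrite /partial.
by have [_ ->] := dg x.
Qed.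

Lemma bump_alg_smooth (f : E -> R) : bump_alg f -> smooth f.
Proof.
move=> bf s.
suff : bump_alg (foldr (@partial R n) f s).
  move=> b; split; first exact: bump_alg_continuous.
  by move=> i x; have [g _ /(_ x)[]] := bump_alg_is_derive b i.
by elim: s => //= j s IHs; exact: bump_alg_partial.
Qed.

Lemma bump_opp f : bump_alg f -> bump_alg (fun x => - f x).
Proof.
move=> bf; rewrite (_ : (fun _ => _) = fun x => -1 * f x).
  by apply: bump_mul => //; exact: bump_cst.
by apply/funext => x; rewrite mulN1r.
Qed.

Lemma bump_sub f g : bump_alg f -> bump_alg g -> bump_alg (fun x => f x - g x).
Proof. by move=> bf bg; apply: bump_add => //; exact: bump_opp. Qed.

Lemma bump_exp f k : bump_alg f -> bump_alg (fun x => f x ^+ k).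
Proof.
move=> bf; elim: k => [|k IHk]; first exact: bump_cst.
by under eq_fun do rewrite exprS; exact: bump_mul.
Qed.

Lemma bump_prod (I : Type) (s : seq I) (F : I -> E -> R) :
  (forall i, bump_alg (F i)) -> bump_alg (fun x => \prod_(i <- s) F i x).
Proof.
move=> bF; elim: s => [|i s IHs].
  by under eq_fun do rewrite big_nil; exact: bump_cst.
by under eq_fun do rewrite big_cons; exact: bump_mul.
Qed.

(** Composing with [s |-> 1 - (1 - s)^m] turns a function with values in [0, 1]
    into a sequence converging to the indicator of the set where it is nonzero. *)
Definition saturate (f : E -> R) (m : nat) : E -> R := fun x => 1 - (1 - f x) ^+ m.

Lemma bump_saturate f m : bump_alg f -> bump_alg (saturate f m).
Proof.
move=> bf; apply: bump_sub; first exact: bump_cst.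
by apply: bump_exp; apply: bump_sub => //; exact: bump_cst.
Qed.

Lemma saturate_itv (f : E -> R) m x : 0 <= f x <= 1 -> 0 <= saturate f m x <= 1.
Proof.
move=> /andP[f0 f1]; rewrite /saturate.
have h : 0 <= (1 - f x) ^+ m <= 1.
  by rewrite exprn_ge0 ?subr_ge0// exprn_ile1 ?subr_ge0// gerBl.
by case/andP: h => h0 h1; rewrite subr_ge0 h1 gerBl h0.
Qed.

Lemma saturate_cvg (f : E -> R) x : 0 <= f x <= 1 ->
  saturate f m x @[m --> \oo] --> ((f x != 0)%:R : R).
Proof.
move=> /andP[f0 f1]; rewrite /saturate.
have [->|fx] /= := eqVneq (f x) 0.
  by under eq_fun do rewrite subr0 expr1n subrr; exact: cvg_cst.
rewrite -[X in _ --> X]subr0; apply: cvgB; first exact: cvg_cst.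
apply: cvg_expr; rewrite ger0_norm ?subr_ge0//.
by rewrite gtrBl lt0r fx.
Qed.

Lemma saturate_eq0 (f : E -> R) m x : f x = 0 -> saturate f m x = 0.
Proof. by rewrite /saturate => ->; rewrite subr0 expr1n subrr. Qed.

Definition ball_bump (c : E) (r : R) : E -> R := fun x =>
  \prod_(i < n) (flat 0 (1 * x 0 i + (r - c 0 i)) * flat 0 (-1 * x 0 i + (c 0 i + r))).

Lemma bump_ball_bump c r : bump_alg (ball_bump c r).
Proof. by apply: bump_prod => i; apply: bump_mul; exact: bump_flat. Qed.

Lemma ball_bump_itv c r x : 0 <= ball_bump c r x <= 1.
Proof.
apply/andP; split; first by apply: prodr_ge0 => i _; rewrite mulr_ge0 ?flat_ge0.
by apply: prodr_ile1 => i _; rewrite mulr_ge0 ?flat_ge0//= mulr_ile1 ?flat_ge0 ?flat0_le1.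
Qed.

Lemma ball_bump_neq0 c r x : 0 < r -> (ball_bump c r x != 0) = (x \in (ball c r : set E)).
Proof.
move=> r0; rewrite ball_cube//; apply/idP/idP.
  move=> /prodf_neq0 h; apply/mem_set => i.
  have := h i isT; rewrite mulf_eq0 negb_or => /andP[h1 h2].
  rewrite ltr_distl; apply/andP; split.
    rewrite ltNge; apply/negP => h3; move/eqP: h2; apply; apply: flat0_eq0; lra.
  rewrite ltNge; apply/negP => h3; move/eqP: h1; apply; apply: flat0_eq0; lra.
move=> /set_mem h; apply/prodf_neq0 => i _.
have := h i; rewrite ltr_distl => /andP[h1 h2].
by rewrite mulf_neq0// gt_eqF//; apply: flat0_gt0; lra.
Qed.

End bump_algebra.

(** * Approximation in L1 and duality *)

Lemma dist_itv01_le1 (R : realDomainType) (a b : R) :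
  0 <= a <= 1 -> 0 <= b <= 1 -> `|a - b| <= 1.
Proof.
by move=> /andP[a0 a1] /andP[b0 b1]; rewrite ler_norml; apply/andP; split; lra.
Qed.

Section integration_tools.
Context d (T : measurableType d) (R : realType).
Variable mu : {measure set T -> \bar R}.
Variables (D : set T) (mD : measurable D).

Lemma integrable_real_measurable (f : T -> R) :
  mu.-integrable D (EFin \o f) -> measurable_fun D f.
Proof. by move=> /integrableP[h _]; apply/measurable_EFinP. Qed.

Lemma le_integrable_real (f g : T -> R) : measurable_fun D f ->
  (forall x, D x -> `|f x| <= `|g x|) ->
  mu.-integrable D (EFin \o g) -> mu.-integrable D (EFin \o f).
Proof.
move=> mf fg; apply: le_integrable => //; first exact/measurable_EFinP.
Qed.

Lemma integrable_mul_bounded (f h : T -> R) M : measurable_fun D h ->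
  (forall x, D x -> `|h x| <= M) ->
  mu.-integrable D (EFin \o f) -> mu.-integrable D (EFin \o (fun x => f x * h x)).
Proof.
move=> mh hM fi; apply: (integrableMl mD fi mh).
exists M; split; first exact: num_real.
by move=> N MN x /= Dx; apply: le_trans (hM x Dx) (ltW MN).
Qed.

Lemma integrable_abs (f : T -> R) :
  mu.-integrable D (EFin \o f) -> mu.-integrable D (EFin \o (fun x => `|f x|)).
Proof.
move=> fi; apply: (le_integrable_real _ _ fi) => [|x _]; last by rewrite normr_id.
by apply: measurableT_comp => //; apply: integrable_real_measurable fi.
Qed.

Lemma integrable_abs_lty (f : T -> R) : mu.-integrable D (EFin \o f) ->
  (\int[mu]_(x in D) `|f x|%:E < +oo)%E.
Proof. by move=> /integrableP[]. Qed.

Lemma integrable_EFin_Rintegral (f : T -> R) : mu.-integrable D (EFin \o f) ->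
  (\int[mu]_(x in D) (f x)%:E)%E = (\int[mu]_(x in D) f x)%:E.
Proof. by move=> fi; rewrite /Rintegral fineK//; exact: integrable_fin_num. Qed.

Lemma dominated_cvg_L1 (fn : nat -> T -> R) (f g : T -> R) :
  (forall k, measurable_fun D (fn k)) -> measurable_fun D f ->
  {ae mu, forall x, D x -> fn ^~ x @ \oo --> f x} ->
  mu.-integrable D (EFin \o g) ->
  {ae mu, forall x k, D x -> `|fn k x| <= g x} ->
  forall e, 0 < e -> exists k0, forall k, (k0 <= k)%N ->
   (\int[mu]_(x in D) `|fn k x - f x|%:E <= e%:E)%E.
Proof.
move=> mfn mf cv gi dom e e0.
have [] := @dominated_convergence _ _ _ mu D mD (fun k => EFin \o fn k)
  (EFin \o f) (EFin \o g).
- by move=> k; exact/measurable_EFinP.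
- exact/measurable_EFinP.
- apply: filterS cv => x + Dx => /(_ Dx) h; apply: cvg_EFin => //; exact: nearW.
- by [].
- by apply: filterS dom => x + k Dx => /(_ k Dx); rewrite /= lee_fin.
move=> _ /= cv0 _.
have /fine_cvgP[fin] := cv0.
move=> /cvgr0Pnorm_le/(_ _ e0) fe.
have [k0 _ h] := filterI fin fe.
exists k0 => k kk0; have [h1 h2] := h k kk0.
rewrite /= in h1 h2.
have -> : (\int[mu]_(x in D) `|fn k x - f x|%:E =
    \int[mu]_(x in D) `|(fn k x)%:E - (f x)%:E|)%E by [].
rewrite -[leLHS]fineK// lee_fin; apply: le_trans h2.
exact: ler_norm.
Qed.

Lemma le_integral_ge0 (f g : T -> R) : measurable_fun D f -> measurable_fun D g ->
  (forall x, D x -> 0 <= f x <= g x) ->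
  (\int[mu]_(x in D) (f x)%:E <= \int[mu]_(x in D) (g x)%:E)%E.
Proof.
move=> mf mg fg; apply: ge0_le_integral => //.
- by move=> x Dx; rewrite lee_fin; case/andP: (fg x Dx).
- exact/measurable_EFinP.
- exact/measurable_EFinP.
- by move=> x Dx; rewrite lee_fin; case/andP: (fg x Dx).
Qed.

Lemma integralD_ge0 (f g : T -> R) : measurable_fun D f -> measurable_fun D g ->
  (forall x, D x -> 0 <= f x) -> (forall x, D x -> 0 <= g x) ->
  (\int[mu]_(x in D) (f x + g x)%:E =
   \int[mu]_(x in D) (f x)%:E + \int[mu]_(x in D) (g x)%:E)%E.
Proof.
move=> mf mg f0 g0.
rewrite -ge0_integralD//.
- exact/measurable_EFinP.
- exact/measurable_EFinP.
Qed.

Lemma integral_abs0_ae (f : T -> R) : measurable_fun D f ->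
  (\int[mu]_(x in D) `|f x|%:E <= 0)%E -> {ae mu, forall x, D x -> f x = 0}.
Proof.
move=> mf f0.
have /ae_eq_integral_abs h : measurable_fun D (EFin \o f) by exact/measurable_EFinP.
have : ae_eq mu D (EFin \o f) (cst 0%E).
  apply/(h mu mD); apply/eqP; rewrite eq_le f0/=.
  by apply: integral_ge0 => x _; rewrite lee_fin.
by apply: filterS => x + Dx => /(_ Dx) [].
Qed.

Lemma measurable_abs (f : T -> R) : measurable_fun D f ->
  measurable_fun D (fun x => `|f x|).
Proof. by move=> mf; apply: measurableT_comp. Qed.

Lemma measurable_dist_indic (A : set T) (phi : T -> R) : measurable A ->
  measurable_fun D phi -> measurable_fun D (fun x => `|\1_A x - phi x|).
Proof.
move=> mA mphi; apply: measurable_abs.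
by apply: measurable_funB => //; exact: measurable_indic.
Qed.

End integration_tools.

(** A class [B] of functions with values in [0, 1], closed under products and
    relative complements, approximates the indicators of all the sets of a
    sigma-algebra as soon as it does so on generators.  Approximation is in the
    sense of [L^1] with respect to a weight [g]. *)
Section approximation_by_functions.
Context d (T : measurableType d) (R : realType).
Variable mu : {measure set T -> \bar R}.
Variables (D : set T) (mD : measurable D).
Variable B : (T -> R) -> Prop.
Hypothesis B_measurable : forall phi, B phi -> measurable_fun D phi.
Hypothesis B_itv : forall phi, B phi -> forall x, 0 <= phi x <= 1.
Hypothesis B_mul : forall phi psi, B phi -> B psi -> B (fun x => phi x * psi x).
Hypothesis B_diff : forall phi psi, B phi -> B psi -> B (fun x => phi x * (1 - psi x)).
Variable g : T -> R.
Hypothesis g0 : forall x, 0 <= g x.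
Hypothesis gi : mu.-integrable D (EFin \o g).

Definition weighted_dist (A : set T) (phi : T -> R) : \bar R :=
  (\int[mu]_(x in D) (g x * `|\1_A x - phi x|)%:E)%E.

Definition approximable (A : set T) : Prop := measurable A /\
  forall e, 0 < e -> exists2 phi, B phi & (weighted_dist A phi <= e%:E)%E.

Let mg : measurable_fun D g. Proof. exact: integrable_real_measurable gi. Qed.

Let mdist (A : set T) (phi : T -> R) : measurable A ->
  measurable_fun D phi ->
  measurable_fun D (fun x => g x * `|\1_A x - phi x|).
Proof.
move=> mA mphi; apply: measurable_funM => //; apply: measurableT_comp => //.
by apply: measurable_funB => //; exact: measurable_indic.
Qed.

Let indic01 (A : set T) (x : T) : 0 <= (\1_A x : R) <= 1.
Proof. by rewrite indicE ler0n lern1 leq_b1. Qed.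

Lemma weighted_dist_cvg (A : set T) (phi : nat -> T -> R) : measurable A ->
  (forall k, measurable_fun D (phi k)) ->
  (forall k x, 0 <= phi k x <= 1) ->
  (forall x, D x -> phi ^~ x @ \oo --> (\1_A x : R)) ->
  forall e, 0 < e -> exists k, (weighted_dist A (phi k) <= e%:E)%E.
Proof.
move=> mA mphi phi01 cv e e0.
have [||||k0 h] := @dominated_cvg_L1 _ T R mu D mD
    (fun k x => g x * `|\1_A x - phi k x|) (fun=> 0) g _ _ _ gi _ e e0.
- by move=> k; exact: mdist.
- exact: measurable_cst.
- apply: aeW => x Dx.
  rewrite -(mulr0 (g x)); apply: cvgMr.
  rewrite -(@normr0 _ R) -(subrr (\1_A x)).
  by apply: cvg_norm; apply: cvgB; [exact: cvg_cst|exact: cv].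
- apply: aeW => x k Dx.
  rewrite normrM normr_id ger0_norm// ler_piMr//.
  by apply: dist_itv01_le1 => //; exact: phi01.
exists k0; apply: le_trans (h k0 (leqnn _)); rewrite le_eqVlt; apply/orP; left.
apply/eqP; apply: eq_integral => x _; congr (_%:E).
by rewrite subr0 normrM normr_id (ger0_norm (g0 _)).
Qed.

Let dist_le (A A1 A2 : set T) (phi phi1 phi2 : T -> R) e :
  measurable A -> measurable A1 -> measurable A2 ->
  measurable_fun D phi -> measurable_fun D phi1 -> measurable_fun D phi2 ->
  (forall x, `|\1_A x - phi x| <= `|\1_A1 x - phi1 x| + `|\1_A2 x - phi2 x|) ->
  (weighted_dist A1 phi1 <= (e / 2)%:E)%E -> (weighted_dist A2 phi2 <= (e / 2)%:E)%E ->
  (weighted_dist A phi <= e%:E)%E.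
Proof.
move=> mA mA1 mA2 mp mp1 mp2 le h1 h2.
rewrite (splitr e) EFinD; apply: le_trans (leeD h1 h2).
rewrite /weighted_dist -integralD_ge0//; last 4 first.
- exact: mdist.
- exact: mdist.
- by move=> x _; rewrite mulr_ge0.
- by move=> x _; rewrite mulr_ge0.
apply: le_integral_ge0 => //; first exact: mdist.
  by apply: measurable_funD; exact: mdist.
by move=> x _; rewrite mulr_ge0//= -mulrDr ler_wpM2l.
Qed.

Lemma approximable_seq (A : set T) (phi : nat -> T -> R) : measurable A ->
  (forall k, B (phi k)) ->
  (forall x, D x -> phi ^~ x @ \oo --> (\1_A x : R)) -> approximable A.
Proof.
move=> mA Bphi cv; split => // e e0.
have [k hk] := weighted_dist_cvg mA (fun k => B_measurable (Bphi k))
  (fun k => B_itv (Bphi k)) cv e0.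
by exists (phi k).
Qed.

Let indicC (A : set T) x : \1_(~` A) x = 1 - \1_A x :> R.
Proof. by rewrite !indicE in_setC; case: (x \in A); rewrite ?subrr ?subr0. Qed.

Let indicI (A1 A2 : set T) x : \1_(A1 `&` A2) x = \1_A1 x * \1_A2 x :> R.
Proof. by rewrite !indicE in_setI; case: (x \in A1); case: (x \in A2); rewrite /= ?mulr0 ?mulr1. Qed.

Let approximableC (A : set T) : approximable setT -> approximable A -> approximable (~` A).
Proof.
move=> [_ aT] [mA aA]; split; first exact: measurableC.
move=> e e0.
have e20 : 0 < e / 2 by rewrite divr_gt0.
have [phi Bphi hphi] := aA _ e20; have [chi Bchi hchi] := aT _ e20.
exists (fun x => chi x * (1 - phi x)); first exact: B_diff.
apply: (dist_le _ _ _ _ _ _ _ hphi hchi) => //; try exact: B_measurable.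
- exact: measurableC.
- exact: B_measurable (B_diff Bchi Bphi).
move=> x; rewrite indicC indicT/=.
have -> : 1 - \1_A x - chi x * (1 - phi x) =
  (1 - chi x) * (1 - phi x) - (\1_A x - phi x) by ring.
rewrite [leRHS]addrC; apply: le_trans (ler_normB _ _) _; rewrite lerD2r normrM.
by rewrite ler_piMr// -[1 in leLHS]/1 dist_itv01_le1// ?ler01 ?lexx// B_itv.
Qed.

Let approximableI (A1 A2 : set T) : approximable A1 -> approximable A2 ->
  approximable (A1 `&` A2).
Proof.
move=> [mA1 a1] [mA2 a2]; split; first exact: measurableI.
move=> e e0.
have e20 : 0 < e / 2 by rewrite divr_gt0.
have [phi Bphi hphi] := a1 _ e20; have [psi Bpsi hpsi] := a2 _ e20.
exists (fun x => phi x * psi x); first exact: B_mul.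
apply: (dist_le _ _ _ _ _ _ _ hphi hpsi) => //; try exact: B_measurable.
- exact: measurableI.
- exact: B_measurable (B_mul Bphi Bpsi).
move=> x; rewrite indicI.
have -> : \1_A1 x * \1_A2 x - phi x * psi x =
  (\1_A1 x - phi x) * \1_A2 x + (\1_A2 x - psi x) * phi x by ring.
apply: le_trans (ler_normD _ _) _.
have /andP[? ?] := B_itv Bphi x; have /andP[? ?] := indic01 A2 x.
by rewrite !normrM lerD// ler_piMr// ger0_norm.
Qed.

(** Complements and intersections correspond to the operations
    [chi * (1 - phi)] and [phi * psi], where [chi] approximates the constant 1;
    a countable union is the limit of the finite ones. *)
Lemma approximable_sigma_algebra : approximable setT ->
  sigma_algebra setT approximable.
Proof.
move=> aT; split.
- by rewrite -setCT; exact: approximableC.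
- by move=> A aA; rewrite setTD; exact: approximableC.
move=> F aF.
have aU k : approximable (\big[setU/set0]_(i < k) F i).
  elim: k => [|k IHk]; first by rewrite big_ord0 -setCT; exact: approximableC.
  rewrite big_ord_recr/= -[_ `|` _]setCK setCU.
  by apply: approximableC => //; apply: approximableI; exact: approximableC.
have mU : measurable (\bigcup_k F k).
  by apply: bigcupT_measurable => k; have [] := aF k.
split => // e e0.
have e20 : 0 < e / 2 by rewrite divr_gt0.
have [|||k hk] := @weighted_dist_cvg (\bigcup_k F k)
   (fun k => \1_(\big[setU/set0]_(i < k) F i)) mU _ _ _ _ e20.
- by move=> k; apply: measurable_indic; have [] := aU k.
- by move=> k x; exact: indic01.
- move=> x _; have [[i _ Fix]|nF] := pselect ((\bigcup_k F k) x).
    apply: cvg_near_cst; exists i.+1 => // k /= ik.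
    rewrite !indicE !mem_set//; first by exists i.
    by rewrite -bigcup_mkord; exists i.
  apply: cvg_near_cst; apply: nearW => k.
  rewrite !indicE !memNset// => h; apply: nF.
  by move: h; rewrite -bigcup_mkord => -[i _ Fix]; exists i.
have [phi Bphi hphi] := (aU k).2 _ e20.
exists phi => //.
apply: (dist_le _ _ _ _ _ _ _ hk hphi) => //; try exact: B_measurable.
- by have [] := aU k.
- by apply: measurable_indic; have [] := aU k.
by move=> x; rewrite -[X in `|X|](subrKA (\1_(\big[setU/set0]_(i < k) F i) x)) ler_normD.
Qed.

End approximation_by_functions.

Section continuous_measurable.
Context {R : realType} {n : nat}.
Local Notation E := 'rV[R]_n.
Local Notation LE := (@lebesgueRV R n).

Lemma continuous_lebesgue_measurable (f : E -> R) (D : set E) :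
  continuous f -> measurable_fun (D : set LE) (f : LE -> R).
Proof.
move=> cf.
suff h : measurable_fun (setT : set LE) (f : LE -> R).
  exact: (@measurable_funS _ _ LE _ setT D f measurableT (@subsetT _ D) h).
apply: (@measurability _ _ LE _ setT (f : LE -> R) _ (RGenOInfty.measurableE R)).
move=> _ [_ [x ->] <-]; rewrite setTI; apply: open_lebesgue_measurable.
by move/continuousP : cf => /(_ `]x, +oo[%classic); apply; exact: interval_open.
Qed.

Lemma bump_measurable (f : E -> R) (D : set E) : bump_alg f ->
  measurable_fun (D : set LE) (f : LE -> R).
Proof. by move=> bf; apply: continuous_lebesgue_measurable; exact: bump_alg_continuous. Qed.

End continuous_measurable.

Section bump_approximation.
Context {R : realType} {n : nat}.
Local Notation E := 'rV[R]_n.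
Local Notation LE := (@lebesgueRV R n).
Local Notation mu := (@lebesgue R n).
Variables (c : E) (r : R).
Hypothesis r0 : 0 < r.
Local Notation Q := (ball c r : set E).

Definition bump_in (U : set E) (phi : E -> R) : Prop :=
  [/\ bump_alg phi, forall x, 0 <= phi x <= 1 & forall x, ~ U x -> phi x = 0].

Lemma measurable_ball_lebesgue : measurable (Q : set LE).
Proof. by apply: borel_lebesgue_measurable; exact: measurable_ballRV. Qed.
Let mQ := measurable_ball_lebesgue.

Let bump_in_measurable (phi : LE -> R) : bump_in Q phi ->
  measurable_fun (Q : set LE) phi.
Proof. by case=> bphi _ _; exact: bump_measurable. Qed.

Let bump_in_mul (phi psi : E -> R) : bump_in Q phi -> bump_in Q psi ->
  bump_in Q (fun x => phi x * psi x).
Proof.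
move=> [bf f01 f0] [bg g01 g0]; split; first exact: bump_mul.
- move=> x; have /andP[? ?] := f01 x; have /andP[? ?] := g01 x.
  by rewrite mulr_ge0//= mulr_ile1.
- by move=> x /f0 ->; rewrite mul0r.
Qed.

Let bump_in_diff (phi psi : E -> R) : bump_in Q phi -> bump_in Q psi ->
  bump_in Q (fun x => phi x * (1 - psi x)).
Proof.
move=> [bf f01 f0] [bg g01 g0]; split.
- by apply: bump_mul => //; apply: bump_sub => //; exact: bump_cst.
- move=> x; have /andP[? ?] := f01 x; have /andP[? ?] := g01 x.
  by rewrite mulr_ge0 ?subr_ge0//= mulr_ile1 ?subr_ge0// gerBl.
- by move=> x /f0 ->; rewrite mul0r.
Qed.

Section weight.
Variable g : E -> R.
Hypothesis g0 : forall x, 0 <= g x.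
Hypothesis gi : mu.-integrable (Q : set LE) (EFin \o (g : LE -> R)).

Local Notation approx := (@approximable _ LE R mu Q (bump_in Q) g).

Let approx_half (i : 'I_n) (a : R) : approx [set x | a < x 0 i].
Proof.
pose f := fun x : E => ball_bump c r x * flat 0 (1 * x 0 i + - a).
have f01 x : 0 <= f x <= 1.
  have /andP[? ?] := ball_bump_itv c r x.
  by rewrite mulr_ge0 ?flat_ge0//= mulr_ile1 ?flat_ge0 ?flat0_le1.
apply: (@approximable_seq _ LE R mu Q mQ (bump_in Q) bump_in_measurable _ g g0 gi _
   (saturate f)).
- by move=> phi [].
- suff o : open [set x : E | a < x 0 i] by exact: open_lebesgue_measurable o.
  have -> : [set x : E | a < x 0 i] = (fun x : E => x 0 i) @^-1` `]a, +oo[%classic.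
    by apply/seteqP; split => x; rewrite /= in_itv/= andbT.
  by apply: open_comp; [move=> x _; exact: coord_continuous|exact: interval_open].
- move=> k; split; first by apply: bump_saturate; apply: bump_mul;
    [exact: bump_ball_bump|exact: bump_flat].
  + by move=> x; exact: saturate_itv.
  + move=> x Qx; apply: saturate_eq0; rewrite /f.
    have := ball_bump_neq0 c x r0; rewrite memNset// => /negbT.
    by rewrite negbK => /eqP ->; rewrite mul0r.
move=> x Qx; rewrite indicE.
rewrite (_ : x \in _ = (f x != 0)); first exact: saturate_cvg.
have hQ : x \in Q by exact: mem_set.
rewrite mulf_eq0 negb_or ball_bump_neq0// hQ andTb mul1r.
apply/idP/idP => h.
  by move: h; rewrite inE => h; rewrite gt_eqF// flat0_gt0// subr_gt0.
rewrite inE /= ltNge; apply/negP => xa.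
by move/eqP: h; apply; apply: flat0_eq0; rewrite subr_le0.
Qed.

Let approxT : approx setT.
Proof.
apply: (@approximable_seq _ LE R mu Q mQ (bump_in Q) bump_in_measurable _ g g0 gi _
   (saturate (ball_bump c r))) => //.
- by move=> phi [].
- move=> k; split; first by apply: bump_saturate; exact: bump_ball_bump.
  + by move=> x; apply: saturate_itv; exact: ball_bump_itv.
  + move=> x Qx; apply: saturate_eq0.
    have := ball_bump_neq0 c x r0; rewrite memNset// => /negbT.
    by rewrite negbK => /eqP.
move=> x Qx; rewrite indicT.
rewrite (_ : 1 = (ball_bump c r x != 0)%:R) ?ball_bump_neq0 ?mem_set//.
by have := saturate_cvg (ball_bump_itv c r x); rewrite ball_bump_neq0 ?mem_set.
Qed.

Let approx_sigma : sigma_algebra setT approx.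
Proof.
apply: approximable_sigma_algebra => //.
by move=> phi [].
Qed.

Let approx_borel (A : set E) : measurable (A : set (@borelRV R n)) -> approx A.
Proof.
suff : @measurable _ (@borelRV R n) `<=` approx by apply.
apply: smallest_sub; first exact: approx_sigma.
move=> _ [i [B mB ->]].
suff : (@measurable _ (measurableTypeR R)) `<=`
    [set B | approx ((fun x : E => x 0 i) @^-1` B)] by apply.
rewrite [X in X `<=` _](RGenOInfty.measurableE R).
have [a0 aC aU] := approx_sigma.
apply: smallest_sub.
  split => /=; first by rewrite preimage_set0.
    by move=> A' aA; rewrite setTD preimage_setC -setTD; exact: aC.
  by move=> F aF; rewrite preimage_bigcup; exact: aU.
move=> _ [a ->] /=.
rewrite (_ : _ @^-1` _ = [set x : E | a < x 0 i]); first exact: approx_half.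
by apply/seteqP; split => x; rewrite /= in_itv/= andbT.
Qed.

(** The half-spaces [a < x i] generate the Borel sets, and saturation gives
    smooth functions converging to their indicators on [Q]. *)
Lemma bump_approximation (A : set LE) : measurable A -> forall e, 0 < e ->
  exists2 phi, bump_in Q phi &
   (\int[mu]_(x in (Q : set LE)) (g x * `|\1_A x - phi x|)%:E <= e%:E)%E.
Proof.
move=> mA e e0.
have mAQ : measurable (A `&` (Q : set LE)) by exact: measurableI.
have [|B [mB AB B0]] := lebesgue_measurable_borel mAQ.
  apply: le_lt_trans (lebesgue_ball_lty c r).
  by apply: le_measure => //; rewrite ?inE//; exact: subIsetr.
have mB' := borel_lebesgue_measurable mB.
have [_ aB] := approx_borel mB; have [phi bphi hphi] := aB _ e0.
exists phi => //.
have md (A' : set LE) : measurable A' ->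
    measurable_fun (Q : set LE) (fun x => (g x * `|\1_A' x - phi x|)%:E).
  move=> mA'; apply/measurable_EFinP.
  apply: (@measurable_funM _ LE R); first exact: integrable_real_measurable gi.
  by apply: (@measurable_dist_indic _ LE R) => //; exact: bump_in_measurable.
have ge0 (A' : set LE) x : (0 <= (g x * `|\1_A' x - phi x|)%:E)%E.
  by rewrite lee_fin mulr_ge0.
apply: le_trans hphi; rewrite le_eqVlt; apply/orP; left; apply/eqP.
apply: (@ge0_ae_eq_integral _ LE R mu Q _ _ mQ (md A mA) (md B mB')
  (fun x _ => ge0 A x) (fun x _ => ge0 B x)).
exists (B `\` (A `&` (Q : set LE))); split => //.
  exact: measurableD.
move=> x /= /not_implyP[Qx]; apply: contra_notP => h.
congr (_ * `|_ - _|)%:E; rewrite !indicE; congr (_%:R); congr nat_of_bool.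
apply/idP/idP => /set_mem xA; apply/mem_set; first exact: AB.
by apply: contrapT => nA; apply: h; split => // -[].
Qed.

End weight.

(** Smooth functions [phi] and [psi] approximate the indicators of [f > 0] and
    of [f < 0] in [L^1] with the weight [|f|], so that the integral of
    [f (phi - psi)] approximates that of [|f|]. *)
Lemma bump_duality (f : E -> R) (C : R) :
  mu.-integrable (Q : set LE) (EFin \o (f : LE -> R)) ->
  (forall phi, bump_alg phi -> (forall x, `|phi x| <= 1) ->
     (forall x, ~ Q x -> phi x = 0) ->
     \int[mu]_(x in (Q : set LE)) (f x * phi x) <= C) ->
  (\int[mu]_(x in (Q : set LE)) `|f x|%:E <= C%:E)%E.
Proof.
move=> fi fC.
have mf : measurable_fun (Q : set LE) (f : LE -> R) := integrable_real_measurable fi.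
have ai := integrable_abs mQ fi.
pose A := (Q : set LE) `&` [set x | 0 < f x].
pose B := (Q : set LE) `&` [set x | f x < 0].
have mA : measurable A.
  rewrite /A (_ : [set x | _] = (f : LE -> R) @^-1` `]0, +oo[%classic).
    by apply: mf => //; exact: measurable_itv.
  by apply/seteqP; split => x; rewrite /= in_itv/= andbT.
have mB : measurable B.
  rewrite /B (_ : [set x | _] = (f : LE -> R) @^-1` `]-oo, 0[%classic).
    by apply: mf => //; exact: measurable_itv.
  by apply/seteqP; split => x; rewrite /= in_itv/=.
apply/lee_addgt0Pr => e e0.
have e20 : 0 < e / 2 by rewrite divr_gt0.
have a0 x : 0 <= `|f x| by [].
have [phi bphi hphi] := bump_approximation a0 ai mA e20.
have [psi bpsi hpsi] := bump_approximation a0 ai mB e20.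
have [bphi1 phi01 phi0] := bphi; have [bpsi1 psi01 psi0] := bpsi.
have le1 (S : set LE) x (eta : E -> R) : 0 <= eta x <= 1 -> `|\1_S x - eta x| <= 1 :> R.
  by move=> eta01; apply: dist_itv01_le1 => //; rewrite indicE ler0n lern1 leq_b1.
have mind (S : set LE) (eta : LE -> R) : measurable S -> bump_alg eta ->
    measurable_fun (Q : set LE) (fun x : LE => `|\1_S x - eta x|).
  by move=> mS be; apply: (@measurable_dist_indic _ LE R) => //; exact: bump_measurable.
have iA : mu.-integrable (Q : set LE) (EFin \o (fun x => `|f x| * `|\1_A x - phi x|)).
  apply: (@integrable_mul_bounded _ LE R mu Q mQ (fun x => `|f x|) _ 1 _ _ ai).
    exact: mind.
  by move=> x _; rewrite normr_id le1.
have iB : mu.-integrable (Q : set LE) (EFin \o (fun x => `|f x| * `|\1_B x - psi x|)).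
  apply: (@integrable_mul_bounded _ LE R mu Q mQ (fun x => `|f x|) _ 1 _ _ ai).
    exact: mind.
  by move=> x _; rewrite normr_id le1.
have d1 x : `|phi x - psi x| <= 1 by exact: dist_itv01_le1.
have ip : mu.-integrable (Q : set LE) (EFin \o (fun x => f x * (phi x - psi x))).
  apply: (@integrable_mul_bounded _ LE R mu Q mQ f _ 1 _ _ fi) => [|x _]; last exact: d1.
  by apply: bump_measurable; exact: bump_sub.
have hC := fC _ (bump_sub bphi1 bpsi1) d1.
rewrite (integrable_EFin_Rintegral mQ ai) -EFinD lee_fin.
apply: (@le_trans _ _ (\int[mu]_(x in (Q : set LE)) (f x * (phi x - psi x)) +
   (\int[mu]_(x in (Q : set LE)) (`|f x| * `|\1_A x - phi x|) +
    \int[mu]_(x in (Q : set LE)) (`|f x| * `|\1_B x - psi x|)))).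
  have iAB := @integrableD _ LE R mu Q mQ _ _ iA iB.
  rewrite -(@RintegralD _ LE R mu Q) //.
  rewrite -(@RintegralD _ LE R mu Q) //.
  apply: (@le_Rintegral _ LE R mu Q) => //.
    exact: (@integrableD _ LE R mu Q mQ _ _ ip iAB).
  move=> x Qx.
  have e1 : \1_A x = (0 < f x)%R%:R :> R.
    rewrite indicE; congr (_%:R); congr nat_of_bool.
    by apply/idP/idP => [/set_mem[]//|h]; apply/mem_set.
  have e2 : \1_B x = (f x < 0)%R%:R :> R.
    rewrite indicE; congr (_%:R); congr nat_of_bool.
    by apply/idP/idP => [/set_mem[]//|h]; apply/mem_set.
  have fE : `|f x| = f x * (\1_A x - \1_B x).
    rewrite e1 e2; have [f0|f0|->] := ltgtP (f x) 0.
    - by rewrite ltr0_norm//= sub0r mulrN1.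
    - by rewrite gtr0_norm//= subr0 mulr1.
    - by rewrite normr0 mul0r.
  rewrite [leLHS]fE -!normrM.
  have -> : f x * (\1_A x - \1_B x) = f x * (phi x - psi x) +
     (f x * (\1_A x - phi x) - f x * (\1_B x - psi x)) by ring.
  rewrite lerD2l.
  have h1 := ler_norm (f x * (\1_A x - phi x)).
  have h2 := ler_norm (- (f x * (\1_B x - psi x))).
  by rewrite normrN in h2; exact: lerD h1 h2.
have iA' := integrable_EFin_Rintegral mQ iA.
have iB' := integrable_EFin_Rintegral mQ iB.
rewrite iA' lee_fin in hphi; rewrite iB' lee_fin in hpsi.
apply: lerD; first by apply: hC => x Qx; rewrite phi0// psi0// subrr.
by rewrite (splitr e); exact: lerD.
Qed.

End bump_approximation.

(** * Translations in L1 *)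

Lemma measurable_max0 d (T : measurableType d) (R : realType) (D : set T) (f : T -> R) :
  measurable_fun D f -> measurable_fun D (fun x => Num.max (f x) 0).
Proof. by move=> mf; apply: measurable_maxr => //; exact: measurable_cst. Qed.

Section shift_integral.
Context {R : realType} {n : nat}.
Local Notation E := 'rV[R]_n.
Local Notation LE := (@lebesgueRV R n).
Local Notation mu := (@lebesgue R n).

Let shift_mu (h : E) (A : set LE) : measurable A ->
  pushforward mu ((fun x : E => x + h) : LE -> LE) A = mu A.
Proof. by move=> _; exact: lebesgue_outer_shift. Qed.

Lemma measurable_fun_shift (h : E) (f : E -> R) :
  measurable_fun (setT : set LE) (f : LE -> R) ->
  measurable_fun (setT : set LE) ((fun x : E => f (x + h)) : LE -> R).
Proof.
move=> mf; exact: (@measurableT_comp _ _ _ LE LE R f setT _ mf (measurable_shift h)).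
Qed.

Lemma ge0_integral_shift (h : E) (f : E -> R) :
  measurable_fun (setT : set LE) (f : LE -> R) -> (forall x, 0 <= f x) ->
  (\int[mu]_(x in (setT : set LE)) (f (x + h)%R)%:E =
   \int[mu]_(x in (setT : set LE)) (f x)%:E)%E.
Proof.
move=> mf f0; apply/esym.
have mE : measurable_fun (setT : set LE) (fun x : LE => (f x)%:E).
  exact/measurable_EFinP.
have f0' : {in (setT : set LE), forall y : LE, (0 <= (f y)%:E)%E}.
  by move=> y _; rewrite lee_fin.
have := @ge0_integral_pushforward _ _ LE LE R _ (measurable_shift h) mu setT
  (fun x : LE => (f x)%:E) measurableT mE f0'.
rewrite preimage_setT => <-.
apply: (@eq_measure_integral _ LE R setT (measure_function_pushforward__canonical__measure_function_Measure
    mu (@measurable_shift R n h)) mu) => A mA _.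
exact: esym (shift_mu h mA).
Qed.

Lemma integrable_shift (h : E) (f : E -> R) :
  mu.-integrable (setT : set LE) (EFin \o (f : LE -> R)) ->
  mu.-integrable (setT : set LE) (EFin \o ((fun x : E => f (x + h)) : LE -> R)).
Proof.
move=> fi; have mf := integrable_real_measurable fi.
apply/integrableP; split; first by apply/measurable_EFinP; exact: measurable_fun_shift.
have sE := @ge0_integral_shift h (fun x => `|f x|)
  (@measurable_abs _ LE R setT f mf) (fun x => normr_ge0 (f x)).
have := integrable_abs_lty fi; rewrite -sE; exact.
Qed.

Lemma Rintegral_shift (h : E) (f : E -> R) :
  mu.-integrable (setT : set LE) (EFin \o (f : LE -> R)) ->
  \int[mu]_(x in (setT : set LE)) f (x + h) = \int[mu]_(x in (setT : set LE)) f x.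
Proof.
move=> fi; have mf := integrable_real_measurable fi.
have mp : measurable_fun (setT : set LE) (fun x : LE => Num.max (f x) 0).
  exact: (@measurable_max0 _ LE R setT f mf).
have mn : measurable_fun (setT : set LE) (fun x : LE => Num.max (- f x) 0).
  exact: (@measurable_max0 _ LE R setT (fun x => - f x) (@measurable_funN _ LE R setT f mf)).
have fE x : f x = Num.max (f x) 0 - Num.max (- f x) 0.
  have [f0|f0] := leP 0 (f x).
    by rewrite max_r ?subr0// oppr_le0.
  by rewrite max_l ?sub0r ?opprK// oppr_ge0 ltW.
have ip : mu.-integrable (setT : set LE) (EFin \o (fun x : LE => Num.max (f x) 0)).
  apply: (@le_integrable_real _ LE R mu setT measurableT _ _ mp _ fi) => x _.
  by rewrite ger0_norm ?le_max ?lexx ?orbT// ge_max normr_ge0 ler_norm.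
have in_ : mu.-integrable (setT : set LE) (EFin \o (fun x : LE => Num.max (- f x) 0)).
  apply: (@le_integrable_real _ LE R mu setT measurableT _ _ mn _ fi) => x _.
  by rewrite ger0_norm ?le_max ?lexx ?orbT// ge_max normr_ge0 -normrN ler_norm.
transitivity (\int[mu]_(x in (setT : set LE)) (Num.max (f (x + h)) 0 - Num.max (- f (x + h)) 0)).
  by apply: eq_Rintegral => x _; rewrite -fE.
transitivity (\int[mu]_(x in (setT : set LE)) (Num.max (f x) 0 - Num.max (- f x) 0)); last first.
  by apply: eq_Rintegral => x _; rewrite -fE.
have sp := integrable_shift h ip; have sn := integrable_shift h in_.
rewrite (@RintegralB _ LE R mu setT (fun x : E => Num.max (f (x + h)) 0)
   (fun x : E => Num.max (- f (x + h)) 0) measurableT sp sn).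
rewrite (@RintegralB _ LE R mu setT _ _ measurableT ip in_).
congr (_ - _); rewrite /Rintegral; congr fine.
- by apply: (@ge0_integral_shift h (fun x => Num.max (f x) 0) mp) => x; rewrite le_max lexx orbT.
- by apply: (@ge0_integral_shift h (fun x => Num.max (- f x) 0) mn) => x; rewrite le_max lexx orbT.
Qed.

End shift_integral.

Section continuous_bounded.
Context {R : realType} {n : nat}.
Local Notation E := 'rV[R]_n.

Lemma continuous_bounded_ball (g : E -> R) (c : E) (r : R) : continuous g ->
  exists2 M, 0 <= M & forall x, ball c r x -> `|g x| <= M.
Proof.
move=> cg.
pose K := [set v : E | forall i, `[c 0 i - r, c 0 i + r]%classic (v 0 i)].
have cK : compact K.
  by apply: (@rV_compact _ _ (fun i => `[c 0 i - r, c 0 i + r]%classic)) => i; exact: segment_compact.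
have cg' : {within K, continuous g} by exact: continuous_subspaceT.
have [M [_ hM]] := compact_bounded (continuous_compact cg' cK).
exists (`|M| + 1) => [|x bx]; first by rewrite addr_ge0.
apply: (hM (`|M| + 1)); first by rewrite ltr_pwDr// ler_norm.
exists x => // i /=; rewrite in_itv/=.
have [r0 /(_ 0 i)] := bx; rewrite /ball/= ltr_distl => /andP[h1 h2].
by apply/andP; split; lra.
Qed.

Lemma ball_shift (c x h : E) (r s : R) : ball c r x -> `|h| <= s -> 0 < s -> ball c (r + s) (x + h).
Proof.
rewrite -!ball_normE/= => h1 h2 s0; rewrite opprD addrA.
by apply: le_lt_trans (ler_normB _ _) _; rewrite ltr_leD.
Qed.

Lemma norm_delta_mx (i : 'I_n) : `|delta_mx 0 i : E| = 1.
Proof.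
rewrite [LHS]/Num.norm/= mx_normrE; apply/eqP; rewrite eq_le; apply/andP; split.
  apply/bigmax_leP; split => // -[a b] _ /=.
  by rewrite !mxE; case: (_ && _); rewrite ?normr1 ?normr0.
apply/bigmax_geP; right; exists (0, i) => //=.
by rewrite !mxE !eqxx normr1.
Qed.

Lemma norm_scale_delta (i : 'I_n) (t : R) : `|t *: (delta_mx 0 i : E)| = `|t|.
Proof. by rewrite normrZ norm_delta_mx mulr1. Qed.

Lemma smooth_line_is_derive (phi : E -> R) (i : 'I_n) (x : E) (t : R) : smooth phi ->
  is_derive t (1 : R) (fun s : R => phi (x + s *: delta_mx 0 i))
    (partial i phi (x + t *: delta_mx 0 i)).
Proof.
move=> sphi.
have [_ /(_ i (x + t *: delta_mx 0 i)) dphi] := sphi [::].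
have e : (fun h : R => h^-1 *: (((fun s : R => phi (x + s *: delta_mx 0 i)) \o shift t) (h *: (1 : R)) -
     phi (x + t *: delta_mx 0 i))) =
   (fun h : R => h^-1 *: ((phi \o shift (x + t *: delta_mx 0 i)) (h *: (delta_mx 0 i : E)) -
     phi (x + t *: delta_mx 0 i))).
  apply/funext => h /=; congr (_ *: (phi _ - _)).
  by rewrite scaler1 scalerDl addrCA.
by apply: DeriveDef; rewrite /derivable /derive e.
Qed.

Lemma smooth_line_MVT (phi : E -> R) (i : 'I_n) (x : E) (t : R) : smooth phi ->
  exists2 s, `|s| <= `|t| &
    phi (x + t *: delta_mx 0 i) - phi x = partial i phi (x + s *: delta_mx 0 i) * t.
Proof.
move=> sphi.
pose F := fun s : R => phi (x + s *: delta_mx 0 i).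
pose dF := fun s : R => partial i phi (x + s *: delta_mx 0 i).
have dFP s : is_derive s (1 : R) F (dF s) by exact: smooth_line_is_derive.
have cF a b : {within `[a, b], continuous F}.
  apply: continuous_subspaceT => s.
  by apply/differentiable_continuous/derivable1_diffP; have [] := dFP s.
have F0 : F 0 = phi x by rewrite /F scale0r addr0.
have [t0|t0] := leP 0 t.
  have [s sI] := MVT_segment t0 (fun s _ => dFP s) (cF _ _).
  rewrite F0 subr0 => h; exists s => //.
  by move: sI; rewrite in_itv/= => /andP[s0 st]; rewrite !ger0_norm.
have [s sI] := MVT_segment (ltW t0) (fun s _ => dFP s) (cF _ _).
rewrite F0 sub0r => h; exists s.
  move: sI; rewrite in_itv/= => /andP[s0 st].
  by rewrite !ler0_norm ?(ltW t0)// lerN2.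
by apply/eqP; rewrite -/(F t) -/(dF s) -opprB h mulrN opprK.
Qed.

End continuous_bounded.

Section L1_distance.
Import HBSimple.
Context d (T : measurableType d) (R : realType).
Variable mu : {measure set T -> \bar R}.
Variables (D : set T) (mD : measurable D).

Lemma measurable_abs_sub (f g : T -> R) : measurable_fun D f -> measurable_fun D g ->
  measurable_fun D (fun x => `|f x - g x|).
Proof. by move=> mf mg; apply: measurable_abs; exact: measurable_funB. Qed.

Lemma L1_triangle (f g h : T -> R) (a b : R) : measurable_fun D f ->
  measurable_fun D g -> measurable_fun D h ->
  (\int[mu]_(x in D) `|f x - g x|%:E <= a%:E)%E ->
  (\int[mu]_(x in D) `|g x - h x|%:E <= b%:E)%E ->
  (\int[mu]_(x in D) `|f x - h x|%:E <= (a + b)%:E)%E.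
Proof.
move=> mf mg mh fg gh; rewrite EFinD; apply: le_trans (leeD fg gh).
rewrite -integralD_ge0//; last 2 first.
- exact: measurable_abs_sub.
- exact: measurable_abs_sub.
apply: le_integral_ge0 => //; first exact: measurable_abs_sub.
  by apply: measurable_funD; exact: measurable_abs_sub.
by move=> x _; rewrite normr_ge0/= ler_distD.
Qed.

Variable B : (T -> R) -> Prop.
Hypothesis B_measurable : forall phi, B phi -> measurable_fun D phi.
Hypothesis B0 : B (fun=> 0).
Hypothesis B_add : forall phi psi, B phi -> B psi -> B (fun x => phi x + psi x).
Hypothesis B_scale : forall a phi, B phi -> B (fun x => a * phi x).
Hypothesis B_indic : forall A, measurable A -> forall e, 0 < e ->
  exists2 phi, B phi & (\int[mu]_(x in D) `|\1_A x - phi x|%:E <= e%:E)%E.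

Let simple_approx (A : R -> set T) (s : seq R) : (forall y, measurable (A y)) ->
  forall e, 0 < e -> exists2 phi, B phi &
  (\int[mu]_(x in D) `|\sum_(y <- s) y * \1_(A y) x - phi x|%:E <= e%:E)%E.
Proof.
move=> mA; elim: s => [|y s IHs] e e0.
  exists (fun=> 0) => //.
  under eq_integral do rewrite big_nil subrr normr0.
  by rewrite integral0 lee_fin ltW.
have e20 : 0 < e / 2 by rewrite divr_gt0.
have [phi Bphi hphi] := IHs _ e20.
have ey : 0 < e / 2 / (`|y| + 1) by rewrite divr_gt0// ltr_wpDl.
have [psi Bpsi hpsi] := B_indic (mA y) ey.
exists (fun x => y * psi x + phi x); first by apply: B_add => //; exact: B_scale.
have mi z : measurable_fun D (\1_(A z) : T -> R) by exact: measurable_indic.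
have mphi := B_measurable Bphi; have mpsi := B_measurable Bpsi.
have ms : measurable_fun D (fun x => \sum_(y <- s) y * \1_(A y) x).
  by apply: measurable_sum => z; apply: measurable_funM => //; exact: measurable_cst.
have m1 : measurable_fun D (fun x => `|\1_(A y) x - psi x|) by exact: measurable_abs_sub.
have m2 : measurable_fun D (fun x => `|\sum_(y <- s) y * \1_(A y) x - phi x|).
  exact: measurable_abs_sub.
have m3 : measurable_fun D (fun x => `|y| * `|\1_(A y) x - psi x|).
  by apply: measurable_funM => //; exact: measurable_cst.
apply: (@le_trans _ _ (\int[mu]_(x in D) (`|y| * `|\1_(A y) x - psi x| +
    `|\sum_(y <- s) y * \1_(A y) x - phi x|)%:E)%E).
  apply: le_integral_ge0 => //.
  - apply: measurable_abs_sub.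
      under eq_fun do rewrite big_cons; apply: measurable_funD => //.
      by apply: measurable_funM => //; exact: measurable_cst.
    apply: measurable_funD => //.
    by apply: measurable_funM => //; exact: measurable_cst.
  - exact: measurable_funD.
  move=> x _; rewrite normr_ge0/= big_cons -normrM.
  rewrite (_ : y * \1_(A y) x + \sum_(j <- s) j * \1_(A j) x - (y * psi x + phi x) =
    y * (\1_(A y) x - psi x) + (\sum_(j <- s) j * \1_(A j) x - phi x)); last by ring.
  exact: ler_normD.
have y0 x : 0 <= `|y| * `|\1_(A y) x - psi x| by rewrite mulr_ge0.
rewrite (integralD_ge0 _ mD m3 m2 (fun x _ => y0 x) (fun x _ => normr_ge0 _)).
rewrite (splitr e) EFinD; apply: leeD => //.
under eq_integral do rewrite EFinM.
rewrite ge0_integralZl//; last exact/measurable_EFinP.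
apply: (@le_trans _ _ (`|y|%:E * (e / 2 / (`|y| + 1))%:E)%E).
  by apply: lee_wpmul2l.
rewrite -EFinM lee_fin mulrCA ler_piMr ?(ltW e20)//.
by rewrite ler_pdivrMr ?ltr_wpDl// mul1r lerDl.
Qed.

(** Simple functions are dense in [L^1], hence so is every linear class that
    approximates indicators. *)
Lemma L1_dense (f : T -> R) : mu.-integrable D (EFin \o f) -> forall e, 0 < e ->
  exists2 phi, B phi & (\int[mu]_(x in D) `|f x - phi x|%:E <= e%:E)%E.
Proof.
move=> fi e e0; have mf := integrable_real_measurable fi.
have e20 : 0 < e / 2 by rewrite divr_gt0.
have [g [gi _ gf]] := approximation_sfun_integrable mD fi.
have [k hk] : exists k, (\int[mu]_(x in D) `|f x - g k x|%:E <= (e / 2)%:E)%E.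
  have /fine_cvgP[fin] := gf.
  move=> /cvgr0Pnorm_le/(_ _ e20) fe.
  have [k0 _ h] := filterI fin fe.
  exists k0; have [/= h1 h2] := h k0 (leqnn _).
  have -> : (\int[mu]_(x in D) `|f x - g k0 x|%:E =
    \int[mu]_(x in D) `|(f x)%:E - (g k0 x)%:E|)%E by [].
  rewrite -[leLHS]fineK// lee_fin; apply: le_trans h2; exact: ler_norm.
pose s := finmap.enum_fset (fset_set (range (g k))).
have [|phi Bphi hphi] := @simple_approx (fun y => g k @^-1` [set y]) s _ _ e20.
  by move=> y; rewrite -[X in measurable X]setTI; exact: (measurable_funP (g k)).
exists phi => //; rewrite (splitr e).
have mg : measurable_fun D (g k) by apply: measurable_funTS; exact: (measurable_funP (g k)).
apply: (L1_triangle mf mg (B_measurable Bphi) hk).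
apply: le_trans hphi; rewrite le_eqVlt; apply/orP; left; apply/eqP.
apply: eq_integral => x _; congr (`|_ - _|%:E).
by rewrite fimfunE fsbig_finite.
Qed.

End L1_distance.

Section integral_support.
Context d (T : measurableType d) (R : realType).
Variable mu : {measure set T -> \bar R}.
Variables (D : set T) (mD : measurable D).

Lemma integral_off (D' : set T) (f : T -> R) : D `<=` D' ->
  (forall x, ~ D x -> f x = 0) ->
  (\int[mu]_(x in D') (f x)%:E = \int[mu]_(x in D) (f x)%:E)%E.
Proof.
move=> DD' f0; rewrite [LHS]integral_mkcond [RHS]integral_mkcond.
apply: eq_integral => x _; rewrite !patchE.
have [xD|] := boolP (x \in D); first by rewrite mem_set//; apply: DD'; exact: set_mem.
by rewrite notin_setE => xD; case: ifP => // _; rewrite f0.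
Qed.

Lemma Rintegral_off (D' : set T) (f : T -> R) : D `<=` D' ->
  (forall x, ~ D x -> f x = 0) ->
  \int[mu]_(x in D') f x = \int[mu]_(x in D) f x.
Proof. by move=> DD' f0; rewrite /Rintegral integral_off. Qed.

Lemma integrable_off (D' : set T) (f : T -> R) : measurable D' -> D `<=` D' ->
  (forall x, ~ D x -> f x = 0) ->
  mu.-integrable D (EFin \o f) -> mu.-integrable D' (EFin \o f).
Proof.
move=> mD' DD' f0 /(integrable_mkcond _ mD).1 h; apply/(integrable_mkcond _ mD').2.
rewrite (_ : _ \_ D' = (EFin \o f) \_ D)//; apply/funext => x; rewrite !patchE.
have [xD|] := boolP (x \in D); first by rewrite mem_set//; apply: DD'; exact: set_mem.
by rewrite notin_setE => xD; case: ifP => // _; rewrite /= f0.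
Qed.

(** Differentiation under the integral sign, then the mean value theorem. *)
Lemma Rintegral_MVT (k dk : R -> T -> R) (s : R) (G : T -> R) :
  (forall t, `|t| < s -> mu.-integrable D (EFin \o k t)) ->
  (forall t y, `|t| < s -> D y -> is_derive t (1 : R) (k ^~ y) (dk t y)) ->
  (forall y, 0 <= G y) -> mu.-integrable D (EFin \o G) ->
  (forall t y, `|t| < s -> D y -> `|dk t y| <= G y) ->
  forall h, `|h| < s -> exists2 theta, `|theta| <= `|h| &
    \int[mu]_(y in D) k h y - \int[mu]_(y in D) k 0 y =
    (\int[mu]_(y in D) dk theta y) * h.
Proof.
move=> ik dkP G0 iG dkG h hs.
pose F := fun t => \int[mu]_(y in D) k t y.
pose dF := fun t => \int[mu]_(y in D) dk t y.
have inI t : `]- s, s[%classic t -> `|t| < s.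
  by rewrite /= in_itv/= -ltr_norml.
have Iin t : `|t| < s -> `]- s, s[%classic t.
  by rewrite /= in_itv/= -ltr_norml.
have FP t : `|t| < s -> is_derive t (1 : R) F (dF t).
  move=> ts.
  have ik' x : `]- s, s[%classic x -> mu.-integrable D (EFin \o k x).
    by move=> /inI; exact: ik.
  have dk' x y : `]- s, s[%classic x -> D y -> derivable (k ^~ y) x 1.
    by move=> /inI xs Dy; have [] := dkP x y xs Dy.
  have dkE x y : `]- s, s[%classic x -> D y -> partial1of2 k x y = dk x y.
    by move=> /inI xs Dy; rewrite partial1of2E; have [_ ->] := dkP x y xs Dy.
  have Gub x y : `]- s, s[%classic x -> D y -> `|partial1of2 k x y| <= G y.
    by move=> xs Dy; rewrite dkE//; apply: dkG => //; exact: inI.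
  have dF1 := derivable_under_integral mD (Iin t ts) ik' dk' G0 iG Gub.
  have e := differentiation_under_integral mD (Iin t ts) ik' dk' G0 iG Gub.
  apply: DeriveDef; first exact: dF1.
  rewrite -derive1E e; apply: eq_Rintegral => y /set_mem Dy.
  by apply: dkE => //; exact: Iin.
have cF a b : - s < a -> b < s -> {within `[a, b], continuous F}.
  move=> sa bs; apply: derivable_within_continuous => t.
  rewrite in_itv/= => /andP[at_ tb].
  have [] // := FP t _; rewrite ltr_norml; apply/andP; split.
    exact: lt_le_trans sa at_.
  exact: le_lt_trans tb bs.
have s0 : 0 < s by exact: le_lt_trans hs.
have ns0 : - s < 0 by rewrite oppr_lt0.
have [h0|h0] := leP 0 h.
  have hs' : h < s by rewrite -(ger0_norm h0).
  have [t tI|t tI e] := @MVT_segment _ F dF 0 h h0 _ (cF 0 h ns0 hs').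
    apply: FP; move: tI; rewrite in_itv/= => /andP[t0 th].
    by rewrite ltr_norml (lt_trans ns0)//= (lt_trans th).
  exists t; last by rewrite -/(F h) -/(F 0) e subr0.
  by move: tI; rewrite in_itv/= => /andP[t0 th]; rewrite !ger0_norm.
have hs' : - s < h by move: hs; rewrite ltr_norml => /andP[].
have [t tI|t tI e] := @MVT_segment _ F dF h 0 (ltW h0) _ (cF h 0 hs' s0).
  apply: FP; move: tI; rewrite in_itv/= => /andP[t0 th].
  by rewrite ltr_norml (lt_trans hs')//= (lt_trans th).
exists t.
  move: tI; rewrite in_itv/= => /andP[t0 th].
  by rewrite !ler0_norm ?lerN2// ltW.
rewrite -/(F h) -/(F 0) -/(dF t).
by rewrite -opprB e sub0r mulrN opprK.
Qed.

End integral_support.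

Section shift_continuity.
Context {R : realType} {n : nat}.
Local Notation E := 'rV[R]_n.
Local Notation LE := (@lebesgueRV R n).
Local Notation mu := (@lebesgue R n).

Lemma bump_alg_shift (f : E -> R) (h : E) : bump_alg f -> bump_alg (fun x => f (x + h)).
Proof.
elim=> [c|k i c b|{}f g _ IHf _ IHg|{}f g _ IHf _ IHg].
- exact: bump_cst.
- have -> : (fun x : E => flat k (c * (x + h) 0 i + b)) =
      fun x : E => flat k (c * x 0 i + (c * h 0 i + b)).
    by apply/funext => x; rewrite mxE mulrDr addrA.
  exact: bump_flat.
- exact: bump_add.
- exact: bump_mul.
Qed.

Variables (c : E) (r : R).
Hypothesis r0 : 0 < r.
Local Notation Q := (ball c r : set E).
Let mQ := @measurable_ball_lebesgue R n c r.

Lemma integrable_const_ball (s M : R) :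
  mu.-integrable (ball c s : set LE) (EFin \o (fun _ : LE => M)).
Proof.
apply: (@measurable_bounded_integrable _ LE R mu (fun=> M) (ball c s)).
- exact: measurable_ball_lebesgue.
- exact: lebesgue_ball_lty.
- exact: (@measurable_cst _ _ LE).
exists `|M|; split; first exact: num_real.
by move=> N MN x _; exact: ltW.
Qed.

Lemma bump_dense (f : E -> R) : mu.-integrable (Q : set LE) (EFin \o (f : LE -> R)) ->
  forall e, 0 < e -> exists phi, [/\ bump_alg phi, forall x, ~ Q x -> phi x = 0 &
   (\int[mu]_(x in (Q : set LE)) `|f x - phi x|%:E <= e%:E)%E].
Proof.
move=> fi e e0.
pose B (phi : LE -> R) := bump_alg phi /\ forall x, ~ Q x -> phi x = 0.
have Bm phi : B phi -> measurable_fun (Q : set LE) phi.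
  by move=> [b _]; exact: bump_measurable.
have B0 : B (fun=> 0) by split => //; exact: bump_cst.
have BD phi psi : B phi -> B psi -> B (fun x => phi x + psi x).
  move=> [b1 h1] [b2 h2]; split; first exact: bump_add.
  by move=> x Qx; rewrite h1// h2// addr0.
have BZ a phi : B phi -> B (fun x => a * phi x).
  move=> [b1 h1]; split; first by apply: bump_mul => //; exact: bump_cst.
  by move=> x Qx; rewrite h1// mulr0.
have BI (A : set LE) : measurable A -> forall e, 0 < e -> exists2 phi, B phi &
    (\int[mu]_(x in (Q : set LE)) `|\1_A x - phi x|%:E <= e%:E)%E.
  move=> mA e' e'0.
  have [phi [b1 _ b2] hphi] := bump_approximation r0 (fun=> ler01)
    (integrable_const_ball r 1) mA e'0.
  exists phi => //; apply: le_trans hphi; rewrite le_eqVlt; apply/orP; left.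
  by apply/eqP; apply: eq_integral => x _; rewrite mul1r.
have [phi [b1 b2] h] := @L1_dense _ LE R mu Q mQ B Bm B0 BD BZ BI f fi e e0.
by exists phi.
Qed.

(** By the mean value theorem on lines; the integrand vanishes off the ball of
    radius [r + 1], since [|t| <= 1]. *)
Lemma bump_shift_continuous (phi : E -> R) (i : 'I_n) : bump_alg phi ->
  (forall x, ~ Q x -> phi x = 0) -> exists2 M, 0 <= M & forall t, `|t| <= 1 ->
   (\int[mu]_(x in (setT : set LE)) `|phi (x + t *: delta_mx 0 i)%R - phi x|%:E
     <= (M * `|t|)%:E)%E.
Proof.
move=> bphi phi0.
have [C C0 hC] := continuous_bounded_ball c (r + 1 + 1)
  (bump_alg_continuous (bump_alg_partial i bphi)).
pose S := (ball c (r + 1) : set LE).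
have mS : measurable S by exact: measurable_ball_lebesgue.
have muS : mu S \is a fin_num by rewrite ge0_fin_numE// lebesgue_ball_lty.
exists (C * fine (mu S)) => [|t t1]; first by rewrite mulr_ge0// fine_ge0.
pose e := t *: delta_mx 0 i : E.
have ne : `|e| <= 1 by rewrite norm_scale_delta.
have off x : ~ S x -> `|phi (x + e) - phi x| = 0.
  move=> Sx; rewrite !phi0 ?subrr ?normr0//.
    by move=> Qx; apply: Sx; apply: le_ball Qx; rewrite lerDl.
  move=> Qx; apply: Sx; rewrite -(addrK e x).
  by apply: (ball_shift Qx) => //; rewrite normrN.
have mphi : measurable_fun S (fun x : LE => phi (x + e)).
  by apply: bump_measurable; exact: bump_alg_shift.
have mphi' : measurable_fun S (phi : LE -> R) by exact: bump_measurable.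
rewrite (@integral_off _ LE R mu S setT (fun x => `|phi (x + e) - phi x|) (@subsetT _ _) off).
apply: (@le_trans _ _ (\int[mu]_(x in S) (C * `|t|)%:E)%E); last first.
  rewrite (@integral_cst _ LE R mu S mS) -[X in (_ * X)%E](fineK muS) -EFinM lee_fin.
  by rewrite mulrAC.
apply: (@le_integral_ge0 _ LE R mu S mS (fun x => `|phi (x + e) - phi x|) (fun=> C * `|t|)
  (@measurable_abs_sub _ LE R S _ _ mphi mphi') (@measurable_cst _ _ LE _ _ _)).
move=> x Sx; rewrite normr_ge0/=.
have [s st ->] := smooth_line_MVT i x t (bump_alg_smooth bphi).
rewrite normrM ler_wpM2r// hC//.
by apply: (ball_shift Sx) => //; rewrite norm_scale_delta (le_trans st).
Qed.

(** Translations preserve the [L^1] norm, so that the result extends from smooth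
    functions to the functions that they approximate. *)
Lemma L1_shift_continuous (f : E -> R) (i : 'I_n) :
  mu.-integrable (setT : set LE) (EFin \o (f : LE -> R)) ->
  (forall x, ~ Q x -> f x = 0) ->
  forall e, 0 < e -> exists2 delta, 0 < delta & forall t, `|t| < delta ->
   (\int[mu]_(x in (setT : set LE)) `|f (x + t *: delta_mx 0 i)%R - f x|%:E <= e%:E)%E.
Proof.
move=> fi f0 e e0.
have mf : measurable_fun (setT : set LE) (f : LE -> R) := integrable_real_measurable fi.
have fiQ : mu.-integrable (Q : set LE) (EFin \o (f : LE -> R)).
  exact: (@integrableS _ LE R mu setT Q _ measurableT mQ (@subsetT _ _) fi).
have e30 : 0 < e / 3 by rewrite divr_gt0.
have [phi [bphi phi0 hphi]] := bump_dense fiQ e30.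
have [M M0 hM] := bump_shift_continuous i bphi phi0.
have mphi : measurable_fun (setT : set LE) (phi : LE -> R) by exact: bump_measurable.
have hphi' : (\int[mu]_(x in (setT : set LE)) `|f x - phi x|%:E <= (e / 3)%:E)%E.
  rewrite (@integral_off _ LE R mu Q setT (fun x => `|f x - phi x|) (@subsetT _ _))//.
  by move=> x Qx; rewrite f0// phi0// subrr normr0.
pose delta := Num.min 1 (e / 3 / (M + 1)).
exists delta; first by rewrite lt_min ltr01 divr_gt0// ltr_wpDl.
move=> t; rewrite lt_min => /andP[t1 t2].
pose h := t *: delta_mx 0 i : E.
have h1 : (\int[mu]_(x in (setT : set LE)) `|f (x + h)%R - phi (x + h)%R|%:E <= (e / 3)%:E)%E.
  by rewrite (ge0_integral_shift h (@measurable_abs_sub _ LE R setT _ _ mf mphi)).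
have h2 : (\int[mu]_(x in (setT : set LE)) `|phi (x + h)%R - phi x|%:E <= (e / 3)%:E)%E.
  apply: le_trans (hM t (ltW t1)) _; rewrite lee_fin.
  move: t2; rewrite ltr_pdivlMr ?ltr_wpDl// => /ltW; apply: le_trans.
  by rewrite mulrC ler_wpM2l// lerDl.
have h3 : (\int[mu]_(x in (setT : set LE)) `|phi x - f x|%:E <= (e / 3)%:E)%E.
  by under eq_integral do rewrite distrC.
have mfh := measurable_fun_shift h mf; have mphih := measurable_fun_shift h mphi.
have -> : e = e / 3 + e / 3 + e / 3 by lra.
apply: (@L1_triangle _ LE R mu setT measurableT _ _ _ _ _ mfh mphi mf) => //.
exact: (@L1_triangle _ LE R mu setT measurableT _ _ _ _ _ mfh mphih mphi).
Qed.

End shift_continuity.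

(** * Weak derivatives and difference quotients *)

Section weak_partial.
Context {R : realType} {n : nat}.
Local Notation E := 'rV[R]_n.
Local Notation LE := (@lebesgueRV R n).
Local Notation mu := (@lebesgue R n).

(** One component of [weak_gradient]; the calculus of weak derivatives is
    carried out coordinate by coordinate. *)
Definition weak_partial (Omega : set E) (i : 'I_n) (u f : E -> R) : Prop :=
  L1loc Omega f /\ forall phi, test_function Omega phi ->
      \int[mu]_(x in Omega) (u x * partial i phi x) =
      - \int[mu]_(x in Omega) (f x * phi x).

Lemma partial_off_supp (phi : E -> R) (i : 'I_n) x : ~ supp phi x -> partial i phi x = 0.
Proof.
move=> nx.
have : (~` supp phi) x by [].
have oS : open (~` supp phi) by rewrite openC; exact: closed_closure.
move=> /(conj oS)/open_nbhs_nbhs nS.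
have : \forall y \near x, (0 : E -> R) y = phi y.
  apply: filterS nS => y nSy; apply/esym; apply: contrapT => py; apply: nSy.
  by apply: subset_closure; apply/eqP.
move=> nE.
by have [_] := near_eq_is_derive nE (is_derive_cst (0 : R) x (delta_mx 0 i : E)).
Qed.

Lemma partial_shift (phi : E -> R) (i : 'I_n) (h x : E) :
  partial i (fun y => phi (y + h)) x = partial i phi (x + h).
Proof.
rewrite /partial /derive.
have -> // : (fun t : R => t^-1 *: (((fun y => phi (y + h)) \o shift x) (t *: (delta_mx 0 i : E))
     - phi (x + h))) =
  (fun t : R => t^-1 *: ((phi \o shift (x + h)) (t *: (delta_mx 0 i : E)) - phi (x + h))).
by apply/funext => t /=; rewrite addrA.
Qed.

Lemma supp_shift (c h : E) (r s : R) (phi : E -> R) : 0 < r -> `|h| < s ->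
  (forall x, ~ ball c r x -> phi x = 0) ->
  supp (fun x => phi (x - h)) `<=` ball c (r + s).
Proof.
move=> r0 hs phi0.
have cl : closed (closed_ball_ (fun y : E => `|y|) (c + h) r) by exact: closed_closed_ball_.
apply: (@subset_trans _ (closed_ball_ (fun y : E => `|y|) (c + h) r)).
  rewrite [X in _ `<=` X](closure_id _).1//.
  apply: closure_subset => x /= /eqP px.
  rewrite /closed_ball_ /=; apply: contrapT => nx; apply: px; apply: phi0.
  by rewrite -ball_normE /= opprB addrA => hx; apply: nx; exact: ltW.
move=> x /= hx; rewrite -ball_normE /=.
rewrite (_ : c - x = (c + h - x) - h); last by rewrite addrAC addrK.
by apply: le_lt_trans (ler_normB _ _) _; rewrite ler_ltD.
Qed.

Lemma test_function_shift (Omega K : set E) (c h : E) (r s : R) (phi : E -> R) :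
  compact K -> K `<=` Omega -> ball c (r + s) `<=` K -> 0 < r -> `|h| < s ->
  bump_alg phi -> (forall x, ~ ball c r x -> phi x = 0) ->
  test_function Omega (fun x => phi (x - h)).
Proof.
move=> cK KO BK r0 hs bphi phi0.
have sub := supp_shift r0 hs phi0.
split.
- by apply: bump_alg_smooth; exact: bump_alg_shift.
- apply: (subclosed_compact _ cK); first exact: closed_closure.
  exact: subset_trans sub BK.
- exact: subset_trans sub (subset_trans BK KO).
Qed.

Lemma L1loc_integrable (Omega K : set E) (f : E -> R) : open Omega -> L1loc Omega f ->
  compact K -> K `<=` Omega -> forall A : set LE, measurable A -> A `<=` K ->
  mu.-integrable A (EFin \o (f : LE -> R)).
Proof.
move=> oO [mf fi] cK KO A mA AK.
have mK : measurable (K : set LE) by exact: compact_lebesgue_measurable.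
have mO : measurable (Omega : set LE) by exact: open_lebesgue_measurable.
apply: (@integrableS _ LE R mu K A (EFin \o f) mK mA AK).
apply/integrableP; split; last exact: fi.
apply/measurable_EFinP.
exact: (@measurable_funS _ _ LE R Omega K f mO KO mf).
Qed.

End weak_partial.

Section weak_difference.
Context {R : realType} {n : nat}.
Local Notation E := 'rV[R]_n.
Local Notation LE := (@lebesgueRV R n).
Local Notation mu := (@lebesgue R n).
Variables (Omega K : set E) (i : 'I_n) (u f : E -> R) (c : E) (r s : R).
Hypothesis oO : open Omega.
Hypothesis cK : compact K.
Hypothesis KO : K `<=` Omega.
Hypothesis BK : ball c (r + s) `<=` K.
Hypothesis r0 : 0 < r.
Hypothesis s0 : 0 < s.
Hypothesis u_loc : L1loc Omega u.
Hypothesis uf : weak_partial Omega i u f.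
Local Notation Q := (ball c r : set E).
Local Notation S := (ball c (r + s) : set E).
Local Notation e := (delta_mx 0 i : E).

Let mS : measurable (S : set LE). Proof. exact: measurable_ball_lebesgue. Qed.
Let mQ : measurable (Q : set LE). Proof. exact: measurable_ball_lebesgue. Qed.
Let mO : measurable (Omega : set LE). Proof. exact: open_lebesgue_measurable. Qed.
Let SO : S `<=` Omega. Proof. exact: subset_trans BK KO. Qed.
Let QS : Q `<=` S. Proof. by apply: le_ball; rewrite lerDl ltW. Qed.

Let u' : E -> R := u \_ S.
Let f' : E -> R := f \_ S.

Let u'E x : S x -> u' x = u x.
Proof. by move=> Sx; rewrite /u' patchE mem_set. Qed.
Let f'E x : S x -> f' x = f x.
Proof. by move=> Sx; rewrite /f' patchE mem_set. Qed.
Let f'0 x : ~ S x -> f' x = 0.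
Proof. by move=> Sx; rewrite /f' patchE memNset. Qed.

Let restrict_integrable (g : E -> R) : L1loc Omega g ->
  mu.-integrable (setT : set LE) (EFin \o ((g \_ S : E -> R) : LE -> R)).
Proof.
move=> gl; have gi := L1loc_integrable oO gl cK KO mS BK.
have := (@integrable_mkcond _ LE R mu S (EFin \o g) mS).1 gi.
by rewrite restrict_EFin.
Qed.

Let u'i := restrict_integrable u_loc.
Let f'i := restrict_integrable uf.1.

Lemma shift_in_ball (h x : E) : Q x -> `|h| < s -> S (x + h).
Proof.
rewrite -!ball_normE/= => h1 h2; rewrite opprD addrA.
by apply: le_lt_trans (ler_normB _ _) _; rewrite ltrD.
Qed.

Section test.
Variable phi : E -> R.
Hypothesis bphi : bump_alg phi.
Hypothesis phi0 : forall x, ~ Q x -> phi x = 0.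

Let phi_bd : exists2 M, 0 <= M & forall x, `|phi x| <= M.
Proof.
have [M M0 hM] := continuous_bounded_ball c r (bump_alg_continuous bphi).
exists M => // x; have [Qx|nQx] := pselect (Q x); first exact: hM.
by rewrite phi0// normr0.
Qed.

Let dphi_shift0 h x : `|h| < s -> ~ S x -> partial i phi (x - h) = 0.
Proof.
move=> hs Sx; rewrite -partial_shift; apply: partial_off_supp => sx; apply: Sx.
exact: (supp_shift r0 hs phi0).
Qed.

Let dphi0 x : ~ S x -> partial i phi x = 0.
Proof.
move=> Sx; rewrite -[x]subr0; apply: dphi_shift0; rewrite ?normr0 ?subr0//.
Qed.

Let dphi_bd : exists2 M, 0 <= M & forall x, `|partial i phi x| <= M.
Proof.
have [M M0 hM] := continuous_bounded_ball c (r + s)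
  (bump_alg_continuous (bump_alg_partial i bphi)).
exists M => // x; have [Sx|nSx] := pselect (S x); first exact: hM.
by rewrite dphi0// normr0.
Qed.

Let weak_shift t : `|t| < s ->
  \int[mu]_(x in (setT : set LE)) (u' x * partial i phi (x - t *: e)) =
  - \int[mu]_(x in (setT : set LE)) (f' x * phi (x - t *: e)).
Proof.
move=> ts.
have te : `|t *: e| < s by rewrite norm_scale_delta.
have := uf.2 _ (test_function_shift cK KO BK r0 te bphi phi0).
have off x : ~ S x -> phi (x - t *: e) = 0.
  move=> Sx; apply: phi0 => Qx; apply: Sx.
  by rewrite -(subrK (t *: e) x); exact: shift_in_ball.
have doff x : ~ S x -> partial i phi (x - t *: e) = 0 by exact: dphi_shift0.
rewrite (@Rintegral_off _ LE R mu S Omega (fun x => u x * _)) //; last first.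
  by move=> x Sx; rewrite partial_shift doff// mulr0.
rewrite (@Rintegral_off _ LE R mu S Omega (fun x => f x * _)) //; last first.
  by move=> x Sx; rewrite off// mulr0.
rewrite (@Rintegral_off _ LE R mu S setT (fun x => u' x * _)) //; last first.
  by move=> x Sx; rewrite doff// mulr0.
rewrite (@Rintegral_off _ LE R mu S setT (fun x => f' x * _)) //; last first.
  by move=> x Sx; rewrite off// mulr0.
move=> h.
transitivity (\int[mu]_(x in (S : set LE)) (u x * partial i (fun y => phi (y - t *: e)) x)).
  by apply: eq_Rintegral => x /set_mem Sx; rewrite u'E// partial_shift.
rewrite h; congr (- _).
by apply: eq_Rintegral => x /set_mem Sx; rewrite f'E.
Qed.

Let prod_integrable (g psi : E -> R) :
  mu.-integrable (setT : set LE) (EFin \o (g : LE -> R)) ->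
  continuous psi -> (exists2 M, 0 <= M & forall x, `|psi x| <= M) ->
  forall h, mu.-integrable (setT : set LE) (EFin \o ((fun x : E => g x * psi (x + h)) : LE -> R)).
Proof.
move=> gi cpsi [M M0 hM] h.
have mpsi := measurable_fun_shift h (@continuous_lebesgue_measurable R n psi setT cpsi).
exact: (@integrable_mul_bounded _ LE R mu setT measurableT g _ M mpsi (fun x _ => hM (x + h)) gi).
Qed.

Let cphi := bump_alg_continuous bphi.
Let cdphi := bump_alg_continuous (bump_alg_partial i bphi).

(** The function [t |-> \int u'(x) phi(x + t e)] has derivative
    [\int u'(x) (partial i phi)(x + t e)], which is the opposite of the integral
    of [f' phi(. + t e)] because the translates of [phi] are test functions; the
    mean value theorem and a translation of the integrals conclude. *)
Lemma weak_difference_test h : `|h| < s -> exists2 theta, `|theta| <= `|h| &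
  \int[mu]_(x in (setT : set LE)) ((u' (x + h *: e) - u' x) * phi x) =
  h * \int[mu]_(x in (setT : set LE)) (f' (x + theta *: e) * phi x).
Proof.
move=> hs.
pose k := fun (t : R) (x : LE) => u' x * phi (x + t *: e).
pose dk := fun (t : R) (x : LE) => u' x * partial i phi (x + t *: e).
have [M M0 hM] := dphi_bd.
have ik t : `|t| < s -> mu.-integrable (setT : set LE) (EFin \o k t).
  by move=> _; exact: prod_integrable.
have dkP t x : `|t| < s -> (setT : set LE) x -> is_derive t (1 : R) (k ^~ x) (dk t x).
  move=> _ _; apply: (@is_deriveZ _ _ _ (fun s : R => phi (x + s *: e)) (u' x)).
  exact: smooth_line_is_derive (bump_alg_smooth bphi).
have G0 (x : LE) : 0 <= `|u' x| * M by rewrite mulr_ge0.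
have iG : mu.-integrable (setT : set LE) (EFin \o (fun x : LE => `|u' x| * M)).
  have a := @integrable_abs _ LE R mu setT measurableT u' u'i.
  exact: (@integrable_mul_bounded _ LE R mu setT measurableT (fun x => `|u' x|) (fun=> M) `|M|
     (@measurable_cst _ _ LE _ _ _) (fun x _ => lexx _) a).
have dkG t x : `|t| < s -> (setT : set LE) x -> `|dk t x| <= `|u' x| * M.
  by move=> _ _; rewrite normrM ler_wpM2l.
have nh : `|- h| < s by rewrite normrN.
have [theta th eq] := @Rintegral_MVT _ LE R mu setT measurableT k dk s _ ik dkP G0 iG dkG _ nh.
exists (- theta); first by rewrite normrN (le_trans th)// normrN.
have ths : `|- theta| < s by rewrite normrN (le_lt_trans th)// normrN.
have k1 := ik _ nh; have k2 : mu.-integrable (setT : set LE) (EFin \o (k 0)).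
  by apply: ik; rewrite normr0.
have k1E : \int[mu]_(x in (setT : set LE)) k (- h) x =
    \int[mu]_(x in (setT : set LE)) (u' (x + h *: e) * phi x).
  rewrite -(Rintegral_shift (h *: e) k1).
  by apply: eq_Rintegral => x _; rewrite /k scaleNr addrK.
have k2E : \int[mu]_(x in (setT : set LE)) k 0 x =
    \int[mu]_(x in (setT : set LE)) (u' x * phi x).
  by apply: eq_Rintegral => x _; rewrite /k scale0r addr0.
have dkE : \int[mu]_(x in (setT : set LE)) dk theta x =
    - \int[mu]_(x in (setT : set LE)) (f' (x + (- theta) *: e) * phi x).
  have ws := weak_shift ths; rewrite scaleNr opprK in ws.
  transitivity (\int[mu]_(x in (setT : set LE)) (u' x * partial i phi (x + theta *: e))).
    exact: eq_Rintegral.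
  rewrite ws; congr (- _).
  have i0 : mu.-integrable (setT : set LE) (EFin \o ((fun x : E => f' x * phi (x + theta *: e)) : LE -> R)).
    by apply: prod_integrable.
  rewrite -(Rintegral_shift (- (theta *: e)) i0).
  by apply: eq_Rintegral => x _; rewrite addrNK scaleNr.
have i1 : mu.-integrable (setT : set LE) (EFin \o ((fun x : E => u' (x + h *: e) * phi x) : LE -> R)).
  have := integrable_shift (h *: e) k1.
  congr (mu.-integrable _ (EFin \o _)); apply/funext => x.
  by rewrite /k scaleNr addrK.
have i2 : mu.-integrable (setT : set LE) (EFin \o ((fun x : E => u' x * phi x) : LE -> R)).
  have := k2.
  congr (mu.-integrable _ (EFin \o _)); apply/funext => x.
  by rewrite /k scale0r addr0.
transitivity (\int[mu]_(x in (setT : set LE)) (u' (x + h *: e) * phi x - u' x * phi x)).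
  by apply: eq_Rintegral => x _; rewrite mulrBl.
rewrite (@RintegralB _ LE R mu setT _ _ measurableT i1 i2) -k1E -k2E eq dkE.
by rewrite mulrNN mulrC.
Qed.

End test.
Let integrable_comb (a b : R) (g1 g2 : E -> R) :
  mu.-integrable (setT : set LE) (EFin \o (g1 : LE -> R)) ->
  mu.-integrable (setT : set LE) (EFin \o (g2 : LE -> R)) ->
  mu.-integrable (setT : set LE) (EFin \o ((fun x => a * g1 x + b * g2 x) : LE -> R)).
Proof.
move=> g1i g2i.
have := (@integrableD _ LE R mu setT measurableT _ _
  (@integrableZl _ LE R mu setT measurableT a _ g1i)
  (@integrableZl _ LE R mu setT measurableT b _ g2i)).
by congr (mu.-integrable _ _); apply/funext => x; rewrite /= EFinD !EFinM.
Qed.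

(** By [weak_difference_test], the integral of the error against a smooth [phi]
    is that of [f(x + theta e) - f(x)] against [phi], for some [theta] that
    depends on [phi] but is at most [|h|] in absolute value; [bump_duality] takes
    the supremum over [phi]. *)
Lemma weak_difference (h C : R) : h != 0 -> `|h| < s ->
  (forall t, `|t| <= `|h| ->
    (\int[mu]_(x in (Q : set LE)) `|f (x + t *: e)%R - f x|%:E <= C%:E)%E) ->
  (\int[mu]_(x in (Q : set LE)) `|(h^-1 * (u (x + h *: e) - u x) - f x)%R|%:E <= C%:E)%E.
Proof.
move=> hn0 hs hC.
pose F x := h^-1 * (u' (x + h *: e) - u' x) - f' x.
have FE x : Q x -> h^-1 * (u (x + h *: e) - u x) - f x = F x.
  move=> Qx; have Sx := QS Qx.
  have Sxh : S (x + h *: e) by apply: shift_in_ball => //; rewrite norm_scale_delta.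
  by rewrite /F !u'E// f'E.
have f'hE t x : `|t| < s -> Q x -> f (x + t *: e) - f x = f' (x + t *: e) - f' x.
  move=> ts Qx; have Sx := QS Qx.
  have Sxh : S (x + t *: e) by apply: shift_in_ball => //; rewrite norm_scale_delta.
  by rewrite !f'E.
have ush := integrable_shift (h *: e) u'i.
have ub : mu.-integrable (setT : set LE) (EFin \o ((fun x => u' (x + h *: e) - u' x) : LE -> R)).
  have := integrable_comb 1 (-1) ush u'i.
  by congr (mu.-integrable _ (EFin \o _)); apply/funext => x; rewrite mul1r mulN1r.
have Fi : mu.-integrable (setT : set LE) (EFin \o (F : LE -> R)).
  have := integrable_comb h^-1 (-1) ub f'i.
  by congr (mu.-integrable _ (EFin \o _)); apply/funext => x; rewrite mulN1r.
have FiQ : mu.-integrable (Q : set LE) (EFin \o (F : LE -> R)).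
  exact: (@integrableS _ LE R mu setT Q _ measurableT mQ (@subsetT _ _) Fi).
have -> : (\int[mu]_(x in (Q : set LE)) `|(h^-1 * (u (x + h *: e) - u x) - f x)%R|%:E =
   \int[mu]_(x in (Q : set LE)) `|F x|%:E)%E.
  by apply: eq_integral => x /set_mem Qx; rewrite FE.
apply: (bump_duality r0 FiQ) => phi bphi phi1 phi0.
have [theta th eq] := weak_difference_test bphi phi0 hs.
have ths : `|theta| < s by exact: le_lt_trans hs.
have fsh := integrable_shift (theta *: e) f'i.
have fd : mu.-integrable (setT : set LE) (EFin \o ((fun x => f' (x + theta *: e) - f' x) : LE -> R)).
  have := integrable_comb 1 (-1) fsh f'i.
  by congr (mu.-integrable _ (EFin \o _)); apply/funext => x; rewrite mul1r mulN1r.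
have mphi : measurable_fun (setT : set LE) (phi : LE -> R) by exact: bump_measurable.
have phiM (g : E -> R) : mu.-integrable (setT : set LE) (EFin \o (g : LE -> R)) ->
   mu.-integrable (setT : set LE) (EFin \o ((fun x => g x * phi x) : LE -> R)).
  move=> gi.
  exact: (@integrable_mul_bounded _ LE R mu setT measurableT g phi 1 mphi (fun x _ => phi1 x) gi).
have fdQ : mu.-integrable (Q : set LE) (EFin \o ((fun x => f' (x + theta *: e) - f' x) : LE -> R)).
  exact: (@integrableS _ LE R mu setT Q _ measurableT mQ (@subsetT _ _) fd).
have fdaQ := @integrable_abs _ LE R mu Q mQ _ fdQ.
have off (g : E -> R) x : ~ Q x -> g x * phi x = 0 by move=> /phi0 ->; rewrite mulr0.
have key : \int[mu]_(x in (Q : set LE)) (F x * phi x) =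
   \int[mu]_(x in (Q : set LE)) ((f' (x + theta *: e) - f' x) * phi x).
  rewrite -(@Rintegral_off _ LE R mu Q setT _ (@subsetT _ _) (off F)).
  rewrite -(@Rintegral_off _ LE R mu Q setT _ (@subsetT _ _)
     (off (fun x => f' (x + theta *: e) - f' x))).
  transitivity (\int[mu]_(x in (setT : set LE)) (h^-1 * ((u' (x + h *: e) - u' x) * phi x) - f' x * phi x)).
    by apply: eq_Rintegral => x _; rewrite /F mulrBl mulrA.
  have iu := phiM _ ub.
  have iu' : mu.-integrable (setT : set LE)
     (EFin \o ((fun x => h^-1 * ((u' (x + h *: e) - u' x) * phi x)) : LE -> R)).
    exact: (@integrableZl _ LE R mu setT measurableT h^-1 _ iu).
  rewrite (@RintegralB _ LE R mu setT _ _ measurableT iu' (phiM _ f'i)).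
  rewrite (@RintegralZl _ LE R mu setT _ h^-1 measurableT iu) eq mulKf//.
  rewrite -(@RintegralB _ LE R mu setT _ _ measurableT (phiM _ fsh) (phiM _ f'i)).
  by apply: eq_Rintegral => x _; rewrite mulrBl.
rewrite key -lee_fin.
apply: le_trans (hC theta th).
have -> : (\int[mu]_(x in (Q : set LE)) `|f (x + theta *: e)%R - f x|%:E =
   \int[mu]_(x in (Q : set LE)) `|f' (x + theta *: e)%R - f' x|%:E)%E.
  by apply: eq_integral => x /set_mem Qx; rewrite f'hE.
rewrite (@integrable_EFin_Rintegral _ LE R mu Q mQ _ fdaQ) lee_fin.
have iQ := @integrableS _ LE R mu setT Q _ measurableT mQ (@subsetT _ _) (phiM _ fd).
apply: (@le_Rintegral _ LE R mu Q _ _ mQ iQ fdaQ) => x Qx.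
apply: le_trans (ler_norm _) _; rewrite normrM ler_piMr//.
Qed.

End weak_difference.

Section L1_sequences.
Context d (T : measurableType d) (R : realType).
Variable mu : {measure set T -> \bar R}.
Variables (D : set T) (mD : measurable D).

Lemma Rintegral_dominated_cvg (fn : nat -> T -> R) (f g : T -> R) :
  (forall k, measurable_fun D (fn k)) -> measurable_fun D f ->
  {ae mu, forall x, D x -> fn ^~ x @ \oo --> f x} ->
  mu.-integrable D (EFin \o g) ->
  {ae mu, forall x k, D x -> `|fn k x| <= g x} ->
  (fun k => \int[mu]_(x in D) fn k x) @ \oo --> \int[mu]_(x in D) f x.
Proof.
move=> mfn mf cv gi dom.
have [] := @dominated_convergence _ _ _ mu D mD (fun k => EFin \o fn k)
  (EFin \o f) (EFin \o g).
- by move=> k; exact/measurable_EFinP.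
- exact/measurable_EFinP.
- apply: filterS cv => x + Dx => /(_ Dx) h; apply: cvg_EFin => //; exact: nearW.
- by [].
- by apply: filterS dom => x + k Dx => /(_ k Dx); rewrite /= lee_fin.
move=> fi _ cv'.
apply: fine_cvg; rewrite /Rintegral fineK//.
exact: integrable_fin_num.
Qed.

Lemma measurable_quotient (a : R) (f1 f2 f3 : T -> R) : measurable_fun D f1 ->
  measurable_fun D f2 -> measurable_fun D f3 ->
  measurable_fun D (fun x => a * (f1 x - f2 x) - f3 x).
Proof.
move=> m1 m2 m3; apply: measurable_funB => //; apply: measurable_funM => //.
exact: measurable_funB.
Qed.

Lemma integral_setU_le (A B : set T) (f : T -> R) : measurable A -> measurable B ->
  measurable_fun (A `|` B) f -> (forall x, 0 <= f x) ->
  (\int[mu]_(x in A `|` B) (f x)%:E <=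
   \int[mu]_(x in A) (f x)%:E + \int[mu]_(x in B) (f x)%:E)%E.
Proof.
move=> mA mB mf f0.
have mf' : measurable_fun (A `|` B) (fun x => (f x)%:E) by exact/measurable_EFinP.
have e : A `|` B = A `|` (B `\` A).
  apply/seteqP; split => x /=; last by tauto.
  by move=> [Ax|Bx]; [left|have [Ax|nAx] := pselect (A x); [left|right]].
rewrite e ge0_integral_setU//; last 4 first.
- exact: measurableD.
- by rewrite -e.
- by move=> x _; rewrite lee_fin.
- by rewrite disj_set2E setDIK.
apply: leeD2l; apply: ge0_subset_integral => //.
- exact: measurableD.
- by apply: measurable_funS mf' => //; exact: measurableU.
- by move=> x _; rewrite lee_fin.
Qed.

(** The sum of the [|g k|] has a finite integral, hence is finite almost
    everywhere: it is the majorant, and the terms of a convergent series tend to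
    zero. *)
Lemma L1_summable_dominated (g : nat -> T -> R) :
  (forall k, measurable_fun D (g k)) ->
  (forall k, (\int[mu]_(x in D) `|g k x|%:E <= (1 / (2 ^ (k + 1))%:R)%:E)%E) ->
  exists2 S : T -> R, mu.-integrable D (EFin \o S) &
    {ae mu, forall x, D x -> (forall k, `|g k x| <= S x) /\ g ^~ x @ \oo --> 0}.
Proof.
move=> mg hg.
have mag k : measurable_fun D (fun x => `|g k x|%:E).
  by apply/measurable_EFinP; exact: measurable_abs.
pose S (x : T) : \bar R := (\sum_(k <oo) `|g k x|%:E)%E.
have mS : measurable_fun D S.
  by apply: ge0_emeasurable_sum => // k x _ _; rewrite lee_fin.
have S0 x : (0 <= S x)%E by apply: nneseries_ge0 => k _ _; rewrite lee_fin.
have Sint : mu.-integrable D S.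
  apply/integrableP; split => //.
  under eq_integral do rewrite gee0_abs//.
  rewrite integral_nneseries//.
  apply: (@le_lt_trans _ _ (\sum_(k <oo) (1 / (2 ^ (k + 1))%:R : R)%:E)%E).
    by apply: lee_nneseries => // k _ _; exact: integral_ge0.
  by have /cvg_lim -> := @cvg_geometric_eseries_half R 1 0; rewrite // ltry.
have Sae := integrable_ae mD Sint.
have mfS : measurable_fun D (fine \o S) by exact: measurableT_comp.
exists (fine \o S).
  apply/integrableP; split; first exact/measurable_EFinP.
  have /integrableP[_] := Sint; apply: le_lt_trans.
  apply: ge0_le_integral => //.
  - by apply: measurableT_comp => //; exact/measurable_EFinP.
  - exact: measurableT_comp.
  move=> x Dx; rewrite /= (gee0_abs (S0 x)) ger0_norm ?fine_ge0//.
  by case: (S x) (S0 x) => [s| |] //= _; rewrite leey.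
apply: filterS Sae => x + Dx => /(_ Dx) Sfin.
have gS k : `|g k x| <= fine (S x).
  rewrite -lee_fin fineK// /S (@nneseriesD1 R (fun k => `|g k x|%:E) k xpredT)//.
  by rewrite leeDl// nneseries_ge0.
split => //.
have tail0 := @nneseries_tail_cvg R (fun k => `|g k x|%:E) xpredT.
have Slt : (S x < +oo)%E by rewrite ltey_eq Sfin.
have {}tail0 := tail0 Slt (fun k _ => normr_ge0 (g k x)).
apply: norm_cvg0.
suff : (fun k => `|g k x|%:E) @ \oo --> 0%:E by move=> /fine_cvgP[].
apply: (@squeeze_cvge _ _ _ _ (fun=> 0%E) _ _ _ _ _ tail0); last exact: cvg_cst.
apply: nearW => N; rewrite lee_fin normr_ge0/=.
rewrite (@nneseries_split _ _ N 1)// addn1 big_nat1 leeDl// nneseries_ge0//.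
Qed.

End L1_sequences.

Section compact_sets.
Context {R : realType} {n : nat}.
Local Notation E := 'rV[R]_n.

(** To prove that a compact set is contained in a set with a property stable
    under finite unions, it is enough to find small balls with this property. *)
Lemma compact_induction (K : set E) (P : set E -> Prop) : compact K -> P set0 ->
  (forall A B, P A -> P B -> P (A `|` B)) ->
  (forall x, K x -> exists2 r, 0 < r & P (ball x r)) -> exists2 A, P A & K `<=` A.
Proof.
move=> cK P0 PU Pb.
have [rho hrho] : exists rho : E -> R, forall x, K x -> 0 < rho x /\ P (ball x (rho x)).
  have h x : exists r, K x -> 0 < r /\ P (ball x r).
    have [Kx|nKx] := pselect (K x); last by exists 0.
    by have [r r0 Pr] := Pb x Kx; exists r.
  by have [rho hrho] := choice h; exists rho.
have : cover_compact K by rewrite -compact_cover.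
move=> /(_ E K (fun x => (ball x (rho x))^°)) [].
- by move=> x Kx; exact: open_interior.
- move=> x Kx; exists x => //; have [r0 _] := hrho x Kx.
  by apply: nbhsx_ballx.
move=> D DK KD.
have sub (s : seq E) : (forall x, x \in s -> K x) -> exists2 A, P A &
    forall x, x \in s -> ball x (rho x) `<=` A.
  elim: s => [|x s IHs] sK; first by exists set0 => // y; rewrite in_nil.
  have [A PA sA] : exists2 A, P A & forall x, x \in s -> ball x (rho x) `<=` A.
    by apply: IHs => y ys; apply: sK; rewrite inE ys orbT.
  have Kx : K x by apply: sK; rewrite inE eqxx.
  exists (ball x (rho x) `|` A); first by apply: PU => //; have [] := hrho x Kx.
  move=> y; rewrite inE => /orP[/eqP->|/sA yA]; first exact: subsetUl.
  by apply: subset_trans yA _; exact: subsetUr.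
have [A PA sA] := sub (finmap.enum_fset D) (fun x xD => set_mem (DK x xD)).
exists A => // x /KD [y yD /interior_subset]; exact: (sA y yD).
Qed.

Lemma compact_closed_ball_norm (x : E) (r : R) : compact (closed_ball_ (fun y : E => `|y|) x r).
Proof.
apply: bounded_closed_compact; last exact: closed_closed_ball_.
exists (`|x| + r); split; first exact: num_real.
move=> M hM y /= xy; apply: le_trans (ltW hM).
by rewrite -[y](subKr x); apply: le_trans (ler_normB _ _) _; rewrite lerD2l.
Qed.

Lemma compact_thickening (Omega K : set E) : open Omega -> compact K -> K `<=` Omega ->
  exists delta, 0 < delta /\ exists K', [/\ compact K', K' `<=` Omega &
    forall x h, K x -> `|h| < delta -> K' (x + h)].
Proof.
move=> oO cK KO.
pose P (A : set E) := exists delta, 0 < delta /\ exists K', [/\ compact K', K' `<=` Omega &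
    forall x h, A x -> `|h| < delta -> K' (x + h)].
have [||||A [delta [d0 [K' [cK' K'O h]]]] KA] := @compact_induction K P.
- by [].
- by exists 1; split => //; exists set0; split => //; exact: compact0.
- move=> A B [d1 [d10 [K1 [cK1 K1O h1]]]] [d2 [d20 [K2 [cK2 K2O h2]]]].
  exists (Num.min d1 d2); split; first by rewrite lt_min d10.
  exists (K1 `|` K2); split; [exact: compactU|by rewrite subUset|].
  move=> x h [Ax|Bx]; rewrite lt_min => /andP[hd1 hd2]; first by left; exact: h1.
  by right; exact: h2.
- move=> x Kx.
  have /nbhs_ballP[r /= r0 rO] := open_nbhs_nbhs (conj oO (KO _ Kx)).
  have r40 : 0 < r / 4 by rewrite divr_gt0.
  exists (r / 4) => //; exists (r / 4); split => //.
  exists (closed_ball_ (fun y : E => `|y|) x (r / 2)); split.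
  + exact: compact_closed_ball_norm.
  + move=> y hy; apply: rO; rewrite -ball_normE /=.
    by apply: le_lt_trans hy _; rewrite ltr_pdivrMr// ltr_pMr// ltr1n.
  + move=> y h xy hr; rewrite /closed_ball_ /=.
    have : ball x (r / 4 + r / 4) (y + h) by apply: ball_shift => //; exact: ltW.
    rewrite -ball_normE /= => /ltW.
    by rewrite (_ : r / 4 + r / 4 = r / 2)//; field.
exists delta; split => //; exists K'; split => // x h' Kx; apply: h; exact: KA.
Qed.

End compact_sets.

Section difference_quotient.
Context {R : realType} {n : nat}.
Local Notation E := 'rV[R]_n.
Local Notation LE := (@lebesgueRV R n).
Local Notation mu := (@lebesgue R n).

Lemma measurable_fun_shift_on (A B : set LE) (h : E) (f : E -> R) :
  measurable A -> measurable B -> (forall x, A x -> B (x + h)) ->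
  measurable_fun (B : set LE) (f : LE -> R) ->
  measurable_fun (A : set LE) ((fun x : E => f (x + h)) : LE -> R).
Proof.
move=> mA mB AB mf.
have ms : measurable_fun A ((fun x : E => x + h) : LE -> LE).
  exact: (@measurable_funS _ _ LE LE setT A _ measurableT (@subsetT _ _) (measurable_shift h)).
apply: (@measurable_comp _ _ _ LE LE R B f A _ mB _ mf ms).
by move=> _ [x Ax <-]; exact: AB.
Qed.

Definition quotient_error (i : 'I_n) (u f : E -> R) (h : R) : E -> R :=
  fun x => h^-1 * (u (x + h *: delta_mx 0 i) - u x) - f x.

(** On a ball, [weak_difference] bounds the error by the distance from [f] to its
    translates, which tends to zero; a compact set is covered by finitely many
    balls. *)
Lemma quotient_cvg (Omega K : set E) (i : 'I_n) (u f : E -> R) : open Omega ->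
  compact K -> K `<=` Omega -> L1loc Omega u -> weak_partial Omega i u f ->
  exists2 delta0, 0 < delta0 &
   (forall h, `|h| < delta0 ->
     measurable_fun (K : set LE) (quotient_error i u f h : LE -> R)) /\
   forall e, 0 < e -> exists2 delta, 0 < delta & forall h, h != 0 -> `|h| < delta ->
    (\int[mu]_(x in (K : set LE)) `|quotient_error i u f h x|%:E <= e%:E)%E.
Proof.
move=> oO cK KO ul uf.
have mK : measurable (K : set LE) by exact: compact_lebesgue_measurable.
have mO : measurable (Omega : set LE) by exact: open_lebesgue_measurable.
have mq (A : set LE) h : measurable A -> A `<=` Omega ->
   (forall x, A x -> Omega (x + h *: delta_mx 0 i)) ->
   measurable_fun A (quotient_error i u f h : LE -> R).
  move=> mA AO AhO; have [[mu_ _] [[mf _] _]] := (ul, uf).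
  have mh := measurable_fun_shift_on mA mO AhO mu_.
  have mu1 := @measurable_funS _ _ LE R Omega A u mO AO mu_.
  have mf1 := @measurable_funS _ _ LE R Omega A f mO AO mf.
  exact: (@measurable_quotient _ LE R A h^-1 _ _ _ mh mu1 mf1).
pose P (A : set E) := exists2 delta0, 0 < delta0 & [/\ open A, A `<=` Omega,
   forall h x, `|h| < delta0 -> A x -> Omega (x + h *: delta_mx 0 i) &
   forall e, 0 < e -> exists2 delta, 0 < delta & forall h, h != 0 -> `|h| < delta ->
    (\int[mu]_(x in (A : set LE)) `|quotient_error i u f h x|%:E <= e%:E)%E].
have [||||A [d0 d00 [oA AO Ah PA]] KA] := @compact_induction R n K P.
- by [].
- exists 1 => //; split => //.
  by move=> e e0; exists 1 => // h _ _; rewrite integral_set0 lee_fin ltW.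
- move=> A B [a0 a00 [oA AO Ah PA]] [b0 b00 [oB BO Bh PB]].
  exists (Num.min a0 b0); first by rewrite lt_min a00.
  split; [exact: openU|by rewrite subUset| |].
    by move=> h x; rewrite lt_min => /andP[ha hb] [|]; [exact: Ah|exact: Bh].
  move=> e e0; have e20 : 0 < e / 2 by rewrite divr_gt0.
  have [a a1 ha] := PA _ e20; have [b b1 hb] := PB _ e20.
  exists (Num.min (Num.min a b) (Num.min a0 b0)).
    by rewrite !lt_min a00 b00 a1 b1.
  move=> h h0; rewrite !lt_min => /andP[/andP[h1 h2] /andP[h3 h4]].
  have mA : measurable (A : set LE) by exact: open_lebesgue_measurable.
  have mB : measurable (B : set LE) by exact: open_lebesgue_measurable.
  have mAB := @measurableU _ LE A B mA mB.
  rewrite (splitr e) EFinD; apply: le_trans (leeD (ha h h0 h1) (hb h h0 h2)).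
  have ABO : A `|` B `<=` Omega by rewrite subUset.
  have ABh x : (A `|` B) x -> Omega (x + h *: delta_mx 0 i).
    by move=> [|]; [exact: Ah|exact: Bh].
  have mAB' := @measurable_abs _ LE R _ _ (mq (A `|` B) h mAB ABO ABh).
  exact: (@integral_setU_le _ LE R mu A B (fun x => `|quotient_error i u f h x|) mA mB mAB'
    (fun x => normr_ge0 _)).
- move=> x Kx.
  have /nbhs_ballP[r /= r0 rO] := open_nbhs_nbhs (conj oO (KO _ Kx)).
  pose s := r / 4; have s0 : 0 < s by rewrite divr_gt0.
  pose C := closed_ball_ (fun y : E => `|y|) x (s + s).
  have cC : compact C by exact: compact_closed_ball_norm.
  have CO : C `<=` Omega.
    move=> y hy; apply: rO; rewrite -ball_normE /=.
    by apply: le_lt_trans hy _; rewrite /s; lra.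
  have BC : ball x (s + s) `<=` C by rewrite -ball_normE /C /closed_ball_ => y /= /ltW.
  have BC0 : ball x s `<=` C.
    by apply: subset_trans BC; apply: le_ball; rewrite lerDl ltW.
  exists s => //; exists s => //; split.
  + exact: ball_open.
  + exact: subset_trans BC0 CO.
  + move=> h y hs xy; apply: CO; apply: BC.
    by apply: shift_in_ball => //; rewrite norm_scale_delta.
  move=> e e0.
  pose f' : E -> R := f \_ (ball x (s + s)).
  have mS := @measurable_ball_lebesgue R n x (s + s).
  have fi : mu.-integrable (setT : set LE) (EFin \o (f' : LE -> R)).
    have gi := L1loc_integrable oO uf.1 cC CO mS BC.
    have := (@integrable_mkcond _ LE R mu _ (EFin \o f) mS).1 gi.
    by rewrite restrict_EFin.
  have f'0 y : ~ ball x (s + s) y -> f' y = 0 by move=> h; rewrite /f' patchE memNset.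
  have ss0 : 0 < s + s by rewrite addr_gt0.
  have [delta d0 hd] := @L1_shift_continuous R n x (s + s) ss0 f' i fi f'0 e e0.
  exists (Num.min s delta); first by rewrite lt_min s0.
  move=> h h0; rewrite lt_min => /andP[hs hdl].
  apply: (weak_difference oO cC CO BC s0 s0 ul uf h0 hs) => t th.
  have ts := le_lt_trans th hs.
  apply: le_trans (hd t (le_lt_trans th hdl)).
  have mQ := @measurable_ball_lebesgue R n x s.
  have f'E y : ball x (s + s) y -> f' y = f y by move=> Sy; rewrite /f' patchE mem_set.
  have -> : (\int[mu]_(y in (ball x s : set LE)) `|f (y + t *: delta_mx 0 i)%R - f y|%:E =
     \int[mu]_(y in (ball x s : set LE)) `|f' (y + t *: delta_mx 0 i)%R - f' y|%:E)%E.
    apply: eq_integral => y /set_mem Qy; rewrite !f'E//.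
      by apply: le_ball Qy; rewrite lerDl ltW.
    by apply: shift_in_ball => //; rewrite norm_scale_delta.
  have mf' : measurable_fun (setT : set LE) (f' : LE -> R) := integrable_real_measurable fi.
  have mf'h := measurable_fun_shift (t *: delta_mx 0 i) mf'.
  have md := @measurable_abs_sub _ LE R setT _ _ mf'h mf'.
  apply: (@ge0_subset_integral _ LE R mu _ _ mQ measurableT).
  - exact/measurable_EFinP.
  - by move=> y _; rewrite lee_fin.
  - exact: subsetT.
have mA : measurable (A : set LE) by exact: open_lebesgue_measurable.
exists d0 => //; split.
  by move=> h hd; apply: mq => // x /KA; exact: Ah.
move=> e e0; have [delta dl0 hd] := PA e e0.
exists (Num.min d0 delta); first by rewrite lt_min d00.
move=> h h0; rewrite lt_min => /andP[h1 h2].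
apply: le_trans (hd h h0 h2).
have mqA : measurable_fun (A : set LE) (quotient_error i u f h : LE -> R).
  by apply: mq => // x; exact: Ah.
have maA := @measurable_abs _ LE R A _ mqA.
apply: (@ge0_subset_integral _ LE R mu _ _ mK mA).
- exact/measurable_EFinP.
- by move=> y _; rewrite lee_fin.
- exact: KA.
Qed.

End difference_quotient.

(** * The chain rule *)

Lemma ae_le_integral_lty d (T : measurableType d) (R : realType)
    (mu : {measure set T -> \bar R}) (D : set T) (f g : T -> R) : measurable D ->
  measurable_fun D f -> measurable_fun D g ->
  {ae mu, forall x, D x -> `|f x| <= `|g x|} ->
  (\int[mu]_(x in D) `|g x|%:E < +oo)%E -> (\int[mu]_(x in D) `|f x|%:E < +oo)%E.
Proof.
move=> mD mf mg fg; apply: le_lt_trans.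
apply: ae_ge0_le_integral => //.
- by apply/measurable_EFinP; exact: measurable_abs.
- by apply/measurable_EFinP; exact: measurable_abs.
Qed.

Lemma measurable_quotient_mul d (T : measurableType d) (R : realType) (D : set T)
    (a : R) (f1 f2 f3 : T -> R) : measurable_fun D f1 ->
  measurable_fun D f2 -> measurable_fun D f3 ->
  measurable_fun D (fun x => a * (f1 x - f2 x) * f3 x).
Proof.
move=> m1 m2 m3; apply: measurable_funM => //; apply: measurable_funM => //.
exact: measurable_funB.
Qed.

Section slopes.
Context {R : realType}.

(** Differentiability relative to [I]: the power [s^p] is differentiable at the
    end of the half-line [s >= 0] in this sense only. *)
Definition derivable_in (I : set R) (f f' : R -> R) : Prop :=
  forall s, I s -> forall e, 0 < e -> exists2 delta, 0 < delta &
  forall t, I t -> `|t - s| < delta -> `|f t - f s - f' s * (t - s)| <= e * `|t - s|.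

(** The bounds on [f] and [f'] serve for the local boundedness of [f o v] and the
    local integrability of [f'(v) Dv], the Lipschitz bound for domination. *)
Definition locally_lipschitz_in (I : set R) (f f' : R -> R) : Prop :=
  forall M, exists2 L, 0 <= L & forall s, I s -> `|s| <= M ->
   [/\ `|f s| <= L, `|f' s| <= L &
       forall t, I t -> `|t| <= M -> `|f t - f s| <= L * `|t - s|].

(** The difference quotients of [f] along increments [h k * d k], where [d k]
    is a convergent sequence: those of [v] in the chain rule. *)
Lemma slope_cvg (I : set R) (f f' : R -> R) (s l S : R) (d h : nat -> R) :
  derivable_in I f f' -> I s -> (forall k, I (s + h k * d k)) ->
  (forall k, h k != 0) -> h @ \oo --> 0 -> d @ \oo --> l -> (forall k, `|d k| <= S) ->
  (fun k => (h k)^-1 * (f (s + h k * d k) - f s)) @ \oo --> f' s * l.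
Proof.
move=> fI Is Ia hn0 h0 dl dS.
have S0 : 0 <= S by apply: le_trans (dS 0%N).
have rem : (fun k => (h k)^-1 * (f (s + h k * d k) - f s) - f' s * d k) @ \oo --> 0.
  apply/cvgr0Pnorm_le => e e0.
  have e1 : 0 < e / (S + 1) by rewrite divr_gt0// ltr_wpDl.
  have [delta d0 hdelta] := fI s Is _ e1.
  have hd0 : (fun k => h k * d k) @ \oo --> 0 * l by apply: cvgM.
  rewrite mul0r in hd0.
  move/cvgr0Pnorm_lt : hd0 => /(_ _ d0).
  apply: filterS => k hk.
  have E : (h k)^-1 * (f (s + h k * d k) - f s) - f' s * d k =
      (h k)^-1 * (f (s + h k * d k) - f s - f' s * (s + h k * d k - s)).
    by field; exact: hn0.
  have := hdelta (s + h k * d k) (Ia k).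
  rewrite {1}addrAC subrr add0r => /(_ hk) hh.
  rewrite E normrM normrV ?unitfE// ler_pdivrMl ?normr_gt0//.
  apply: le_trans hh _.
  rewrite addrAC subrr add0r normrM mulrCA; apply: ler_wpM2l => //.
  rewrite mulrAC ler_pdivrMr ?ltr_wpDl// ler_wpM2l ?(ltW e0)//.
  by apply: le_trans (dS k) _; rewrite lerDl.
rewrite [X in X @ _](_ : _ = (fun k => (h k)^-1 * (f (s + h k * d k) - f s) - f' s * d k)
    \+ (fun k => f' s * d k)); last by apply/funext => k; rewrite /= subrK.
rewrite -[f' s * l]add0r; apply: cvgD => //.
exact: (cvgM (cvg_cst _) dl).
Qed.

End slopes.

Section local_integrability.
Context {R : realType} {n : nat}.
Local Notation E := 'rV[R]_n.
Local Notation LE := (@lebesgueRV R n).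
Local Notation mu := (@lebesgue R n).

Lemma compact_lebesgue_lty (K : set E) : compact K -> (mu K < +oo)%E.
Proof.
move=> cK; have [M [_ hM]] := compact_bounded cK.
have sub : K `<=` ball 0 (`|M| + 2).
  move=> x Kx; rewrite -ball_normE /= sub0r normrN.
  apply: (@le_lt_trans _ _ (`|M| + 1)); last by rewrite ltrD2l ltr1n.
  by apply: hM => //; rewrite ltr_pwDr// ler_norm.
apply: le_lt_trans (lebesgue_ball_lty (0 : E) (`|M| + 2)).
by apply: le_measure => //; rewrite inE; [exact: compact_lebesgue_measurable|exact: measurable_ball_lebesgue].
Qed.

Lemma L1loc_dominated (Omega : set E) (g h : E -> R) : open Omega ->
  lebesgue_measurable Omega g -> L1loc Omega h ->
  (forall K, compact K -> K `<=` Omega ->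
     exists L, ae_in K (fun x => `|g x| <= L * `|h x|)) -> L1loc Omega g.
Proof.
move=> oO mg [mh hi] dom; split => // K cK KO.
have [L hL] := dom K cK KO.
have mK : measurable (K : set LE) by exact: compact_lebesgue_measurable.
have mO : measurable (Omega : set LE) by exact: open_lebesgue_measurable.
have mgK := @measurable_funS _ _ LE R Omega K g mO KO mg.
have mhK := @measurable_funS _ _ LE R Omega K h mO KO mh.
have hiK : mu.-integrable (K : set LE) (EFin \o (h : LE -> R)).
  by apply/integrableP; split; [exact/measurable_EFinP|exact: hi].
have mL : measurable_fun (K : set LE) (fun _ : LE => L) by exact: measurable_cst.
have hLi := @integrable_mul_bounded _ LE R mu K mK h (fun=> L) `|L| mL (fun x _ => lexx _) hiK.
have ae : ae_in K (fun x => `|g x| <= `|h x * L|).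
  apply: ae_in_sub hL => // x _ /le_trans; apply.
  by rewrite normrM mulrC ler_wpM2l// ler_norm.
exact: (@ae_le_integral_lty _ LE R mu K g (fun x => h x * L) mK mgK
  (@integrable_real_measurable _ LE R mu K _ hLi) ae (@integrable_abs_lty _ LE R mu K _ hLi)).
Qed.

Lemma L1loc_cst (Omega : set E) (a : R) : L1loc Omega (fun=> a).
Proof.
split; first exact: (@measurable_cst _ _ LE).
move=> K cK KO.
have mK : measurable (K : set LE) by exact: compact_lebesgue_measurable.
by rewrite (@integral_cst _ LE R mu K mK) lte_mul_pinfty// compact_lebesgue_lty.
Qed.

Lemma Linftyloc_L1loc (Omega : set E) (g : E -> R) : open Omega ->
  Linftyloc Omega g -> L1loc Omega g.
Proof.
move=> oO [mg gb]; apply: (L1loc_dominated oO mg (L1loc_cst Omega 1)) => K cK KO.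
have [M hM] := gb K cK KO; exists M.
by apply: ae_in_sub hM => // x _; rewrite normr1 mulr1.
Qed.

Lemma ae_in_shift (A B : set E) (h : E) (P : E -> Prop) :
  (forall x, A x -> B (x + h)) -> ae_in B P -> ae_in A (fun x => P (x + h)).
Proof.
move=> AB /(negligible_shift h) hN.
have : mu.-negligible (~` [set x : E | A x -> P (x + h)]).
  by apply: negligibleS hN => x /= nAP BP; apply: nAP => Ax; apply: BP; exact: AB.
exact.
Qed.

Lemma continuous_compact_supp_bounded (g : E -> R) (K : set E) : continuous g ->
  compact K -> (forall x, ~ K x -> g x = 0) -> exists2 M, 0 <= M & forall x, `|g x| <= M.
Proof.
move=> cg cK g0.
have cg' : {within K, continuous g} by exact: continuous_subspaceT.
have [M [_ hM]] := compact_bounded (continuous_compact cg' cK).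
exists (`|M| + 1) => [|x]; first by rewrite addr_ge0.
have [Kx|nKx] := pselect (K x); last by rewrite g0// normr0 addr_ge0.
by apply: (hM (`|M| + 1)); [rewrite ltr_pwDr// ler_norm|exists x].
Qed.

Lemma off_supp (phi : E -> R) x : ~ supp phi x -> phi x = 0.
Proof.
by move=> nx; apply: contrapT => px; apply: nx; apply: subset_closure; apply/eqP.
Qed.

End local_integrability.

Section chain_rule.
Context {R : realType} {n : nat}.
Local Notation E := 'rV[R]_n.
Local Notation LE := (@lebesgueRV R n).
Local Notation mu := (@lebesgue R n).
Variables (Omega : set E) (v : E -> R) (f f' : R -> R) (I : set R).
Hypothesis oO : open Omega.
Hypothesis vb : Linftyloc Omega v.
Hypothesis vI : ae_in Omega (fun x => I (v x)).
Hypothesis mf : measurable_fun setT f.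
Hypothesis mf' : measurable_fun setT f'.
Hypothesis fL : locally_lipschitz_in I f f'.
Hypothesis fD : derivable_in I f f'.

Let mO : measurable (Omega : set LE). Proof. exact: open_lebesgue_measurable. Qed.

Lemma comp_lebesgue_measurable (g : R -> R) : measurable_fun setT g ->
  lebesgue_measurable Omega (fun x => g (v x)).
Proof. by move=> mg; exact: (@measurableT_comp _ _ _ LE R R g Omega v mg vb.1). Qed.

Let bound_on (K : set E) : compact K -> K `<=` Omega -> exists M,
  ae_in K (fun x => I (v x) /\ `|v x| <= M).
Proof.
move=> cK KO; have [M hM] := vb.2 K cK KO; exists M.
by apply: ae_in_and hM; apply: ae_in_sub vI.
Qed.

Lemma comp_Linftyloc : Linftyloc Omega (fun x => f (v x)).
Proof.
split; first exact: comp_lebesgue_measurable.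
move=> K cK KO; have [M hM] := bound_on cK KO.
have [L L0 hL] := fL M; exists L.
by apply: ae_in_sub hM => // x _ [Ix vM]; have [] := hL _ Ix vM.
Qed.

Let comp_L1loc : L1loc Omega (fun x => f (v x)).
Proof. exact: (Linftyloc_L1loc oO comp_Linftyloc). Qed.

Variables (i : 'I_n) (Dv : E -> R).
Hypothesis wv : weak_partial Omega i v Dv.
Local Notation e := (delta_mx 0 i : E).

Let chain_L1loc : L1loc Omega (fun x => f' (v x) * Dv x).
Proof.
apply: (L1loc_dominated oO _ wv.1).
  exact: (@measurable_funM _ LE R Omega _ _ (comp_lebesgue_measurable mf') wv.1.1).
move=> K cK KO; have [M hM] := bound_on cK KO; have [L L0 hL] := fL M.
exists L; apply: ae_in_sub hM => // x _ [Ix vM].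
by rewrite normrM ler_wpM2r//; have [] := hL _ Ix vM.
Qed.

Section test.
Variable phi : E -> R.
Hypothesis tphi : test_function Omega phi.

Let K := supp phi.
Let sphi : smooth phi. Proof. by have [] := tphi. Qed.
Let cK : compact K. Proof. by have [] := tphi. Qed.
Let KO : K `<=` Omega. Proof. by have [] := tphi. Qed.
Let mK : measurable (K : set LE). Proof. exact: compact_lebesgue_measurable. Qed.
Let cphi : continuous phi. Proof. by have [] := sphi [::]. Qed.
Let cdphi : continuous (partial i phi). Proof. by have [] := sphi [:: i]. Qed.

Let phi_bd : exists2 M, 0 <= M & forall x, `|phi x| <= M.
Proof. exact: (continuous_compact_supp_bounded cphi cK (@off_supp _ _ phi)). Qed.

Let dphi_bd : exists2 M, 0 <= M & forall x, `|partial i phi x| <= M.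
Proof.
exact: (continuous_compact_supp_bounded cdphi cK (fun x => @partial_off_supp _ _ phi i x)).
Qed.

(* Discrete integration by parts: invariance under translations moves the
   difference quotient to [phi], where smoothness makes it converge
   boundedly. *)
Let quotient_test_cvg (h : nat -> R) (F' : E -> R) :
  mu.-integrable (setT : set LE) (EFin \o (F' : LE -> R)) ->
  (forall k, h k != 0) -> h @ \oo --> 0 ->
  (fun k => \int[mu]_(x in (setT : set LE))
     ((h k)^-1 * (F' (x + h k *: e) - F' x) * phi x)) @ \oo -->
  - \int[mu]_(x in (setT : set LE)) (F' x * partial i phi x).
Proof.
move=> Fi hn0 h0.
have [M M0 hM] := phi_bd; have [M' M'0 hM'] := dphi_bd.
have mphi : measurable_fun (setT : set LE) (phi : LE -> R).
  exact: continuous_lebesgue_measurable.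
have mdphi : measurable_fun (setT : set LE) (partial i phi : LE -> R).
  exact: continuous_lebesgue_measurable.
have ip (g psi : E -> R) N : mu.-integrable (setT : set LE) (EFin \o (g : LE -> R)) ->
    measurable_fun (setT : set LE) (psi : LE -> R) -> (forall x, `|psi x| <= N) ->
    mu.-integrable (setT : set LE) (EFin \o ((fun x => g x * psi x) : LE -> R)).
  move=> gi mpsi bpsi.
  exact: (@integrable_mul_bounded _ LE R mu setT measurableT g psi N mpsi (fun x _ => bpsi x) gi).
have Fa := @integrable_abs _ LE R mu setT measurableT _ Fi.
pose q k (x : E) := (h k)^-1 * (phi (x + (- h k) *: e) - phi x).
have mq k : measurable_fun (setT : set LE) (q k : LE -> R).
  have ms := measurable_fun_shift ((- h k) *: e) mphi.
  have mc : measurable_fun (setT : set LE) (fun _ : LE => (h k)^-1) by exact: measurable_cst.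
  exact: (@measurable_funM _ LE R setT _ _ mc (@measurable_funB _ LE R setT _ _ ms mphi)).
have qb k x : `|q k x| <= M'.
  have [s _ hs] := smooth_line_MVT i x (- h k) sphi.
  rewrite /q hs mulrCA mulrN mulVf// normrM normrN normr1 mulr1; exact: hM'.
have qcv x : q ^~ x @ \oo --> - partial i phi x.
  have := smooth_line_is_derive i x 0 sphi => -[dx ex].
  rewrite scale0r addr0 in ex.
  have cv : (fun t : R => t^-1 *: (((fun s : R => phi (x + s *: e)) \o shift 0) (t *: (1 : R)) -
     phi (x + 0 *: e))) @ 0^' --> partial i phi x by rewrite -ex.
  have nh : (fun k => - h k) @ \oo --> 0 by rewrite -oppr0; exact: cvgN.
  have nhk k : - h k != 0 by rewrite oppr_eq0.
  have := (cvgr_dnbhsP _ _ _).1 cv (fun k => - h k) (conj nhk nh).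
  move=> /cvgN; apply: cvg_trans; apply: near_eq_cvg; apply: nearW => k.
  rewrite /q opprfctE /= scale0r !addr0 scaler1 [X in - X]/GRing.scale/=.
  by rewrite invrN mulNr opprK.
have step k : \int[mu]_(x in (setT : set LE))
     ((h k)^-1 * (F' (x + h k *: e) - F' x) * phi x) =
   \int[mu]_(x in (setT : set LE)) (F' x * q k x).
  have i1 := ip _ _ _ Fi mphi hM.
  have mphi' := measurable_fun_shift ((- h k) *: e) mphi.
  have i2 := ip _ _ _ Fi mphi' (fun x => hM (x + (- h k) *: e)).
  have i2' := integrable_shift (h k *: e) i2.
  have E2 : (fun x : E => F' (x + h k *: e) * phi (x + h k *: e + (- h k) *: e)) =
      fun x : E => F' (x + h k *: e) * phi x.
    by apply/funext => x; rewrite scaleNr addrK.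
  rewrite E2 in i2'.
  have eq2 := Rintegral_shift (h k *: e) i2; rewrite (congr1 (fun g : E -> R => \int[mu]_(x in (setT : set LE)) g x) E2) in eq2.
  transitivity (\int[mu]_(x in (setT : set LE)) ((h k)^-1 * (F' (x + h k *: e) * phi x - F' x * phi x))).
    by apply: eq_Rintegral => x _; ring.
  have i3 := @integrableB _ LE R mu setT measurableT _ _ i2' i1.
  rewrite (@RintegralZl _ LE R mu setT _ (h k)^-1 measurableT i3).
  rewrite (@RintegralB _ LE R mu setT _ _ measurableT i2' i1) eq2.
  rewrite -(@RintegralB _ LE R mu setT _ _ measurableT i2 i1).
  have i4 := @integrableB _ LE R mu setT measurableT _ _ i2 i1.
  rewrite -(@RintegralZl _ LE R mu setT _ (h k)^-1 measurableT i4).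
  by apply: eq_Rintegral => x _; rewrite /q; ring.
under eq_fun do rewrite step.
have -> : - (\int[mu]_(x in (setT : set LE)) (F' x * partial i phi x)) =
   \int[mu]_(x in (setT : set LE)) (F' x * - partial i phi x).
  have i1 := ip _ _ _ Fi mdphi hM'.
  rewrite -mulN1r -(@RintegralZl _ LE R mu setT _ (-1) measurableT i1).
  by apply: eq_Rintegral => x _; ring.
have mF : measurable_fun (setT : set LE) (F' : LE -> R) := integrable_real_measurable Fi.
apply: (@Rintegral_dominated_cvg _ LE R mu setT measurableT (fun k x => F' x * q k x)
   (fun x => F' x * - partial i phi x) (fun x => `|F' x| * M')).
- by move=> k; exact: (@measurable_funM _ LE R setT _ _ mF (mq k)).
- exact: (@measurable_funM _ LE R setT _ _ mF (@measurable_funN _ LE R setT _ mdphi)).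
- by apply: ae_inW => x _; apply: cvgMr; exact: qcv.
- exact: (@integrable_mul_bounded _ LE R mu setT measurableT (fun x => `|F' x|) (fun=> M') `|M'|
     (@measurable_cst _ _ LE _ _ _) (fun x _ => lexx _) Fa).
- by apply: (@aeW _ LE) => x k _; rewrite normrM ler_wpM2l.
Qed.

(* Steps are chosen so that the errors are summable in [L^1], which turns
   convergence in [L^1] into dominated convergence almost everywhere. *)
Let good_steps (delta : R) : 0 < delta -> exists h : nat -> R, exists S : E -> R,
  [/\ forall k, h k != 0 /\ `|h k| < delta, h @ \oo --> 0,
      forall k, measurable_fun (K : set LE) (quotient_error i v Dv (h k) : LE -> R),
      mu.-integrable (K : set LE) (EFin \o (S : LE -> R)) &
      ae_in K (fun x => (forall k, `|quotient_error i v Dv (h k) x| <= S x) /\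
        (fun k => quotient_error i v Dv (h k) x) @ \oo --> 0)].
Proof.
move=> delta0.
have [d1 d10 [mq cv]] := quotient_cvg oO cK KO (Linftyloc_L1loc oO vb) wv.
have step k : exists h, [/\ h != 0, `|h| < delta, `|h| < d1, `|h| < k.+1%:R^-1 &
    (\int[mu]_(x in (K : set LE)) `|quotient_error i v Dv h x|%:E <= (1 / (2 ^ (k + 1))%:R)%:E)%E].
  have pk : 0 < 1 / (2 ^ (k + 1))%:R :> R by rewrite divr_gt0// ltr0n expn_gt0.
  have [d2 d20 hd2] := cv _ pk.
  pose m := Num.min (Num.min delta d1) (Num.min (k.+1%:R^-1) d2).
  have m0 : 0 < m by rewrite !lt_min delta0 d10 d20 invr_gt0 ltr0n.
  have : m / 2 < m by rewrite ltr_pdivrMr// ltr_pMr// ltr1n.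
  have m20 : 0 < m / 2 by rewrite divr_gt0.
  rewrite {2}/m !lt_min => /andP[/andP[h1 h2] /andP[h3 h4]].
  have a : `|m / 2| = m / 2 by rewrite gtr0_norm.
  exists (m / 2); split; rewrite ?a ?gt_eqF//.
  by apply: hd2; rewrite ?a ?gt_eqF.
have [h hh] := choice step.
have mqh k : measurable_fun (K : set LE) (quotient_error i v Dv (h k) : LE -> R).
  by apply: mq; have [] := hh k.
have ih k : (\int[mu]_(x in (K : set LE)) `|quotient_error i v Dv (h k) x|%:E
    <= (1 / (2 ^ (k + 1))%:R)%:E)%E by have [] := hh k.
have [S Si Sae] := @L1_summable_dominated _ LE R mu K mK _ mqh ih.
exists h; exists S; split => //.
- by move=> k; have [] := hh k.
- apply/cvgr0Pnorm_lt => eps eps0.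
  have := near_infty_natSinv_lt (PosNum eps0).
  apply: filterS => k /= hk; apply: lt_trans hk.
  by have [] := hh k.
Qed.

Lemma weak_partial_chain_test :
  \int[mu]_(x in (Omega : set LE)) (f (v x) * partial i phi x) =
  - \int[mu]_(x in (Omega : set LE)) (f' (v x) * Dv x * phi x).
Proof.
have [delta [delta0 [K' [cK' K'O thick]]]] := compact_thickening oO cK KO.
have [h [S [hk h0 mq Si hae]]] := good_steps delta0.
have [M hM] := bound_on cK' K'O.
have [L L0 hL] := fL M.
have [B B0 hB] := phi_bd.
have KK' : K `<=` K' by move=> x Kx; rewrite -[x]addr0; apply: thick => //; rewrite normr0.
have mK' : measurable (K' : set LE) by exact: compact_lebesgue_measurable.
pose F : E -> R := fun x => f (v x).
pose F' : E -> R := F \_ K'.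
have FiK' := L1loc_integrable oO comp_L1loc cK' K'O mK' (@subset_refl _ _).
have Fi : mu.-integrable (setT : set LE) (EFin \o (F' : LE -> R)).
  have := (@integrable_mkcond _ LE R mu K' (EFin \o F) mK').1 FiK'.
  by rewrite restrict_EFin.
have F'E x : K' x -> F' x = F x by move=> K'x; rewrite /F' patchE mem_set.
have hn0 k : h k != 0 by have [] := hk k.
have nhe k : `|h k *: e| < delta by rewrite norm_scale_delta; have [] := hk k.
have K'h k x : K x -> K' (x + h k *: e) by move=> Kx; exact: thick.
have lim1 := quotient_test_cvg Fi hn0 h0.
have phiK x : ~ K x -> phi x = 0 by exact: off_supp.
have dphiK x : ~ K x -> partial i phi x = 0 by exact: partial_off_supp.
have E1 k : \int[mu]_(x in (setT : set LE)) ((h k)^-1 * (F' (x + h k *: e) - F' x) * phi x) =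
    \int[mu]_(x in (K : set LE)) ((h k)^-1 * (F (x + h k *: e) - F x) * phi x).
  rewrite (@Rintegral_off _ LE R mu K setT _ (@subsetT _ _)); last first.
    by move=> x /phiK ->; rewrite mulr0.
  apply: eq_Rintegral => x /set_mem Kx; rewrite !F'E//; [exact: KK'|exact: K'h].
have E2 : \int[mu]_(x in (setT : set LE)) (F' x * partial i phi x) =
    \int[mu]_(x in (Omega : set LE)) (F x * partial i phi x).
  rewrite (@Rintegral_off _ LE R mu K setT _ (@subsetT _ _)); last first.
    by move=> x /dphiK ->; rewrite mulr0.
  rewrite (@Rintegral_off _ LE R mu K Omega _ KO); last first.
    by move=> x /dphiK ->; rewrite mulr0.
  by apply: eq_Rintegral => x /set_mem Kx; rewrite F'E//; exact: KK'.
have E3 : \int[mu]_(x in (Omega : set LE)) (f' (v x) * Dv x * phi x) =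
    \int[mu]_(x in (K : set LE)) (f' (v x) * Dv x * phi x).
  rewrite (@Rintegral_off _ LE R mu K Omega _ KO)//.
  by move=> x /phiK ->; rewrite mulr0.
rewrite E2 in lim1.
rewrite (_ : (fun k => _) = (fun k => \int[mu]_(x in (K : set LE)) ((h k)^-1 * (F (x + h k *: e) - F x) * phi x))) in lim1; last first.
  by apply/funext => k; exact: E1.
have mphi : measurable_fun (K : set LE) (phi : LE -> R) by exact: continuous_lebesgue_measurable.
have mFO : measurable_fun (Omega : set LE) (F : LE -> R) := comp_L1loc.1.
have mFK := @measurable_funS _ _ LE R Omega K F mO KO mFO.
have Dvi := L1loc_integrable oO wv.1 cK KO mK (@subset_refl _ _).
have Dva := @integrable_abs _ LE R mu K mK _ Dvi.
have domi : mu.-integrable (K : set LE) (EFin \o (fun x : LE => (S x + `|Dv x|) * (L * B))).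
  have SD := @integrableD _ LE R mu K mK _ _ Si Dva.
  exact: (@integrable_mul_bounded _ LE R mu K mK (fun x => S x + `|Dv x|) (fun=> L * B) `|L * B|
     (@measurable_cst _ _ LE _ _ _) (fun x _ => lexx _) SD).
have good : ae_in K (fun x => [/\ I (v x), `|v x| <= M,
    forall k, I (v (x + h k *: e)) /\ `|v (x + h k *: e)| <= M,
    forall k, `|quotient_error i v Dv (h k) x| <= S x &
    (fun k => quotient_error i v Dv (h k) x) @ \oo --> 0]).
  have a1 : ae_in K (fun x => forall k, I (v (x + h k *: e)) /\ `|v (x + h k *: e)| <= M).
    by apply: ae_in_all => k; exact: (ae_in_shift (K'h k) hM).
  have a2 : ae_in K (fun x => I (v x) /\ `|v x| <= M) by exact: ae_in_sub hM.
  apply: ae_in_sub (ae_in_and (ae_in_and a1 a2) hae) => // x _.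
  by move=> [[? [? ?]] [? ?]].
have qE k x : v (x + h k *: e) = v x + h k * (quotient_error i v Dv (h k) x + Dv x).
  by rewrite /quotient_error; field; exact: hn0.
have Sd k x : `|quotient_error i v Dv (h k) x| <= S x ->
    `|quotient_error i v Dv (h k) x + Dv x| <= S x + `|Dv x|.
  by move=> hS; apply: le_trans (ler_normD _ _) _; rewrite lerD2r.
have lim2 : (fun k => \int[mu]_(x in (K : set LE)) ((h k)^-1 * (F (x + h k *: e) - F x) * phi x)) @ \oo -->
    \int[mu]_(x in (K : set LE)) (f' (v x) * Dv x * phi x).
  apply: (@Rintegral_dominated_cvg _ LE R mu K mK _ _ (fun x => (S x + `|Dv x|) * (L * B))).
  - move=> k.
    have mFh := measurable_fun_shift_on mK mO (fun x Kx => K'O _ (K'h k x Kx)) mFO.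
    exact: (@measurable_quotient_mul _ LE R K (h k)^-1 _ _ _ mFh mFK mphi).
  - have mg : measurable_fun (K : set LE) ((fun x => f' (v x) * Dv x) : LE -> R).
      exact: (@measurable_funS _ _ LE R Omega K _ mO KO chain_L1loc.1).
    exact: (@measurable_funM _ LE R K _ _ mg mphi).
  - apply: ae_in_sub good => // x Kx [Ix vM Ih hS cv].
    have cvd : (fun k => quotient_error i v Dv (h k) x + Dv x) @ \oo --> Dv x.
      by rewrite -[X in _ --> X]add0r; apply: cvgD => //; exact: cvg_cst.
    have Ih' k : I (v x + h k * (quotient_error i v Dv (h k) x + Dv x)).
      by rewrite -qE; have [] := Ih k.
    have sl := slope_cvg fD Ix Ih' hn0 h0 cvd (fun k => Sd k x (hS k)).
    rewrite [X in X @ _](_ : _ =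
       (fun k => (h k)^-1 * (f (v x + h k * (quotient_error i v Dv (h k) x + Dv x)) - f (v x)))
       \* (fun=> phi x)); last by apply/funext => k; rewrite /F/= -qE.
    by apply: cvgM => //; exact: cvg_cst.
  - exact: domi.
  - suff dm : ae_in K (fun x => forall k,
        `|(h k)^-1 * (F (x + h k *: e) - F x) * phi x| <= (S x + `|Dv x|) * (L * B)).
      by move: dm; apply: (@filterS _ _ ae_lebesgue_filter) => x hx k Kx; exact: hx.
    apply: ae_in_sub good => // x Kx [Ix vM Ih hS cv] k.
    have [Iak ak] := Ih k.
    have [_ _ /(_ _ Iak ak) lip] := hL _ Ix vM.
    rewrite normrM mulrA; apply: ler_pM => //.
    rewrite normrM normrV ?unitfE// ler_pdivrMl ?normr_gt0//.
    apply: le_trans lip _; rewrite qE addrAC subrr add0r normrM.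
    rewrite mulrA [L * _]mulrC -!mulrA ler_wpM2l// mulrC ler_wpM2r//.
    exact: Sd.
rewrite E3 -(cvg_unique _ lim1 lim2) ?opprK//.
Qed.

End test.

(** The difference quotients of [f o v] converge to [f'(v) Dv] almost everywhere
    along a sequence of steps, and the Lipschitz bound makes them dominated. *)
Lemma weak_partial_chain :
  weak_partial Omega i (fun x => f (v x)) (fun x => f' (v x) * Dv x).
Proof. by split; [exact: chain_L1loc|exact: weak_partial_chain_test]. Qed.

End chain_rule.

(** * Calculus of weak derivatives *)

Section weak_calculus.
Context {R : realType} {n : nat}.
Local Notation E := 'rV[R]_n.
Local Notation LE := (@lebesgueRV R n).
Local Notation mu := (@lebesgue R n).
Variables (Omega : set E) (i : 'I_n).
Hypothesis oO : open Omega.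

Let mO : measurable (Omega : set LE). Proof. exact: open_lebesgue_measurable. Qed.

Lemma integrable_mul_test (u psi : E -> R) (K : set E) : L1loc Omega u ->
  continuous psi -> compact K -> K `<=` Omega -> (forall x, ~ K x -> psi x = 0) ->
  mu.-integrable (Omega : set LE) (EFin \o ((fun x => u x * psi x) : LE -> R)).
Proof.
move=> ul cpsi cK KO psi0.
have mK : measurable (K : set LE) by exact: compact_lebesgue_measurable.
have [M M0 hM] := continuous_compact_supp_bounded cpsi cK psi0.
have ui := L1loc_integrable oO ul cK KO mK (@subset_refl _ _).
have mpsi : measurable_fun (K : set LE) (psi : LE -> R) by exact: continuous_lebesgue_measurable.
have uK := @integrable_mul_bounded _ LE R mu K mK u psi M mpsi (fun x _ => hM x) ui.
apply: (@integrable_off _ LE R mu K mK Omega (fun x => u x * psi x) mO KO _ uK) => x nK.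
by rewrite psi0// mulr0.
Qed.

Lemma L1loc_comb (a b : R) (f g : E -> R) : L1loc Omega f -> L1loc Omega g ->
  L1loc Omega (fun x => a * f x + b * g x).
Proof.
move=> fl gl.
have [mf _] := fl; have [mg _] := gl.
have mc (c : R) : measurable_fun (Omega : set LE) (fun _ : LE => c) by exact: measurable_cst.
split.
  exact: (@measurable_funD _ LE R Omega _ _ (@measurable_funM _ LE R Omega _ _ (mc a) mf)
    (@measurable_funM _ LE R Omega _ _ (mc b) mg)).
move=> K cK KO.
have mK : measurable (K : set LE) by exact: compact_lebesgue_measurable.
have fi := L1loc_integrable oO fl cK KO mK (@subset_refl _ _).
have gi := L1loc_integrable oO gl cK KO mK (@subset_refl _ _).
have := (@integrableD _ LE R mu K mK _ _
  (@integrableZl _ LE R mu K mK a _ fi) (@integrableZl _ LE R mu K mK b _ gi)).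
by move=> /integrableP[_].
Qed.

Lemma Linftyloc_comb (a b : R) (f g : E -> R) : Linftyloc Omega f -> Linftyloc Omega g ->
  Linftyloc Omega (fun x => a * f x + b * g x).
Proof.
move=> fl gl; split; first exact: (L1loc_comb a b (Linftyloc_L1loc oO fl) (Linftyloc_L1loc oO gl)).1.
move=> K cK KO; have [M hM] := fl.2 K cK KO; have [N hN] := gl.2 K cK KO.
exists (`|a| * M + `|b| * N).
apply: ae_in_sub (ae_in_and hM hN) => // x _ [h1 h2].
by apply: le_trans (ler_normD _ _) _; rewrite !normrM lerD// ler_wpM2l.
Qed.

Lemma Linftyloc_mul (f g : E -> R) : Linftyloc Omega f -> Linftyloc Omega g ->
  Linftyloc Omega (fun x => f x * g x).
Proof.
move=> fl gl; split; first exact: (@measurable_funM _ LE R Omega _ _ fl.1 gl.1).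
move=> K cK KO; have [M hM] := fl.2 K cK KO; have [N hN] := gl.2 K cK KO.
exists (M * N).
apply: ae_in_sub (ae_in_and hM hN) => // x _ [h1 h2].
by rewrite normrM ler_pM.
Qed.

Lemma weak_partial_comb (a b : R) (u w f g : E -> R) : L1loc Omega u -> L1loc Omega w ->
  weak_partial Omega i u f -> weak_partial Omega i w g ->
  weak_partial Omega i (fun x => a * u x + b * w x) (fun x => a * f x + b * g x).
Proof.
move=> ul wl [fl uf] [gl wg]; split; first exact: L1loc_comb.
move=> phi tphi; have [sphi cK KO] := tphi.
have cphi : continuous phi by have [] := sphi [::].
have cdphi : continuous (partial i phi) by have [] := sphi [:: i].
have lin (c1 c2 : E -> R) (psi : E -> R) : continuous psi ->
    (forall x, ~ supp phi x -> psi x = 0) -> L1loc Omega c1 -> L1loc Omega c2 ->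
    \int[mu]_(x in (Omega : set LE)) ((a * c1 x + b * c2 x) * psi x) =
    a * \int[mu]_(x in (Omega : set LE)) (c1 x * psi x) +
    b * \int[mu]_(x in (Omega : set LE)) (c2 x * psi x).
  move=> cpsi psi0 l1 l2.
  have i1 := integrable_mul_test l1 cpsi cK KO psi0.
  have i2 := integrable_mul_test l2 cpsi cK KO psi0.
  rewrite -(@RintegralZl _ LE R mu Omega _ a mO i1) -(@RintegralZl _ LE R mu Omega _ b mO i2).
  have j1 : mu.-integrable (Omega : set LE) (EFin \o (fun x : LE => a * (c1 x * psi x))).
    exact: (@integrableZl _ LE R mu Omega mO a _ i1).
  have j2 : mu.-integrable (Omega : set LE) (EFin \o (fun x : LE => b * (c2 x * psi x))).
    exact: (@integrableZl _ LE R mu Omega mO b _ i2).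
  rewrite -(@RintegralD _ LE R mu Omega _ _ mO j1 j2).
  by apply: eq_Rintegral => x _; rewrite mulrDl !mulrA.
rewrite (lin u w)//; last by move=> x; exact: partial_off_supp.
rewrite (lin f g)//; last by move=> x; exact: off_supp.
by rewrite uf// wg// !mulrN -opprD.
Qed.

Lemma weak_partial_ae (u f g : E -> R) : L1loc Omega g ->
  ae_in Omega (fun x => f x = g x) -> weak_partial Omega i u f -> weak_partial Omega i u g.
Proof.
move=> gl fg [fl uf]; split => // phi tphi; rewrite uf//; congr (- _).
have [sphi _ _] := tphi.
have cphi : continuous phi by have [] := sphi [::].
have mphi : measurable_fun (Omega : set LE) (phi : LE -> R).
  exact: continuous_lebesgue_measurable.
have m1 : measurable_fun (Omega : set LE) (fun x : LE => (f x * phi x)%:E).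
  by apply/measurable_EFinP; exact: (@measurable_funM _ LE R Omega _ _ fl.1 mphi).
have m2 : measurable_fun (Omega : set LE) (fun x : LE => (g x * phi x)%:E).
  by apply/measurable_EFinP; exact: (@measurable_funM _ LE R Omega _ _ gl.1 mphi).
rewrite /Rintegral; congr fine.
apply: (@ae_eq_integral _ LE R mu Omega _ _ mO m1 m2).
by apply: ae_in_sub fg => // x _ ->.
Qed.

(** [f - g] has zero integral against every smooth function supported in a small
    ball, so [bump_duality] applies with the bound 0. *)
Lemma weak_partial_unique (u f g : E -> R) : weak_partial Omega i u f ->
  weak_partial Omega i u g -> ae_in Omega (fun x => f x = g x).
Proof.
move=> [fl uf] [gl ug]; apply: ae_in_local => x Ox.
have /nbhs_ballP[r /= r0 rO] := open_nbhs_nbhs (conj oO Ox).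
pose s := r / 4; have s0 : 0 < s by rewrite divr_gt0.
pose C := closed_ball_ (fun y : E => `|y|) x (s + s).
have cC : compact C by exact: compact_closed_ball_norm.
have CO : C `<=` Omega.
  move=> y hy; apply: rO; rewrite -ball_normE /=.
  by apply: le_lt_trans hy _; rewrite /s; lra.
have BC : ball x (s + s) `<=` C by rewrite -ball_normE /C /closed_ball_ => y /= /ltW.
have BC0 : ball x s `<=` C.
  by apply: subset_trans BC; apply: le_ball; rewrite lerDl ltW.
exists s => //.
have mQ := @measurable_ball_lebesgue R n x s.
have fi := L1loc_integrable oO fl cC CO mQ BC0.
have gi := L1loc_integrable oO gl cC CO mQ BC0.
have di : mu.-integrable (ball x s : set LE) (EFin \o ((fun y => f y - g y) : LE -> R)).
  exact: (@integrableB _ LE R mu _ mQ _ _ fi gi).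
have h : (\int[mu]_(y in (ball x s : set LE)) `|f y - g y|%:E <= 0%:E)%E.
  apply: (bump_duality s0 di) => phi bphi phi1 phi0.
  have t : test_function Omega phi.
    have n0 : `|0 : E| < s by rewrite normr0.
    have := test_function_shift cC CO BC s0 n0 bphi phi0.
    by under eq_fun do rewrite subr0.
  have BO := subset_trans BC0 CO.
  have mphi : measurable_fun (ball x s : set LE) (phi : LE -> R) by exact: bump_measurable.
  have fpi := @integrable_mul_bounded _ LE R mu _ mQ f phi 1 mphi (fun x _ => phi1 x) fi.
  have gpi := @integrable_mul_bounded _ LE R mu _ mQ g phi 1 mphi (fun x _ => phi1 x) gi.
  have off (w : E -> R) y : ~ ball x s y -> w y * phi y = 0 by move=> /phi0 ->; rewrite mulr0.
  have := uf phi t; rewrite ug// => /oppr_inj.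
  rewrite (@Rintegral_off _ LE R mu (ball x s) Omega _ BO (off f)).
  rewrite (@Rintegral_off _ LE R mu (ball x s) Omega _ BO (off g)) => eq.
  rewrite (_ : (fun y => _) = (fun y => f y * phi y - g y * phi y)); last first.
    by apply/funext => y; rewrite mulrBl.
  by rewrite (@RintegralB _ LE R mu _ _ _ mQ fpi gpi) eq subrr.
have md := @integrable_real_measurable _ LE R mu _ _ di.
apply: ae_in_sub (@integral_abs0_ae _ LE R mu _ mQ _ md h) => // y _.
by move=> /eqP; rewrite subr_eq0 => /eqP.
Qed.

End weak_calculus.

Section gradients.
Context {R : realType} {n : nat}.
Local Notation E := 'rV[R]_n.
Variable Omega : set E.
Hypothesis oO : open Omega.

Lemma wgrad_weak_partial (u : E -> R) (i : 'I_n) : W11loc Omega u ->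
  weak_partial Omega i u (fun x => wgrad Omega u x 0 i).
Proof.
move=> [_ [G hG]].
have : weak_gradient Omega u (wgrad Omega u).
  by apply: (@xgetPex _ _ [set G | weak_gradient Omega u G]); exists G.
by move=> /(_ i).
Qed.

Lemma wgrad_ae (u : E -> R) (G : E -> E) : W11loc Omega u ->
  (forall i, weak_partial Omega i u (fun x => G x 0 i)) ->
  ae_in Omega (fun x => wgrad Omega u x = G x).
Proof.
move=> uW hG.
have h : ae_in Omega (fun x => forall k, if insub k is Some i then
    wgrad Omega u x 0 (i : 'I_n) = G x 0 i else True).
  apply: ae_in_all => k; case: insubP => [i _ _|_]; last exact: ae_inW.
  exact: (weak_partial_unique oO (wgrad_weak_partial i uW) (hG i)).
apply: ae_in_sub h => // x _ h; apply/rowP => i.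
by have := h (val i); rewrite valK.
Qed.

End gradients.

Section real_derivatives.
Context {R : realType}.

Lemma is_derive_expansion (f : R -> R) (s l : R) : is_derive s (1 : R) f l ->
  forall e, 0 < e -> exists2 delta, 0 < delta &
  forall t, `|t - s| < delta -> `|f t - f s - l * (t - s)| <= e * `|t - s|.
Proof.
move=> [df dl] e e0.
have cv : (fun h : R => h^-1 *: ((f \o shift s) (h *: (1 : R)) - f s)) @ 0^' --> l.
  by rewrite -dl.
have := cv; move=> /cvgrPdist_le/(_ _ e0)[delta /= d0 hd].
exists delta => // t ts.
have [->|tns] := eqVneq t s; first by rewrite !subrr mulr0 subr0 normr0 mulr0.
have := hd (t - s); rewrite /= distrC subr0 => /(_ ts).
rewrite subr_eq0 => /(_ tns).
rewrite scaler1 subrK /GRing.scale/= => h.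
have n0 : t - s != 0 by rewrite subr_eq0.
have -> : f t - f s - l * (t - s) = - ((l - (t - s)^-1 * (f t - f s)) * (t - s)).
  by field.
by rewrite normrN normrM ler_wpM2r.
Qed.

Lemma derivable_in_is_derive (I : set R) (f f' : R -> R) :
  (forall s, I s -> is_derive s (1 : R) f (f' s)) -> derivable_in I f f'.
Proof.
move=> h s Is e e0; have [delta d0 hd] := is_derive_expansion (h s Is) e0.
by exists delta => // t _; exact: hd.
Qed.

Lemma lipschitz_is_derive (f f' : R -> R) (s t L : R) : s <= t ->
  (forall r, s <= r <= t -> is_derive r (1 : R) f (f' r)) ->
  (forall r, s <= r <= t -> `|f' r| <= L) -> `|f t - f s| <= L * `|t - s|.
Proof.
move=> st df bf.
have cf : {within `[s, t], continuous f}.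
  apply: derivable_within_continuous => r; rewrite in_itv/= => /df[].
  by [].
have hd r : r \in `]s, t[%R -> is_derive r (1 : R) f (f' r).
  by rewrite in_itv/= => /andP[h1 h2]; apply: df; rewrite !ltW.
have [r rI ->] := MVT_segment st hd cf.
by rewrite normrM ler_wpM2r// bf// -in_itv.
Qed.

Lemma locally_lipschitz_is_derive (I : set R) (f f' : R -> R) :
  (forall s t r, I s -> I t -> s <= r <= t -> I r) ->
  (forall s, I s -> is_derive s (1 : R) f (f' s)) ->
  (forall M, exists2 L, 0 <= L & forall s, I s -> `|s| <= M -> `|f s| <= L /\ `|f' s| <= L) ->
  locally_lipschitz_in I f f'.
Proof.
move=> cI df bf M; have [L L0 hL] := bf M.
have wlog_lip s t : s <= t -> I s -> I t -> `|s| <= M -> `|t| <= M -> `|f t - f s| <= L * `|t - s|.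
  move=> st Is It sM tM; apply: (@lipschitz_is_derive f f') => // r rI.
    by apply: df; exact: cI rI.
  have [] // := hL r (cI _ _ _ Is It rI) _.
  case/andP: rI => r1 r2; rewrite ler_norml.
  by rewrite (le_trans _ r1) ?(le_trans r2)//; [move: tM|move: sM]; rewrite ler_norml => /andP[].
exists L => // s Is sM; have [h1 h2] := hL s Is sM; split => // t It tM.
have [st|/ltW ts] := leP s t; first exact: wlog_lip.
by rewrite distrC (distrC t); exact: wlog_lip.
Qed.

Lemma sqr_is_derive (s : R) : is_derive s (1 : R) (fun x => x ^+ 2) (2 * s).
Proof.
have := is_deriveM (is_derive_id s (1 : R)) (is_derive_id s (1 : R)).
by move=> /is_derive_eq; apply; rewrite /GRing.scale/= mulr1 mulrDl mul1r.
Qed.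

Lemma sqr_lipschitz : locally_lipschitz_in (setT : set R) (fun x => x ^+ 2) (fun x => 2 * x).
Proof.
apply: locally_lipschitz_is_derive => // [s _|M]; first exact: sqr_is_derive.
exists (`|M| ^+ 2 + 2 * `|M|) => [|s _ sM]; first by rewrite addr_ge0 ?mulr_ge0.
have sM' : `|s| <= `|M| by apply: le_trans sM _; exact: ler_norm.
split.
  rewrite normrX; apply: le_trans (_ : `|M| ^+ 2 <= _).
    by rewrite ler_pXn2r// nnegrE.
  by rewrite lerDl mulr_ge0.
by rewrite normrM ger0_norm// (le_trans (_ : _ <= 2 * `|M|)) ?ler_wpM2l// lerDr exprn_ge0.
Qed.

Definition dpowR (a s : R) : R := a * s `^ (a - 1).

Lemma powR_is_derive (a s : R) : 0 < s ->
  is_derive s (1 : R) (fun x => x `^ a) (dpowR a s).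
Proof. exact: is_derive1_powR. Qed.

Lemma powR_le_endpoints (b c M s : R) : 0 < c -> c <= s <= M -> s `^ b <= c `^ b + M `^ b.
Proof.
move=> c0 /andP[cs sM]; have s0 : 0 < s by exact: lt_le_trans cs.
have M0 : 0 < M by exact: lt_le_trans sM.
have [b0|b0] := leP 0 b.
  apply: le_trans (_ : M `^ b <= _); last by rewrite lerDr powR_ge0.
  by apply: ge0_ler_powR; rewrite // nnegrE ltW.
apply: le_trans (_ : c `^ b <= _); last by rewrite lerDl powR_ge0.
rewrite -[b]opprK !(powRN _ (- b)) lef_pV2 ?posrE ?powR_gt0//.
by apply: ge0_ler_powR; rewrite // ?nnegrE ?ltW ?oppr_gt0.
Qed.

Lemma powR_lipschitz_away (a c : R) : 0 < c ->
  locally_lipschitz_in `[c, +oo[%classic (fun x => x `^ a) (dpowR a).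
Proof.
move=> c0; apply: locally_lipschitz_is_derive.
- move=> s t r /=; rewrite !in_itv/= !andbT => cs _ /andP[sr _].
  exact: le_trans sr.
- move=> s /=; rewrite in_itv/= andbT => cs; apply: powR_is_derive.
  exact: lt_le_trans cs.
move=> M.
pose B b := c `^ b + M `^ b.
have B0 b : 0 <= B b by rewrite addr_ge0 ?powR_ge0.
exists (B a + `|a| * B (a - 1)); first by rewrite addr_ge0// mulr_ge0.
move=> s /=; rewrite in_itv/= andbT => cs sM.
have csM : c <= s <= M by rewrite cs (le_trans (ler_norm _)).
split.
  rewrite ger0_norm ?powR_ge0//; apply: le_trans (powR_le_endpoints a c0 csM) _.
  by rewrite lerDl mulr_ge0.
rewrite /dpowR normrM (ger0_norm (powR_ge0 _ _)).
apply: le_trans (_ : `|a| * B (a - 1) <= _); last by rewrite lerDr.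
by rewrite ler_wpM2l// powR_le_endpoints.
Qed.

Lemma powR_derivable_away (a c : R) : 0 < c ->
  derivable_in `[c, +oo[%classic (fun x => x `^ a) (dpowR a).
Proof.
move=> c0; apply: derivable_in_is_derive => s /=; rewrite in_itv/= andbT => cs.
by apply: powR_is_derive; exact: lt_le_trans cs.
Qed.

Lemma powR_split (p s : R) : 1 <= p -> 0 <= s -> s `^ p = s * s `^ (p - 1).
Proof.
move=> p1 s0; have [->|sn0] := eqVneq s 0.
  by rewrite mul0r powR0// gt_eqF// (lt_le_trans ltr01).
by rewrite -{2}(powRr1 s0) -powRD ?subrKC ?sn0 ?implybT// addrC subrK.
Qed.

(** The interval contains 0, where [powR_is_derive] does not apply: increments
    from 0 are estimated by writing [s^p = s * s^(p-1)]. *)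
Lemma powR_lipschitz_half (p : R) : 1 <= p ->
  locally_lipschitz_in `[0, +oo[%classic (fun x => x `^ p) (dpowR p).
Proof.
move=> p1 M.
have p0 : 0 < p by exact: lt_le_trans p1.
have q0 : 0 <= p - 1 by rewrite subr_ge0.
pose N := Num.max M 0.
have N0 : 0 <= N by rewrite le_max lexx orbT.
have mon b s : 0 <= b -> 0 <= s -> s <= N -> s `^ b <= N `^ b.
  by move=> b0 s0 sN; apply: ge0_ler_powR; rewrite // nnegrE.
pose L := N `^ p + p * N `^ (p - 1).
have pN0 : 0 <= p * N `^ (p - 1) by rewrite mulr_ge0 ?powR_ge0// ltW.
have L0 : 0 <= L by rewrite addr_ge0 ?powR_ge0.
have bd s : 0 <= s -> s <= N -> `|s `^ p| <= L /\ `|dpowR p s| <= L.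
  move=> s0 sN; split.
    rewrite ger0_norm ?powR_ge0//; apply: le_trans (mon _ _ (ltW p0) s0 sN) _.
    by rewrite lerDl.
  rewrite /dpowR ger0_norm ?mulr_ge0 ?powR_ge0 ?(ltW p0)//.
  apply: le_trans (_ : p * N `^ (p - 1) <= _); last by rewrite lerDr powR_ge0.
  by rewrite ler_wpM2l ?(ltW p0)// mon.
have lip s t : 0 <= s -> s <= t -> t <= N -> `|t `^ p - s `^ p| <= L * `|t - s|.
  move=> s0 st tN; have t0 := le_trans s0 st.
  move: s0; rewrite le_eqVlt => /predU1P[<-|s0].
    rewrite powR0 ?gt_eqF// !subr0 powR_split// normrM mulrC ler_wpM2r//.
    rewrite ger0_norm ?powR_ge0//; apply: le_trans (mon _ _ q0 t0 tN) _.
    apply: le_trans (_ : p * N `^ (p - 1) <= _); last by rewrite lerDr powR_ge0.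
    by rewrite ler_peMl ?powR_ge0.
  apply: (@lipschitz_is_derive (fun x => x `^ p) (dpowR p)) => // r /andP[sr rt].
    by apply: powR_is_derive; exact: lt_le_trans sr.
  have [] // := bd r _ _; first by apply: le_trans sr; exact: ltW.
  exact: le_trans tN.
have leN s : `|s| <= M -> s <= N.
  by move=> sM; rewrite le_max (le_trans (ler_norm s) sM).
exists L => // s /=; rewrite in_itv/= andbT => s0 /leN sN.
have [b1 b2] := bd s s0 sN; split => // t; rewrite in_itv/= andbT => t0 /leN tN.
have [st|/ltW ts] := leP s t; first exact: lip.
by rewrite distrC (distrC t); exact: lip.
Qed.

Lemma powR_derivable_half (p : R) : 1 <= p ->
  derivable_in `[0, +oo[%classic (fun x => x `^ p) (dpowR p).
Proof.
move=> p1 s /=; rewrite in_itv/= andbT le_eqVlt => /predU1P[<-|s0] e e0; last first.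
  by have [delta d0 hd] := is_derive_expansion (powR_is_derive p s0) e0; exists delta => // t _; exact: hd.
have p0 : 0 < p by exact: lt_le_trans p1.
have [pe1|pn1] := eqVneq p 1.
  exists 1 => // t; rewrite in_itv/= andbT => t0 _.
  by rewrite /dpowR pe1 subrr !powRr1// powRr0 !subr0 mulr1 mul1r subrr normr0 mulr_ge0// ltW.
have q0 : 0 < p - 1 by rewrite subr_gt0 lt_neqAle eq_sym pn1.
exists (e `^ (p - 1)^-1); first exact: powR_gt0.
move=> t; rewrite in_itv/= andbT => t0; rewrite !subr0 => tb.
rewrite /dpowR !powR0 ?gt_eqF// mulr0 mul0r !subr0 powR_split// normrM mulrC ler_wpM2r//.
rewrite ger0_norm ?powR_ge0//.
have -> : e = (e `^ (p - 1)^-1) `^ (p - 1).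
  by rewrite -powRrM mulVf ?gt_eqF// powRr1// ltW.
have tb' : t <= e `^ (p - 1)^-1 by rewrite -(ger0_norm t0) ltW.
by apply: ge0_ler_powR; rewrite ?nnegrE ?powR_ge0// ltW.
Qed.

Lemma measurable_dpowR (a : R) : measurable_fun setT (dpowR a).
Proof. by apply: measurable_funM => //; exact: measurable_powR. Qed.

End real_derivatives.

Section products.
Context {R : realType} {n : nat}.
Local Notation E := 'rV[R]_n.
Variables (Omega : set E) (i : 'I_n).
Hypothesis oO : open Omega.

(** Polarization, [4 a b = (a + b)^2 - (a - b)^2], from the chain rule for the
    square. *)
Lemma weak_partial_mul (a b Da Db : E -> R) : Linftyloc Omega a -> Linftyloc Omega b ->
  weak_partial Omega i a Da -> weak_partial Omega i b Db ->
  weak_partial Omega i (fun x => a x * b x) (fun x => a x * Db x + b x * Da x).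
Proof.
move=> al bl aD bD.
have a1 := Linftyloc_L1loc oO al; have b1 := Linftyloc_L1loc oO bl.
have sq (k : R) := weak_partial_chain oO (Linftyloc_comb oO 1 k al bl)
   (ae_inW (fun (x : E) (_ : Omega x) => I))
   (@exprn_measurable R setT 2) (@mulrl_measurable R setT 2) (@sqr_lipschitz R)
   (derivable_in_is_derive (fun s _ => @sqr_is_derive R s))
   (weak_partial_comb oO 1 k a1 b1 aD bD).
have sqL (k : R) : L1loc Omega (fun x => (1 * a x + k * b x) ^+ 2).
  apply: (Linftyloc_L1loc oO).
  exact: (comp_Linftyloc (Linftyloc_comb oO 1 k al bl)
   (ae_inW (fun (x : E) (_ : Omega x) => I)) (@exprn_measurable R setT 2) (@sqr_lipschitz R)).
have := weak_partial_comb oO (4^-1) (- 4^-1) (sqL 1) (sqL (-1)) (sq 1) (sq (-1)).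
have -> : (fun x => 4^-1 * (1 * a x + 1 * b x) ^+ 2 + - 4^-1 * (1 * a x + -1 * b x) ^+ 2) =
    (fun x => a x * b x).
  by apply/funext => x; field.
congr (weak_partial _ _ _ _).
by apply/funext => x; field.
Qed.

Variables (u v Du Dv : E -> R) (c p b : R).
Hypothesis c0 : 0 < c.
Hypothesis p1 : 1 <= p.
Hypothesis uc : ae_in Omega (fun x => c <= u x).
Hypothesis v0 : ae_in Omega (fun x => 0 <= v x).
Hypothesis ul : Linftyloc Omega u.
Hypothesis vl : Linftyloc Omega v.
Hypothesis uD : weak_partial Omega i u Du.
Hypothesis vD : weak_partial Omega i v Dv.

Let uI : ae_in Omega (fun x => `[c, +oo[%classic (u x)).
Proof. by apply: ae_in_sub uc => // x _; rewrite /= in_itv/= andbT. Qed.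

Let vI : ae_in Omega (fun x => `[0, +oo[%classic (v x)).
Proof. by apply: ae_in_sub v0 => // x _; rewrite /= in_itv/= andbT. Qed.

Lemma powR_u_Linftyloc : Linftyloc Omega (fun x => u x `^ b).
Proof.
exact: (comp_Linftyloc ul uI (@measurable_powR R b) (powR_lipschitz_away b c0)).
Qed.

Lemma powR_v_Linftyloc : Linftyloc Omega (fun x => v x `^ p).
Proof.
exact: (comp_Linftyloc vl vI (@measurable_powR R p) (powR_lipschitz_half p1)).
Qed.

Lemma powR_u_weak_partial : weak_partial Omega i (fun x => u x `^ b) (fun x => dpowR b (u x) * Du x).
Proof.
exact: (weak_partial_chain oO ul uI (@measurable_powR R b) (measurable_dpowR b)
  (powR_lipschitz_away b c0) (powR_derivable_away b c0) uD).
Qed.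

Lemma powR_v_weak_partial : weak_partial Omega i (fun x => v x `^ p) (fun x => dpowR p (v x) * Dv x).
Proof.
exact: (weak_partial_chain oO vl vI (@measurable_powR R p) (measurable_dpowR p)
  (powR_lipschitz_half p1) (powR_derivable_half p1) vD).
Qed.

End products.

(** * The pointwise inequality *)

Section picone.
Context {R : realType} {n : nat}.
Local Notation E := 'rV[R]_n.
Implicit Types (a b U V xi : E).

Lemma dotvDr xi a b : dotv xi (a + b) = dotv xi a + dotv xi b.
Proof.
by rewrite /dotv -big_split; apply: eq_bigr => i _; rewrite mxE mulrDr.
Qed.

Lemma dotvZr xi (k : R) a : dotv xi (k *: a) = k * dotv xi a.
Proof.
by rewrite /dotv mulr_sumr; apply: eq_bigr => i _; rewrite mxE mulrCA.
Qed.

Variables (H : E -> R) (p : R).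
Hypothesis H0 : forall z, 0 <= H z.
Hypothesis p1 : 1 <= p.
Hypothesis Hp : positively_homogeneous p H.

Let p0 : 0 < p. Proof. exact: lt_le_trans p1. Qed.

Lemma homogeneous_at0 : H 0 = 0.
Proof.
have := Hp 0 (ltr0Sn R 1); rewrite scaler0 => h.
have h2 : 1 < 2 `^ p :> R.
  apply: (@lt_le_trans _ _ (2 `^ 1)); first by rewrite powRr1// ltr1n.
  by apply: ler_powR => //; rewrite ler1n.
have : (2 `^ p - 1) * H 0 = 0 by rewrite mulrBl mul1r -h subrr.
by move/eqP; rewrite mulf_eq0 subr_eq0 gt_eqF//= => /eqP.
Qed.

(** The subgradient inequality at the points [(1 + h) U] reads
    [h (xi, U) <= ((1 + h)^p - 1) H U]; small [h] of both signs identify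
    [(xi, U)] with the derivative of the right-hand side at [h = 0]. *)
Lemma euler_subdifferential xi U : subdifferential H U xi -> dotv xi U = p * H U.
Proof.
move=> sd.
have key h : -1 < h -> h * dotv xi U <= ((1 + h) `^ p - 1) * H U.
  move=> h1; have l0 : 0 < 1 + h by rewrite -ltrBlDl sub0r.
  have hU : U + h *: U = (1 + h) *: U by rewrite scalerDl scale1r.
  by have := sd (h *: U); rewrite dotvZr hU Hp// mulrBl mul1r.
have bd e : 0 < e -> `|dotv xi U - p * H U| <= e * H U.
  move=> e0.
  have [delta d0 hd] := is_derive_expansion (powR_is_derive p (ltr01 : 0 < (1 : R))) e0.
  pose h := Num.min (delta / 2) (1 / 2).
  have h0 : 0 < h by rewrite lt_min !divr_gt0.
  have hd' : h < delta.
    by apply: le_lt_trans (_ : delta / 2 < _); [rewrite ge_min lexx|rewrite ltr_pdivrMr// ltr_pMr// ltr1n].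
  have h1 : h < 1.
    apply: le_lt_trans (_ : 1 / 2 < _); first by rewrite ge_min lexx orbT.
    by rewrite ltr_pdivrMr// mul1r ltr1n.
  have dE : dpowR p 1 = p by rewrite /dpowR powR1 mulr1.
  have e1 : (1 + h) `^ p - 1 - p * h <= e * h.
    have := hd (1 + h); rewrite addrAC subrr add0r gtr0_norm// => /(_ hd').
    by rewrite powR1 dE; apply: le_trans; exact: ler_norm.
  have e2 : (1 + - h) `^ p - 1 + p * h <= e * h.
    have := hd (1 - h); rewrite addrAC subrr add0r normrN gtr0_norm// => /(_ hd').
    by rewrite powR1 dE mulrN opprK; apply: le_trans; exact: ler_norm.
  have k1 := key h (lt_trans (ltrN10 R) h0).
  have k2 : - h * dotv xi U <= ((1 + - h) `^ p - 1) * H U.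
    by apply: key; rewrite ltrN2.
  rewrite ler_norml; apply/andP; split.
    have : (- h) * dotv xi U <= (e * h - p * h) * H U.
      by apply: le_trans k2 _; rewrite ler_wpM2r// lerBrDr.
    by rewrite -subr_ge0 => h3; rewrite -subr_ge0 -(pmulr_rge0 _ h0); move: h3; lra.
  have : h * dotv xi U <= (e * h + p * h) * H U.
    by apply: le_trans k1 _; rewrite ler_wpM2r// -lerBlDr.
  by rewrite -subr_ge0 => h3; rewrite -subr_ge0 -(pmulr_rge0 _ h0); move: h3; lra.
apply/eqP; rewrite -subr_eq0 -normr_le0; apply/ler_addgt0Pr => e e0.
rewrite add0r; apply: le_trans (bd (e / (H U + 1)) _) _.
  by rewrite divr_gt0// ltr_wpDl.
by rewrite mulrAC ler_pdivrMr ?ltr_wpDl// ler_wpM2l ?(ltW e0)// lerDl.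
Qed.

(** [r] stands for the ratio [v / u].  When it is positive, the claim is the
    subgradient inequality for the increment [r^-1 V - U], multiplied by [r^p].
    When it vanishes, both terms on the left do so, unless [p = 1] and
    [r^(p-1) = 1]: then the increment [V - U] is used. *)
Lemma picone_ratio xi U V (r : R) : subdifferential H U xi -> 0 <= r ->
  (1 - p) * r `^ p * H U + r `^ (p - 1) * dotv xi V <= H V.
Proof.
move=> sd; rewrite le_eqVlt => /predU1P[<-|r0].
  rewrite powR0 ?gt_eqF// mulr0 mul0r add0r.
  have [pe1|pn1] := eqVneq p 1.
    rewrite pe1 subrr powRr0 mul1r.
    have := sd (V - U); rewrite subrKC dotvDr -scaleN1r dotvZr (euler_subdifferential sd) pe1.
    by rewrite mulN1r mul1r lerD2r.
  by rewrite powR0 ?mul0r// subr_eq0.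
have rn : r != 0 by rewrite gt_eqF.
have := sd (r^-1 *: V - U).
rewrite subrKC dotvDr dotvZr -scaleN1r dotvZr (euler_subdifferential sd) Hp ?invr_gt0//.
move=> h.
have rp : r `^ p * (r^-1) `^ p = 1.
  by rewrite -powRM ?invr_ge0 ?ltW// divff// powR1.
have rq : r `^ (p - 1) = r `^ p * r^-1.
  by rewrite -[r^-1]powR_inv1 ?ltW// -powRD// rn implybT.
rewrite rq -subr_ge0.
have -> : H V - ((1 - p) * r `^ p * H U + r `^ p * r^-1 * dotv xi V) =
  r `^ p * ((r^-1) `^ p * H V - H U - (r^-1 * dotv xi V + -1 * (p * H U))).
  rewrite mulrBr mulrBr mulrA rp; ring.
by rewrite mulr_ge0 ?powR_ge0// subr_ge0.
Qed.

Hypothesis Hs : strictly_convex H.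

(** If [p = 1], then [H] is linear on the ray through [V], and if [H V = 0], then
    strict convexity makes [H] negative at the midpoint of [0] and [V]. *)
Lemma strictly_convex_gt0 V : V != 0 -> p != 1 /\ 0 < H V.
Proof.
move=> Vn0.
have half : (0 : R) < 2^-1 /\ (2^-1 : R) < 1 by split; lra.
have [hh0 hh1] := half.
split.
  apply/eqP => pe1.
  have n2 : V != 2 *: V.
    apply/eqP => h; move/eqP: Vn0; apply.
    have : V + V = V by rewrite [RHS]h scaler_nat mulr2n.
    by rewrite -[RHS]addr0 => /addrI.
  have := Hs n2 hh0 hh1.
  have -> : 2^-1 *: V + (1 - 2^-1) *: (2 *: V) = (2^-1 + 1) *: V.
    by rewrite scalerA -scalerDl; congr (_ *: _); field.
  have l1 : (0 : R) < 2^-1 + 1 by lra.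
  have l2 : (0 : R) < 2 by lra.
  by rewrite (Hp V l1) (Hp V l2) pe1 !powRr1 ?ltW//; lra.
rewrite lt_neqAle H0 andbT; apply/eqP => h.
have := Hs Vn0 hh0 hh1.
rewrite scaler0 addr0 homogeneous_at0 -h !mulr0 addr0.
by rewrite ltNge H0.
Qed.

(** Equality here is equality in the subgradient inequality at [r^-1 V]; if this
    point differed from [U], strict convexity would violate the inequality at
    their midpoint.  When [r = 0], it gives [V = 0] by [strictly_convex_gt0]. *)
Lemma picone_ratio_eq xi U V (r : R) : subdifferential H U xi -> 0 <= r ->
  (1 - p) * r `^ p * H U + r `^ (p - 1) * dotv xi V = H V -> V = r *: U.
Proof.
move=> sd; rewrite le_eqVlt => /predU1P[<-|r0].
  rewrite powR0 ?gt_eqF// mulr0 mul0r add0r scale0r => h.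
  apply/eqP/negPn/negP => Vn0.
  have [pn1 HV] := strictly_convex_gt0 Vn0.
  by move: HV; rewrite -h powR0 ?subr_eq0// mul0r ltxx.
have rn : r != 0 by rewrite gt_eqF.
have rp : r `^ p * (r^-1) `^ p = 1.
  by rewrite -powRM ?invr_ge0 ?ltW// divff// powR1.
have rq : r `^ (p - 1) = r `^ p * r^-1.
  by rewrite -[r^-1]powR_inv1 ?ltW// -powRD// rn implybT.
rewrite rq => h.
have eq : dotv xi (r^-1 *: V - U) = H (r^-1 *: V) - H U.
  rewrite dotvDr dotvZr -scaleN1r dotvZr (euler_subdifferential sd) Hp ?invr_gt0//.
  have rp0 : r `^ p != 0 by rewrite gt_eqF// powR_gt0.
  apply: (mulfI rp0); rewrite -h mulrBr !mulrDr.
  have -> : r `^ p * (r^-1 `^ p * ((1 - p) * r `^ p * H U)) + 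
     r `^ p * (r^-1 `^ p * (r `^ p * r^-1 * dotv xi V)) = 
     (r `^ p * r^-1 `^ p) * ((1 - p) * r `^ p * H U + r `^ p * r^-1 * dotv xi V) by ring.
  by rewrite rp; ring.
have [ne|/negPn/eqP ne] := boolP (r^-1 *: V != U); last by rewrite -ne scalerA divff// scale1r.
exfalso.
have hh0 : (0 : R) < 2^-1 by lra.
have hh1 : (2^-1 : R) < 1 by lra.
have st := Hs ne hh0 hh1.
have := sd (2^-1 *: (r^-1 *: V - U)); rewrite dotvZr eq.
have -> : U + 2^-1 *: (r^-1 *: V - U) = 2^-1 *: (r^-1 *: V) + (1 - 2^-1) *: U.
  by rewrite scalerBr scalerBl scale1r addrCA.
move=> h2; have := le_lt_trans h2 (_ : _ < 2^-1 * H (r^-1 *: V) + (1 - 2^-1) * H U - H U).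
rewrite ltrD2r => /(_ st); lra.
Qed.

End picone.

(** * Functions with zero weak gradient *)

Lemma null_sections d1 d2 (T1 : measurableType d1) (T2 : measurableType d2) (R : realType)
  (m1 : {sigma_finite_measure set T1 -> \bar R}) (m2 : {sigma_finite_measure set T2 -> \bar R})
  (D : set (T1 * T2)) : measurable D ->
  (forall y, m1 (ysection D y) = 0%E) -> {ae m1, forall x, m2 (xsection D x) = 0%E}.
Proof.
move=> mD y0; have := indic_fubini_tonelli m1 m2 mD.
rewrite indic_fubini_tonelli_FE// indic_fubini_tonelli_GE//.
rewrite [RHS]integral0_eq => [i0|y _]; last exact: y0.
have mx : measurable_fun setT (m2 \o xsection D) by exact: measurable_fun_xsection.
have i1 : (\int[m1]_x `|(m2 \o xsection D) x| = 0)%E.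
  by rewrite -[RHS]i0; apply: eq_integral => x _; rewrite gee0_abs.
have /(ae_eq_integral_abs _ measurableT mx) [N [mN N0 sN]] := i1.
by exists N; split => // x /= nx; apply: sN => /= h; apply: nx; exact: h.
Qed.

Section borel_sigma_finite.
Context {R : realType}.

(** A constant of its own, on which the sigma-finite structure needed for
    Tonelli's theorem is declared. *)
Definition borel_volume n : set (@borelRV R n) -> \bar R := lebesgue_borel n.

HB.instance Definition _ n := Measure.on (@borel_volume n).

Lemma borel_volume_sigma_finite n : sigma_finite setT (@borel_volume n).
Proof.
exists (fun k => ball (0 : 'rV[R]_n) k%:R).
  apply/seteqP; split => // x _.
  exists (Num.Def.truncn `|x|).+1 => //; rewrite -ball_normE/= sub0r normrN.
  exact: truncnS_gt.
by move=> k; split; [exact: measurable_ballRV|exact: lebesgue_borel_ball_lty].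
Qed.

HB.instance Definition _ n := @Measure_isSigmaFinite.Build _ _ _ (@borel_volume n)
  (@borel_volume_sigma_finite n).

End borel_sigma_finite.

Section invariant_sets.
Context {R : realType} {n : nat}.
Local Notation E := 'rV[R]_n.
Local Notation BE := (@borelRV R n).
Local Notation mu := (@lebesgue R n).

Lemma measurable_add_pair :
  measurable_fun (setT : set (BE * BE)) ((fun p => (p.1 : E) + (p.2 : E)) : BE * BE -> BE).
Proof.
apply: measurable_to_borelRV => i.
have -> : (fun t : BE * BE => ((t.1 : E) + (t.2 : E)) 0 i) =
    (fun t => (t.1 : E) 0 i + (t.2 : E) 0 i) by apply/funext => t; rewrite mxE.
apply: measurable_funD.
- exact: (measurableT_comp (@measurable_coord R n i) (@measurable_fst _ _ BE BE)).
- exact: (measurableT_comp (@measurable_coord R n i) (@measurable_snd _ _ BE BE)).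
Qed.

(** A Borel set that is invariant, up to null sets, under all small
    translations is locally null or conull: by Tonelli, for almost all [x] the
    membership of [x + h] does not depend on almost all [h], and one such [x]
    near the centre suffices. *)
Lemma invariant_set_trivial (B : set BE) (c : E) (r : R) : 0 < r -> measurable B ->
  (forall h : E, ball 0 r h -> ae_in (ball c r) (fun x => B x <-> B (x + h))) ->
  ae_in (ball c (r / 2)) B \/ ae_in (ball c (r / 2)) (~` B).
Proof.
move=> r0 mB inv.
pose m := @borel_volume R n.
pose Q : set BE := ball c r; pose W : set BE := ball (0 : E) r.
have mQ : measurable Q by exact: measurable_ballRV.
have mW : measurable W by exact: measurable_ballRV.
pose B1 : set (BE * BE) := fst @^-1` B.
pose B2 : set (BE * BE) := (fun p => (p.1 : E) + (p.2 : E)) @^-1` B.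
have mB1 : measurable B1.
  by rewrite -[B1]setTI; exact: (@measurable_fst _ _ BE BE).
have mB2 : measurable B2.
  by rewrite -[B2]setTI; exact: measurable_add_pair.
pose D : set (BE * BE) := (Q `*` W) `&` ((B1 `\` B2) `|` (B2 `\` B1)).
have mD : measurable D.
  apply: measurableI; first exact: measurableX.
  by apply: measurableU; exact: measurableD.
have y0 h : m (ysection D h) = 0%E.
  have [Wh|nWh] := pselect (W h); last first.
    rewrite (_ : ysection D h = set0) ?measure0//.
    by apply/seteqP; split => x //; rewrite /ysection/= inE => -[[_ /nWh]].
  have mS : measurable (ysection D h) := measurable_ysection h mD.
  have [N [mN N0 sN]] := inv h Wh.
  rewrite /m /borel_volume -lebesgue_borelE//.
  apply: subset_measure0 mN _ N0; first exact: borel_lebesgue_measurable.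
  move=> x; rewrite /ysection/= inE => -[[Qx _] BB]; apply: sN => /= /(_ Qx)[b1 b2].
  by case: BB => -[/= y1 y2]; [exact/y2/b1|exact/y2/b2].
have [N [mN N0 sN]] := @null_sections _ _ BE BE R m m D mD y0.
have r20 : 0 < r / 2 by rewrite divr_gt0.
have [x Qx xN] : exists2 x, ball c (r / 2) x & ~ N x.
  apply: contrapT => nx; have := @lebesgue_borel_ball_gt0 R n c (r / 2) r20.
  rewrite ltNge => /negP; apply; rewrite -N0.
  apply: le_measure; rewrite ?inE//; first exact: measurable_ballRV.
  by move=> x Qx; apply: contrapT => nN; apply: nx; exists x.
have {xN} x0 : m (xsection D x) = 0%E by apply: contrapT => h; apply: xN; exact: sN.
have mS : measurable (xsection D x) := @measurable_xsection _ _ BE BE D (x : BE) mD.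
have aeW : ae_in W (fun h => B x <-> B (h + x)).
  exists (xsection D x); split; first exact: borel_lebesgue_measurable.
    by rewrite [LHS]lebesgue_borelE.
  move=> h /= /not_implyP[Wh nB]; rewrite /xsection/= inE; split.
    by split => //=; apply: le_ball Qx; lra.
  rewrite /B1 /B2/= (addrC x h); have [Bx|Bx] := pselect (B x); have [Bh|Bh] := pselect (B (h + x)).
  - by exfalso; apply: nB.
  - by left.
  - by right.
  - by exfalso; apply: nB.
have aeQ : ae_in (ball c (r / 2)) (fun y => B x <-> B y).
  have -> : (fun y => B x <-> B y) = (fun y => B x <-> B (y + (- x) + x)).
    by apply/funext => y; rewrite subrK.
  apply: (@ae_in_shift _ _ _ W (- x) (fun h => B x <-> B (h + x))) aeW => y Qy.
  move: Qx Qy; rewrite /W -!ball_normE/= sub0r opprB => Qx Qy.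
  have := ler_normB (c - y) (c - x); rewrite (_ : c - y - (c - x) = x - y); last first.
    by rewrite opprB addrC addrA subrK.
  by move=> /le_lt_trans; apply; lra.
have [Bx|Bx] := pselect (B x); [left|right].
- by apply: ae_in_sub aeQ => // y _ [+ _]; apply.
- by apply: ae_in_sub aeQ => // y _ [_ h] /h.
Qed.

End invariant_sets.

Lemma open_ball_sub {R : realType} {n} (U : set 'rV[R]_n) x : open U -> U x ->
  exists2 d, 0 < d & ball x d `<=` U.
Proof.
by move=> oU Ux; have /nbhs_ballP[d d0 dU] := open_nbhs_nbhs (conj oU Ux); exists d.
Qed.

Section constancy.
Context {R : realType} {n : nat}.
Local Notation E := 'rV[R]_n.
Local Notation LE := (@lebesgueRV R n).
Local Notation BE := (@borelRV R n).
Local Notation mu := (@lebesgue R n).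
Variables (Omega : set E) (z : E -> R).
Hypothesis oO : open Omega.
Hypothesis zl : L1loc Omega z.
Hypothesis zD : forall i, weak_partial Omega i z (fun=> 0).

Let mO : measurable (Omega : set LE). Proof. exact: open_lebesgue_measurable. Qed.

(** [weak_difference] with both [f] and the bound [C] equal to zero. *)
Lemma shift_invariant_coord (i : 'I_n) (K : set E) (c : E) (r s h : R) : compact K ->
  K `<=` Omega -> ball c (r + s) `<=` K -> 0 < r -> 0 < s -> `|h| < s ->
  ae_in (ball c r) (fun x => z (x + h *: delta_mx 0 i) = z x).
Proof.
move=> cK KO BK r0 s0 hs; have [->|h0] := eqVneq h 0.
  by apply: ae_inW => x _; rewrite scale0r addr0.
have BO : ball c r `<=` Omega.
  by move=> x cx; apply/KO/BK; apply: le_ball cx; rewrite lerDl ltW.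
have BhO x : ball c r x -> Omega (x + h *: delta_mx 0 i).
  by move=> cx; apply/KO/BK; apply: shift_in_ball => //; rewrite norm_scale_delta.
have W := @weak_difference R n Omega K i z (fun=> 0) c r s oO cK KO BK r0 s0 zl (zD i) h 0 h0 hs.
have mB : measurable (ball c r : set LE) by exact: measurable_ball_lebesgue.
have {W} W1 : (\int[mu]_(x in ball c r)
    `|h^-1 * (z (x + h *: delta_mx 0 i) - z x) - 0|%:E <= 0)%E.
  apply: W => t _.
  have -> : (\int[mu]_(x in ball c r) `|(0 : R) - 0|%:E = 0)%E; last exact: lexx.
  by apply: integral0_eq => x _; rewrite subrr normr0.
have [mz _] := zl.
have mz1 := @measurable_funS _ _ LE R Omega (ball c r) z mO BO mz.
have mzh := @measurable_fun_shift_on R n (ball c r) Omega (h *: delta_mx 0 i) z mB mO BhO mz.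
have mq := @measurable_quotient _ LE R (ball c r) h^-1 _ _ _ mzh mz1
  (@measurable_cst _ _ LE R (ball c r) (0 : R)).
have := @integral_abs0_ae _ LE R mu (ball c r) mB _ mq W1.
apply: ae_in_sub => // x _; rewrite subr0 => /eqP.
by rewrite mulf_eq0 invr_eq0 (negbTE h0)/= subr_eq0 => /eqP.
Qed.

Let norm_coord_le (h : E) j : `|h 0 j| <= `|h|.
Proof.
rewrite [leRHS]/Num.norm/= mx_normrE; apply/bigmax_geP; right.
by exists (0, j).
Qed.

Let trunc (h : E) (k : nat) : E := \row_(j < n) if (j < k)%N then h 0 j else 0.

Let norm_trunc h k : `|trunc h k| <= `|h|.
Proof.
rewrite [leLHS]/Num.norm/= mx_normrE; apply/bigmax_leP; split => // -[a b] _ /=.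
by rewrite mxE; case: ifP => _; [exact: norm_coord_le|rewrite normr0].
Qed.

(** The translation by [h] is composed of [n] translations along the axes, of
    which the first ones together move a point by at most [|h|].  Hence the points
    at which the last factor acts are in the ball of radius [r + r], and they are
    translated in the ball of radius [r + r + r]. *)
Lemma shift_invariant (K : set E) (c : E) (r : R) (h : E) : compact K ->
  K `<=` Omega -> ball c (r + r + r) `<=` K -> 0 < r -> `|h| < r ->
  ae_in (ball c r) (fun x => z (x + h) = z x).
Proof.
move=> cK KO BK r0 hr.
suff trk k : ae_in (ball c r) (fun x => z (x + trunc h k) = z x).
  have := trk n; rewrite (_ : trunc h n = h)//.
  by apply/rowP => j; rewrite mxE ltn_ord.
elim: k => [|k IH].
  apply: ae_inW => x _; rewrite (_ : trunc h 0 = 0) ?addr0//.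
  by apply/rowP => j; rewrite !mxE.
have [kn|kn] := ltnP k n; last first.
  rewrite (_ : trunc h k.+1 = trunc h k)//; apply/rowP => j; rewrite !mxE.
  by rewrite !(leq_trans (ltn_ord j))// leqW.
pose j := Ordinal kn.
have E1 : trunc h k.+1 = trunc h k + h 0 j *: delta_mx 0 j.
  apply/rowP => i; rewrite !mxE eqxx/= ltnS leq_eqVlt.
  have [ik|ik] := eqVneq (i : nat) k.
    have <- : i = j by exact: val_inj.
    by rewrite eqxx/= ik ltnn add0r mulr1.
  have /negbTE -> : i != j by apply: contra ik => /eqP ->.
  by rewrite mulr0 addr0.
have hj : `|h 0 j| < r by exact: le_lt_trans (norm_coord_le h j) hr.
have r2 : 0 < r + r by rewrite addr_gt0.
have step := shift_invariant_coord j cK KO BK r2 r0 hj.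
have := @ae_in_shift _ _ (ball c r) _ (trunc h k) _ _ step => step'.
have {step'} step1 : ae_in (ball c r)
    (fun x => z (x + trunc h k + h 0 j *: delta_mx 0 j) = z (x + trunc h k)).
  by apply: step' => x cx; apply: shift_in_ball => //; exact: le_lt_trans (norm_trunc h k) hr.
apply: ae_in_sub (ae_in_and IH step1) => // x _ [h1 h2].
by rewrite E1 addrA h2.
Qed.

(** A sublevel set agrees almost everywhere with a Borel set, which inherits its
    invariance under small translations. *)
Lemma locally_below_or_above (a : R) (x0 : E) : Omega x0 -> exists2 r, 0 < r &
  ae_in (ball x0 r) (fun x => z x <= a) \/ ae_in (ball x0 r) (fun x => ~ z x <= a).
Proof.
move=> Ox; have [d d0 dO] := open_ball_sub oO Ox.
pose r := d / 4; have r0 : 0 < r by rewrite divr_gt0.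
pose K := closed_ball_ (fun y : E => `|y|) x0 (r + r + r).
have KO : K `<=` Omega.
  by move=> y Ky; apply: dO; rewrite -ball_normE/=; apply: le_lt_trans Ky _; rewrite /r; lra.
have B3 : ball x0 (r + r + r) `<=` K.
  by move=> y; rewrite -ball_normE/= => /ltW.
have B2O : ball x0 (r + r) `<=` Omega.
  by move=> y By; apply/KO/B3; apply: le_ball By; rewrite lerDl ltW.
have mB2 : measurable (ball x0 (r + r) : set LE) by exact: measurable_ball_lebesgue.
pose A : set LE := ball x0 (r + r) `&` [set x | z x <= a].
have mA : measurable A.
  have [mz _] := zl; have := @measurable_funS _ _ LE R Omega _ z mO B2O mz.
  move=> /(_ mB2 `]-oo, a]%classic (measurable_itv _)).
  by rewrite (_ : z @^-1` _ = [set x | z x <= a])//; apply/seteqP; split => x /=; rewrite in_itv.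
have Alty : (mu A < +oo)%E.
  apply: le_lt_trans (lebesgue_ball_lty x0 (r + r)); apply: le_measure; rewrite ?inE//.
  by move=> x [].
have [B [mB AB BA0]] := lebesgue_measurable_borel mA Alty.
have BP : ae_in (ball x0 (r + r)) (fun x => B x <-> z x <= a).
  exists (B `\` A); split => //.
    by apply: measurableD => //; exact: borel_lebesgue_measurable.
  move=> x /= /not_implyP[Bx nB]; split; last first.
    by move=> [_ /= za]; apply: nB; split => // _; apply: AB.
  apply: contrapT => nBx; apply: nB; split => // za.
  by exfalso; apply: nBx; apply: AB.
have BP1 : ae_in (ball x0 r) (fun x => B x <-> z x <= a).
  by apply: ae_in_sub BP => // x Bx; apply: le_ball Bx; rewrite lerDl ltW.
have inv h : ball 0 r h -> ae_in (ball x0 r) (fun x => B x <-> B (x + h)).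
  move=> Bh; have hr : `|h| < r by move: Bh; rewrite -ball_normE/= sub0r normrN.
  have BPh : ae_in (ball x0 r) (fun x => B (x + h) <-> z (x + h) <= a).
    apply: (@ae_in_shift _ _ _ (ball x0 (r + r)) h (fun x => B x <-> z x <= a)) BP => x Bx.
    exact: shift_in_ball.
  have zh := shift_invariant (@compact_closed_ball_norm R n _ _) KO B3 r0 hr.
  apply: ae_in_sub (ae_in_and BP1 (ae_in_and BPh zh)) => // x _ [h1 [h2 h3]].
  by rewrite h1 h2 h3.
have r20 : 0 < r / 2 by rewrite divr_gt0.
have BP2 : ae_in (ball x0 (r / 2)) (fun x => B x <-> z x <= a).
  by apply: ae_in_sub BP1 => // x Bx; apply: le_ball Bx; lra.
exists (r / 2) => //; have [H|H] := invariant_set_trivial r0 mB inv; [left|right].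
- by apply: ae_in_sub (ae_in_and BP2 H) => // x _ [h1 h2]; apply/h1.
- by apply: ae_in_sub (ae_in_and BP2 H) => // x _ [h1 h2] /h1.
Qed.

Lemma ae_in_open_absurd (U : set E) : open U -> U !=set0 -> ae_in U (fun=> False) -> False.
Proof.
move=> oU [x Ux] [N [mN N0 sN]].
have [d d0 dU] := open_ball_sub oU Ux.
have := lebesgue_ball_gt0 x d0; rewrite ltNge => /negP; apply; rewrite -N0.
apply: le_measure; rewrite ?inE//; first exact: measurable_ball_lebesgue.
by move=> y By; apply: sN => /= /(_ (dU _ By)).
Qed.

(** The points near which [P] holds almost everywhere, and those near which its
    negation does, form two open sets that cover [U]; they are disjoint because
    balls have positive measure. *)
Lemma connected_ae_dichotomy (U : set E) (P : E -> Prop) : open U -> connected U ->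
  (forall x, U x -> exists2 r, 0 < r &
     ae_in (ball x r) P \/ ae_in (ball x r) (fun y => ~ P y)) ->
  ae_in U P \/ ae_in U (fun x => ~ P x).
Proof.
move=> oU cU loc.
pose V (Q : E -> Prop) : set E := U `&` [set x | exists2 r, 0 < r & ae_in (ball x r) Q].
have oV Q : open (V Q).
  rewrite openE => x [Ux [r r0 rQ]].
  have [d d0 dU] := open_ball_sub oU Ux.
  apply/nbhs_ballP; exists (Num.min d (r / 2)) => /=; first by rewrite lt_min d0 divr_gt0.
  move=> y By; split; first by apply: dU; apply: le_ball By; rewrite ge_min lexx.
  exists (r / 2); first by rewrite divr_gt0.
  apply: ae_in_sub rQ => // t Bt; rewrite (splitr r); apply: ball_triangle Bt.
  by apply: le_ball By; rewrite ge_min lexx orbT.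
have VU Q : V Q = U -> ae_in U Q.
  by move=> VQ; apply: ae_in_local => x; rewrite -VQ => -[].
have [V0|V0] := pselect (V P !=set0); [left|right]; apply: VU.
  apply: cU => //; first by exists (V P) => //; apply/seteqP; split => x; [case|case=> _].
  exists (~` V (fun y => ~ P y)); first exact: open_closedC.
  apply/seteqP; split => [x [Ux [r r0 rP]]|x [Ux nV]]; split => //.
    move=> -[_ [s s0 sP]]; apply: (@ae_in_open_absurd (ball x (Num.min r s))).
    - exact: ball_open.
    - by exists x; apply: ballxx; rewrite lt_min r0.
    - have h1 : ae_in (ball x (Num.min r s)) P.
        by apply: ae_in_sub rP => // y; apply: le_ball; rewrite ge_min lexx.
      have h2 : ae_in (ball x (Num.min r s)) (fun y => ~ P y).
        by apply: ae_in_sub sP => // y; apply: le_ball; rewrite ge_min lexx orbT.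
      by apply: ae_in_sub (ae_in_and h1 h2) => // y _ [] /[swap].
  by have [r r0 [rP|rP]] := loc x Ux; [exists r|exfalso; apply: nV; split => //; exists r].
apply/seteqP; split => [x []//|x Ux]; split => //.
by have [r r0 [rP|rP]] := loc x Ux; [exfalso; apply: V0; exists x; split => //; exists r|exists r].
Qed.

(** The constant is the infimum of the levels [a] such that [z <= a] almost
    everywhere; the dichotomy puts [z] above all the smaller levels. *)
Lemma ae_constant : connected Omega -> exists k, ae_in Omega (fun x => z x = k).
Proof.
move=> cO; have [Oe|/set0P O0] := eqVneq Omega set0.
  by exists 0; apply: ae_inW => x; rewrite Oe.
have dich a := connected_ae_dichotomy oO cO (@locally_below_or_above a).
pose S := [set a | ae_in Omega (fun x => z x <= a)].
have S0 : S !=set0.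
  apply: contrapT => nS; apply: (ae_in_open_absurd oO O0).
  have nk (k : nat) : ae_in Omega (fun x => ~ z x <= k%:R).
    by have [h|//] := dich k%:R; exfalso; apply: nS; exists k%:R.
  apply: ae_in_sub (ae_in_all nk) => // x _ /(_ (Num.Def.truncn `|z x|).+1); apply.
  by apply: le_trans (ler_norm _) _; apply/ltW; exact: truncnS_gt.
have Sup a b : a <= b -> S a -> S b.
  by move=> ab; apply: ae_in_sub => // x _ /le_trans; apply.
have Slb : has_lbound S.
  apply: contrapT => nS; apply: (ae_in_open_absurd oO O0).
  have nk (k : nat) : ae_in Omega (fun x => z x <= - k%:R).
    apply: contrapT => nk; apply: nS; exists (- k%:R) => a Sa.
    by rewrite leNgt; apply/negP => ak; apply: nk; exact: Sup (ltW ak) Sa.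
  apply: ae_in_sub (ae_in_all nk) => // x _ /(_ (Num.Def.truncn `|z x|).+1).
  have := truncnS_gt `|z x|; have := ler_norm (- z x); rewrite normrN; lra.
exists (inf S).
have up (k : nat) : ae_in Omega (fun x => z x <= inf S + k.+1%:R^-1).
  have k0 : 0 < k.+1%:R^-1 :> R by rewrite invr_gt0.
  have [a Sa ak] := inf_adherent k0 (conj S0 Slb).
  exact: Sup (ltW ak) Sa.
have lo (k : nat) : ae_in Omega (fun x => ~ z x <= inf S - k.+1%:R^-1).
  have [h|//] := dich (inf S - k.+1%:R^-1); exfalso.
  have := ge_inf Slb h; rewrite leNgt => /negP; apply.
  by rewrite gtrBl invr_gt0.
apply: ae_in_sub (ae_in_and (ae_in_all up) (ae_in_all lo)) => // x _ [hu hl].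
apply/eqP; rewrite eq_le; apply/andP; split; apply/ler_addgt0Pr => e e0.
  have [k _ /(_ k (leqnn k)) ke] := near_infty_natSinv_lt (PosNum e0).
  by apply: le_trans (hu k) _; rewrite lerD2l ltW.
have [k _ /(_ k (leqnn k)) /= ke] := near_infty_natSinv_lt (PosNum e0).
have h : inf S - k.+1%:R^-1 < z x by rewrite ltNge; apply/negP/hl.
by rewrite -lerBlDr; apply: le_trans (ltW h); rewrite lerD2l lerN2 ltW.
Qed.

End constancy.

(** * The Picone inequality *)

Section picone_pointwise.
Context {R : realType} {n : nat}.
Local Notation E := 'rV[R]_n.
Variables (H : E -> R) (p : R).
Hypothesis H0 : forall z, 0 <= H z.
Hypothesis p1 : 1 <= p.
Hypothesis Hp : positively_homogeneous p H.

(** [s] and [t] are the values of [v] and [u], and the vector paired with [xi]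
    is the gradient that the chain and Leibniz rules give for the quotient of
    [v] to the [p] by [u] to the [p - 1]. *)
Lemma picone_pairing (xi U V : E) (s t : R) : subdifferential H U xi -> 0 <= s -> 0 < t ->
  p^-1 * dotv xi (s `^ p *: (dpowR (- (p - 1)) t *: U) +
                  t `^ (- (p - 1)) *: (dpowR p s *: V)) =
  (1 - p) * (s / t) `^ p * H U + (s / t) `^ (p - 1) * dotv xi V.
Proof.
move=> sd s0 t0; have p0 : p != 0 by rewrite gt_eqF// (lt_le_trans _ p1).
have inv_pow q : (t^-1) `^ q = t `^ (- q).
  by rewrite -powR_inv1 ?ltW// -powRrM mulN1r.
rewrite dotvDr !dotvZr (euler_subdifferential H0 Hp sd).
rewrite !powRM ?invr_ge0 ?(ltW t0)// !inv_pow /dpowR.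
by rewrite (_ : - (p - 1) - 1 = - p); [field|ring].
Qed.

End picone_pointwise.

Lemma ess_inf_in_ge {R : realType} {n} (Omega : set 'rV[R]_n) (f : 'rV[R]_n -> R) (a : R) :
  (a%:E <= ess_inf_in Omega f)%E -> ae_in Omega (fun x => a <= f x).
Proof.
move=> /(@ess_infP _ (@lebesgueRV R n) R (lebesgue n)).
apply: (@filterS _ _ ae_lebesgue_filter) => x + Ox.
by rewrite /patch mem_set// lee_fin.
Qed.

Section quotient.
Context {R : realType} {n : nat}.
Local Notation E := 'rV[R]_n.
Variables (Omega : set E) (p c : R) (u v : E -> R).
Hypothesis oO : open Omega.
Hypothesis p1 : 1 <= p.
Hypothesis c0 : 0 < c.
Hypothesis uc : ae_in Omega (fun x => c <= u x).
Hypothesis v0 : ae_in Omega (fun x => 0 <= v x).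
Hypotheses (uW : W11loc Omega u) (ul : Linftyloc Omega u).
Hypotheses (vW : W11loc Omega v) (vl : Linftyloc Omega v).
Local Notation U := (wgrad Omega u).
Local Notation V := (wgrad Omega v).

(** What the chain and Leibniz rules give for [v^p u^(1-p)]. *)
Definition picone_gradient : E -> E := fun x =>
  v x `^ p *: (dpowR (- (p - 1)) (u x) *: U x) + u x `^ (- (p - 1)) *: (dpowR p (v x) *: V x).

Let w (x : E) := v x `^ p / u x `^ (p - 1).

Let wE : w = (fun x => v x `^ p * u x `^ (- (p - 1))).
Proof. by apply/funext => x; rewrite powRN. Qed.

Lemma picone_quotient_partial i : weak_partial Omega i w (fun x => picone_gradient x 0 i).
Proof.
rewrite wE.
have := weak_partial_mul oO (powR_v_Linftyloc p1 v0 vl) (powR_u_Linftyloc (- (p - 1)) c0 uc ul)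
  (powR_v_weak_partial oO p1 v0 vl (wgrad_weak_partial i vW))
  (powR_u_weak_partial oO (- (p - 1)) c0 uc ul (wgrad_weak_partial i uW)).
set f := (fun x => _ + _); have -> // : f = fun x => picone_gradient x 0 i.
by apply/funext => x; rewrite !mxE.
Qed.

Lemma picone_quotient_W11loc : W11loc Omega w.
Proof.
split; last by exists picone_gradient => i; exact: picone_quotient_partial.
rewrite wE; apply: (Linftyloc_L1loc oO).
exact: (Linftyloc_mul (powR_v_Linftyloc p1 v0 vl) (powR_u_Linftyloc (- (p - 1)) c0 uc ul)).
Qed.

Lemma picone_quotient_wgrad : ae_in Omega (fun x => wgrad Omega w x = picone_gradient x).
Proof. exact: wgrad_ae picone_quotient_W11loc picone_quotient_partial. Qed.

(** The hypothesis says that the weak gradient of [v / u] vanishes. *)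
Lemma proportional_of_gradient : connected Omega ->
  ae_in Omega (fun x => V x = (v x / u x) *: U x) ->
  exists k, ae_in Omega (fun x => v x = k * u x).
Proof.
move=> cO VU.
have ulN := powR_u_Linftyloc (-1) c0 uc ul.
have zl : L1loc Omega (fun x => v x * u x `^ (-1)).
  by apply: (Linftyloc_L1loc oO); exact: (Linftyloc_mul vl ulN).
have zD i : weak_partial Omega i (fun x => v x * u x `^ (-1)) (fun=> 0).
  apply: (weak_partial_ae oO (L1loc_cst Omega 0) _ (weak_partial_mul oO vl ulN
    (wgrad_weak_partial i vW)
    (powR_u_weak_partial oO (-1) c0 uc ul (wgrad_weak_partial i uW)))).
  apply: ae_in_sub (ae_in_and VU uc) => // x _ [-> cu].
  have ux : 0 < u x by exact: lt_le_trans cu.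
  have ux0 : u x != 0 by rewrite gt_eqF.
  have u1 : u x `^ (-1) = (u x)^-1 by rewrite powR_inv1 ?ltW.
  have u2 : u x `^ (-1 - 1) = (u x)^-1 * (u x)^-1 by rewrite powRD ?u1 ?ux0 ?implybT.
  by rewrite mxE /dpowR u2 u1; field.
have [k zk] := ae_constant oO zl zD cO.
exists k; apply: ae_in_sub (ae_in_and zk uc) => // x _ [<- cu].
have ux : 0 < u x by exact: lt_le_trans cu.
by rewrite powR_inv1 ?ltW// mulfVK// gt_eqF.
Qed.

End quotient.

Theorem lemma5p1 (R : realType) (N : nat) (Omega : set 'rV[R]_N)
    (H : 'rV[R]_N -> R) (p : R) (u v : 'rV[R]_N -> R)
    (xi : 'rV[R]_N -> 'rV[R]_N)
    (Omega_open : open Omega)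
    (H_ge0 : forall z, 0 <= H z)
    (H_convex : convex_function setT H)
    (p_ge1 : 1 <= p)
    (H_homogeneous : positively_homogeneous p H)
    (u_W11loc : W11loc Omega u) (u_Linftyloc : Linftyloc Omega u)
    (v_W11loc : W11loc Omega v) (v_Linftyloc : Linftyloc Omega v)
    (u_inf : (0 < ess_inf_in Omega u)%E)
    (v_inf : (0 <= ess_inf_in Omega v)%E)
    (xi_measurable : forall i, lebesgue_measurable Omega (fun x => xi x 0 i))
    (xi_subdifferential :
      ae_in Omega (fun x => subdifferential H (wgrad Omega u x) (xi x))) :
  let w := fun x => v x `^ p / u x `^ (p - 1) in
  [/\ W11loc Omega w,
      ae_in Omega (fun x =>
        p^-1 * dotv (xi x) (wgrad Omega w x) <= H (wgrad Omega v x)) &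
      strictly_convex H -> connected Omega ->
      ae_in Omega (fun x =>
        p^-1 * dotv (xi x) (wgrad Omega w x) = H (wgrad Omega v x)) ->
      ~ ae_in Omega (fun x => v x = 0) ->
      exists2 k : R, 0 < k & ae_in Omega (fun x => v x = k * u x)].
Proof.
move=> w.
have [c c0 uc] : exists2 c, 0 < c & ae_in Omega (fun x => c <= u x).
  have [c c0 cu] : exists2 c : R, 0 < c & (c%:E <= ess_inf_in Omega u)%E.
    move: u_inf; case: (ess_inf_in Omega u) => [r| |] //; first by exists r.
    by exists 1; rewrite ?leey.
  by exists c => //; exact: ess_inf_in_ge.
have v0 := ess_inf_in_ge v_inf.
have wW := picone_quotient_W11loc Omega_open p_ge1 c0 uc v0
  u_W11loc u_Linftyloc v_W11loc v_Linftyloc.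
have pairing : ae_in Omega (fun x => [/\ subdifferential H (wgrad Omega u x) (xi x),
    0 <= v x / u x & p^-1 * dotv (xi x) (wgrad Omega w x) =
      (1 - p) * (v x / u x) `^ p * H (wgrad Omega u x) +
      (v x / u x) `^ (p - 1) * dotv (xi x) (wgrad Omega v x)]).
  have wG := picone_quotient_wgrad Omega_open p_ge1 c0 uc v0
    u_W11loc u_Linftyloc v_W11loc v_Linftyloc.
  apply: ae_in_sub (ae_in_and (ae_in_and wG xi_subdifferential) (ae_in_and uc v0)) => //.
  move=> x _ [[-> sd] [cu vx]]; have ux := lt_le_trans c0 cu.
  by split => //; [rewrite divr_ge0// ltW|exact: picone_pairing].
split=> // [|Hs cO eqH vn0].
  apply: ae_in_sub pairing => // x _ [sd r0 ->].
  exact: picone_ratio.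
have VU : ae_in Omega (fun x => wgrad Omega v x = (v x / u x) *: wgrad Omega u x).
  apply: ae_in_sub (ae_in_and pairing eqH) => // x _ [[sd r0 ->] e].
  exact: (picone_ratio_eq H_ge0 p_ge1 H_homogeneous Hs sd r0 e).
have [k vk] := proportional_of_gradient Omega_open c0 uc u_W11loc u_Linftyloc v_W11loc v_Linftyloc cO VU.
exists k => //; rewrite ltNge; apply/negP => k0; apply: vn0.
apply: ae_in_sub (ae_in_and vk (ae_in_and uc v0)) => // x _ [vkx [cu vx]].
apply/eqP; rewrite eq_le vx andbT vkx mulr_le0_ge0// ltW//.
exact: lt_le_trans cu.
Qed.
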